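(* Let $k,\ell,m,n$ be nonnegative integers with $n\ge2$, $m$ even and $k+\ell+m=n$. The stacked twist map $$\theta:\mathrm{Gr}_{\ge m}(k,n)\times\mathrm{Gr}^{\perp}_{>0}(k+m,n)\to\mathrm{Gr}^{\perp}_{>0}(\ell+m,n)\times\mathrm{Gr}_{\ge m}(\ell,n)$$ descends to a homeomorphism $\tilde\theta:\mathcal A_{n,k,\ge m}\to\mathcal A_{n,\ell,\ge m}$ such that $\tilde\theta\circ\mathcal Z=\mathcal Z^{\mathrm{op}}\circ\theta$. The map $\tilde\theta$ restricts to homeomorphisms $\tilde\theta:\mathcal A^{>0}_{k+f}\to\mathcal A^{>0}_{\ell+f^{-1}}$ for each $f\in\tilde S_n(-k,\ell)$.
   Context: For integers $a,b\ge0$, $\tilde S_n(-a,b)$ is the set of bijections $f:\mathbb Z\to\mathbb Z$ with $f(i+n)=f(i)+n$ for all $i$, $\sum_{i=1}^n(f(i)-i)=0$, and $i-a\le f(i)\le i+b$ for all $i$. $\mathrm{Gr}(r,n)$ is the Grassmannian of $r$-dimensional subspaces of $\mathbb R^n$, represented as row spans of full rank $r\times n$ matrices. $\mathrm{Gr}_{\ge0}(r,n)$ (resp. $\mathrm{Gr}_{>0}(r,n)$): elements representable by a matrix with all maximal minors $\ge0$ (resp. $>0$). For $f\in\tilde S_n(-r,n-r)$, the positroid cell $\Pi^{>0}_{r+f}$ is the set of $V\in\mathrm{Gr}_{\ge0}(r,n)$ such that for all integers $a<b$ the rank of the matrix with columns $V(a),\dots,V(b-1)$ (indices modulo $n$)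 equals $\#\{i<a\mid a\le f(i)+r<b\}$. For $0\le m\le n-r$, $\mathrm{Gr}_{\ge m}(r,n):=\bigsqcup_{f\in\tilde S_n(-r,n-r-m)}\Pi^{>0}_{r+f}$. Also $\mathrm{Gr}^{\perp}_{>0}(r,n):=\{Z^\perp\mid Z\in\mathrm{Gr}_{>0}(r,n)\}\subset\mathrm{Gr}(n-r,n)$. Stacked twist map: for a $k\times n$ matrix $V$ and an $\ell\times n$ matrix $W$, let $U$ be the $(k+\ell)\times n$ matrix with $V$ on top of $W$, columns extended to $j\in\mathbb Z$ by $U(j+n)=(-1)^{k-1}U(j)$. When for all $j$ the vectors $U(j-\ell),\dots,U(j+k-1)$ form a basis of $\mathbb R^{k+\ell}$ (this is the case when $V\in\mathrm{Gr}_{\ge m}(k,n)$, $W\in\mathrm{Gr}^\perp_{>0}(k+m,n)$), let $\tilde U(j)$ be the unique vector with $\langle\tilde U(j),U(j-\ell)\rangle=(-1)^j$ and $\langle\tilde U(j),U(i)\rangle=0$ for $j-\ell+1\le i\le j+k-1$; let $\tilde U$ have columns $\tilde U(1),\dots,\tilde U(n)$, let $\tilde W$ be its first $k$ rows and $\tilde V$ its last $\ell$ rows, and set $\theta(V,W)=(\tilde W,\tilde V)$, regarded as a map on pairs of row spans. $\mathrm{Fl}(a,b;n)$ is the two-step flag variety of pairs of subspaces $W\subset U\subset\mathbb R^n$ with $\dim W=a$, $\dim U=b$. Define $$\mathcal A_{n,k,\ge m}=\{(W,U)\mid W\in\mathrm{Gr}^{\perp}_{>0}(k+m,n),\ U=\mathrm{span}(V,W)\text{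 for some }V\in\mathrm{Gr}_{\ge m}(k,n)\}\subset\mathrm{Fl}(\ell,k+\ell;n),$$ and $\mathcal A_{n,\ell,\ge m}\subset\mathrm{Fl}(k,k+\ell;n)$ by exchanging $k$ and $\ell$. The map $\mathcal Z:\mathrm{Gr}_{\ge m}(k,n)\times\mathrm{Gr}^\perp_{>0}(k+m,n)\to\mathcal A_{n,k,\ge m}$ is $(V,W)\mapsto(W,\mathrm{span}(V,W))$, and $\mathcal Z^{\mathrm{op}}:\mathrm{Gr}^\perp_{>0}(\ell+m,n)\times\mathrm{Gr}_{\ge m}(\ell,n)\to\mathcal A_{n,\ell,\ge m}$ is $(\tilde W,\tilde V)\mapsto(\tilde W,\mathrm{span}(\tilde W,\tilde V))$. For $f\in\tilde S_n(-k,\ell)$, $\mathcal A^{>0}_{k+f}:=\mathcal Z(\Pi^{>0}_{k+f}\times\mathrm{Gr}^\perp_{>0}(k+m,n))$ and $\mathcal A^{>0}_{\ell+f^{-1}}:=\mathcal Z^{\mathrm{op}}(\mathrm{Gr}^\perp_{>0}(\ell+m,n)\times\Pi^{>0}_{\ell+f^{-1}})$. *)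

(* Defs.v *)
From HB Require Import structures.
From mathcomp Require Import all_boot all_order all_algebra.
From mathcomp Require Import all_classical all_reals all_analysis.

Set Implicit Arguments.
Unset Strict Implicit.
Unset Printing Implicit Defensive.

Import Order.TTheory GRing.Theory Num.Theory.
Import numFieldNormedType.Exports.

Local Open Scope classical_set_scope.
Local Open Scope ring_scope.

Section AffinePermutations.

(* [affine_perm n a b] is the set $\tilde S_n(-a,b)$. *)
Definition affine_perm (n a b : nat) : set (int -> int) :=
  [set f | [/\ bijective f,
               forall i, f (i + n%:Z) = f i + n%:Z,
               \sum_(1 <= i < n.+1) (f i%:Z - i%:Z) = 0
             & forall i, i - a%:Z <= f i <= i + b%:Z]].

End AffinePermutations.

Section Homeomorphisms.

Definition homeo_between (S T : topologicalType) (A : set S) (B : set T)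
    (f : S -> T) : Prop :=
  [/\ set_bij A B f,
      {within A, continuous f}
    & exists g : T -> S,
        {within B, continuous g} /\ (forall x, A x -> g (f x) = x)].

End Homeomorphisms.

Section Subspaces.
Variables (R : realType) (n : nat).

(* All linear subspaces of R^n, of every dimension: the disjoint union of the
   Grassmannians Gr(r, n), r = 0, ..., n. *)
Definition subspaces : Type := {vspace 'rV[R]_n}.

HB.instance Definition _ := Choice.copy subspaces {vspace 'rV[R]_n}.

Definition rowspan (r : nat) (M : 'M[R]_(r, n)) : subspaces :=
  <<[seq row i M | i : 'I_r]>>%VS.

(* [M] is a full rank r x n matrix whose row span is [V]. *)
Definition represents (r : nat) (M : 'M[R]_(r, n)) (V : subspaces) : Prop :=
  row_free M /\ rowspan M = V.

(* Each Gr(r, n) carries the quotient topology from the full rank r x n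
   matrices, and [subspaces] the disjoint union topology. As every Gr(r, n) is
   open, the topology induced on it is this quotient topology. *)
Definition subspaces_open (A : set subspaces) : Prop :=
  forall r : nat,
    @open (subspace [set M : 'M[R]_(r, n) | row_free M])
          [set M | A (rowspan (M : 'M[R]_(r, n)))].

Fact subspaces_openT : subspaces_open setT.
Proof. by move=> r; exact: openT. Qed.

Fact subspaces_openI : setI_closed subspaces_open.
Proof. by move=> A B oA oB r; exact: openI (oA r) (oB r). Qed.

Fact subspaces_open_bigU (I : Type) (f : I -> set subspaces) :
  (forall i, subspaces_open (f i)) -> subspaces_open (\bigcup_i f i).
Proof.
by move=> of_ r; rewrite -[X in open X]/(\bigcup_i [set M | f i (rowspan M)]);
apply: bigcup_open => i _; exact: of_.
Qed.

HB.instance Definition _ := isOpenTopological.Build subspaces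
  subspaces_openT subspaces_openI subspaces_open_bigU.

(* Two-step flags (W, U), dim W = a, dim U = b, with the topology of the
   product of Grassmannians. *)
Definition flags (a b : nat) : set (subspaces * subspaces) :=
  [set p | [/\ (p.1 <= p.2)%VS, \dim p.1 = a & \dim p.2 = b]].

Definition orthogonal_complement (Z W : subspaces) : Prop :=
  forall w : 'rV[R]_n,
    w \in W <-> (forall z : 'rV[R]_n, z \in Z -> (w *m z^T) 0 0 = 0).

(* The r x r minor of [M] on the columns s 0 < ... < s (r - 1). *)
Definition maximal_minor (r : nat) (M : 'M[R]_(r, n)) (s : 'I_r -> 'I_n) : R :=
  \det (colsub s M).

Definition increasing (r : nat) (s : 'I_r -> 'I_n) : Prop :=
  forall i j : 'I_r, (i < j)%N -> (s i < s j)%N.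

Definition Gr_nonneg (r : nat) : set subspaces :=
  [set V | exists2 M : 'M[R]_(r, n), represents M V
         & forall s, increasing s -> 0 <= maximal_minor M s].

Definition Gr_pos (r : nat) : set subspaces :=
  [set V | exists2 M : 'M[R]_(r, n), represents M V
         & forall s, increasing s -> 0 < maximal_minor M s].

(* [Gr_perp_pos r] is a set of (n - r)-dimensional subspaces. *)
Definition Gr_perp_pos (r : nat) : set subspaces :=
  [set W | exists2 Z, Gr_pos r Z & orthogonal_complement Z W].

(* Columns M(j), j : int, of an r x n matrix M with columns M(1), ..., M(n),
   extended by M(j + n) = e M(j). The value is 0 if n = 0. *)
Definition ext_col (e : R) (r : nat) (M : 'M[R]_(r, n)) (j : int) : 'cV[R]_r :=
  e ^ ((j - 1) %/ n%:Z)%Z *: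
  oapp (fun i : 'I_n => col i M) 0 (insub `|((j - 1) %% n%:Z)%Z|%N).

(* The matrix with columns M(a), ..., M(b - 1), indices modulo n. *)
Definition cyclic_columns (r : nat) (M : 'M[R]_(r, n)) (a b : int) :
    'M[R]_(r, `|b - a|%N) :=
  \matrix_(i, t) ext_col 1 M (a + (t : nat)%:Z) i 0.

(* $\Pi^{>0}_{r+f}$; the cardinality condition says that the set of indices is
   finite with as many elements as the rank. *)
Definition positroid_cell (r : nat) (f : int -> int) : set subspaces :=
  [set V | Gr_nonneg r V /\
     forall M : 'M[R]_(r, n), represents M V ->
     forall a b : int, a < b ->
       ([set i : int | (i < a) && (a <= f i + r%:Z < b)]
          #= `I_(\rank (cyclic_columns M a b)))%card].

(* $\mathrm{Gr}_{\ge m}(r,n)$, for m <= n - r. *)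
Definition Gr_ge (m r : nat) : set subspaces :=
  \bigcup_(f in affine_perm n r (n - r - m)) positroid_cell r f.

(* $\mathcal A_{n,k,\ge m}$ *)
Definition amplituhedron (m k : nat) : set (subspaces * subspaces) :=
  [set p | Gr_perp_pos (k + m) p.1 /\
           exists2 V : subspaces, Gr_ge m k V & p.2 = (V + p.1)%VS].

Definition Zmap (p : subspaces * subspaces) : subspaces * subspaces :=
  (p.2, (p.1 + p.2)%VS).

Definition Zmap_op (p : subspaces * subspaces) : subspaces * subspaces :=
  (p.1, (p.1 + p.2)%VS).

Definition amplituhedron_cell (m k : nat) (f : int -> int) :
    set (subspaces * subspaces) :=
  Zmap @` (positroid_cell k f `*` Gr_perp_pos (k + m)).

Definition amplituhedron_cell_op (m l : nat) (f : int -> int) :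
    set (subspaces * subspaces) :=
  Zmap_op @` (Gr_perp_pos (l + m) `*` positroid_cell l f).

Section StackedTwist.
Variables (k l : nat) (V : 'M[R]_(k, n)) (W : 'M[R]_(l, n)).

(* U(j), with U(j + n) = (-1)^(k-1) U(j); the exponent k - 1 is an integer. *)
Definition stacked_col (j : int) : 'cV[R]_(k + l) :=
  ext_col ((-1) ^ (k%:Z - 1)) (col_mx V W) j.

(* U(j - l), ..., U(j + k - 1) is a basis for every j. *)
Definition twistable : Prop :=
  forall j : int,
    basis_of fullv [seq stacked_col (j - l%:Z + t%:Z) | t <- iota 0 (k + l)].

(* The vector paired to (-1)^j with U(j - l) and to 0 with U(i) for
   j - l + 1 <= i <= j + k - 1, unique when the U(i) form a basis. When
   k = l = 0 the basis is empty, nothing is required of the pairings, and the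
   vector is the zero of R^0. *)
Definition twisted_col (j : int) : 'cV[R]_(k + l) :=
  xget 0 [set u : 'cV[R]_(k + l) |
    forall i : int, j - l%:Z <= i <= j + k%:Z - 1 ->
      (u^T *m stacked_col i) 0 0 = if i == j - l%:Z then (-1) ^ j else 0].

Definition twisted_mx : 'M[R]_(k + l, n) :=
  \matrix_(i, c) twisted_col (c : nat).+1%:Z i 0.

Definition stacked_twist : subspaces * subspaces :=
  (rowspan (usubmx twisted_mx), rowspan (dsubmx twisted_mx)).

End StackedTwist.

(* The stacked twist on pairs of row spans, computed on chosen representing
   matrices. *)
Definition representative (r : nat) (V : subspaces) : 'M[R]_(r, n) :=
  xget 0 [set M | represents M V].

Definition theta (k l : nat) (p : subspaces * subspaces) :
    subspaces * subspaces :=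
  stacked_twist (representative k p.1) (representative l p.2).

End Subspaces.

Arguments Gr_nonneg R n r : clear implicits.
Arguments Gr_pos R n r : clear implicits.
Arguments Gr_perp_pos R n r : clear implicits.
Arguments Gr_ge R n m r : clear implicits.
Arguments positroid_cell R n r f : clear implicits.
Arguments amplituhedron R n m k : clear implicits.
Arguments amplituhedron_cell R n m k f : clear implicits.
Arguments amplituhedron_cell_op R n m l f : clear implicits.
Arguments flags R n a b : clear implicits.

(* Main.v *)
(* The stacked twist only sees the flag (W, span(V, W)): under left
   multiplication of the stacked matrix U by g, its dual is multiplied by the
   inverse transpose of g, which turns block upper triangular g into block lower
   triangular ones. So the map on flags is defined from any matrix representing
   the flag, it is continuous because the Grassmannians have continuous local
   sections, and it is inverted by the same construction with the vectors
   normalised at the other end of the window and the two blocks exchanged.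

   That this map respects positivity is first seen for the Veronese matrices,
   where the cyclic shift acts by a matrix preserving a bilinear form. It
   follows for all totally positive V and W^perp by connectedness: along a path
   of positive matrices the window minors of both halves of the dual do not
   vanish, and a nonnegative matrix with nonvanishing cyclically consecutive
   minors has no vanishing maximal minor. Nonnegative V is a limit of positive
   ones. Finally, the ranks of the windows of the dual are determined by those
   of V through orthogonality, and the counting formula for the ranks shows that
   the cell of f goes to the cell of its inverse. *)
Require Import Defs.
From mathcomp Require Import all_boot all_order all_algebra all_fingroup.
From mathcomp Require Import all_classical all_reals all_analysis.
From mathcomp Require Import zify lra.
Import Order.TTheory GRing.Theory Num.Theory.
Import numFieldNormedType.Exports.

Set Implicit Arguments.
Unset Strict Implicit.
Unset Printing Implicit Defensive.

Local Open Scope classical_set_scope.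
Local Open Scope ring_scope.

(** * Cauchy-Binet *)

(** A subspace [W] orthogonal to a totally positive one is the row span of [altx X] with [X] totally
    positive, so stacked matrices are taken in the form [col_mx V (altx X)]. Over a period, [V] and
    [X] naturally change by [twist_sign R k] and [twist_sign R l]; alternation adds a factor (-1)^n,
    and the two signs agree because k + l + m = n with m even. The dual has the same shape with the
    blocks exchanged: its top is [altx] of a positive matrix, its bottom is nonnegative. The boolean
    [b] therefore treats the map and its inverse at once.

    The main obstacle is signs. For cyclic windows and for complementary sets of columns they are
    read off by comparison with the Veronese matrix on the same columns, whose minors are products
    of sines. Positivity is taken up to a scalar ([gpos c]), which makes it invariant under changes
    of basis; the scalar may vary along a path, and products of two minors eliminate it. Paths and
    approximations come from sweeps, which make a nonnegative matrix of full rank totally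
    positive. *)

Lemma det_sum_cols (R : comPzRingType) (T : finType) (r : nat)
    (F : T -> 'I_r -> 'I_r -> R) :
  \det (\matrix_(i, j) \sum_(a : T) F a i j) =
  \sum_(f : {ffun 'I_r -> T}) \det (\matrix_(i, j) F (f j) i j).
Proof.
rewrite -det_tr /determinant.
under eq_bigr => s _.
  under eq_bigr => i _ do rewrite !mxE.
  rewrite bigA_distr_bigA big_distrr; over.
rewrite exchange_big; apply: eq_bigr => f _; rewrite -[RHS]det_tr.
by apply: eq_bigr => s _; congr (_ * _); apply: eq_bigr => i _; rewrite !mxE.
Qed.

Lemma det_colsub_perm (R : comPzRingType) (r n : nat) (M : 'M[R]_(r, n))
    (f : 'I_r -> 'I_n) (s : 'S_r) :
  \det (colsub (f \o s) M) = (-1) ^+ s * \det (colsub f M).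
Proof.
have -> : colsub (f \o s) M = col_perm s (colsub f M).
  by apply/matrixP => i j; rewrite !mxE.
by rewrite col_permE det_mulmx det_perm odd_permV mulrC.
Qed.

(* Symmetrised Cauchy--Binet: summing over all maps, not over increasing ones,
   counts every minor [r`!] times. *)
Lemma Cauchy_Binet_fact (R : comPzRingType) (r n : nat) (A B : 'M[R]_(r, n)) :
  (r`!)%:R * \det (A *m B^T) =
  \sum_(f : {ffun 'I_r -> 'I_n}) \det (colsub f A) * \det (colsub f B).
Proof.
(* Permuting the columns of [A *m B^T] by [s] and expanding each over the inner index produces the
   term of [s] in every [\det (colsub f B)]. Summing these r! equal expressions over [s] assembles
   the minors of [B]. *)
have detE (s : 'S_r) : \det (A *m B^T) =
    \sum_(f : {ffun 'I_r -> 'I_n})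
       (-1) ^+ s * (\prod_j B (s j) (f j)) * \det (colsub f A).
  transitivity ((-1) ^+ s * \det (\matrix_(i, j) \sum_a A i a * B (s j) a)).
    rewrite (_ : \matrix_(i, j) _ = col_perm s (A *m B^T)).
      rewrite col_permE det_mulmx det_perm odd_permV mulrCA -signr_addb.
      by rewrite addbb mulr1.
    by apply/matrixP => i j; rewrite !mxE; under [RHS]eq_bigr do rewrite mxE.
  rewrite (det_sum_cols (fun a i j => A i a * B (s j) a)) big_distrr.
  apply: eq_bigr => f _; rewrite -mulrA; congr (_ * _) => /=.
  rewrite (_ : \matrix_(i, j) _ =
            colsub f A *m diag_mx (\row_j B (s j) (f j))); last first.
    by apply/matrixP => i j; rewrite mul_mx_diag !mxE.
  rewrite det_mulmx det_diag mulrC; congr (_ * _).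
  by apply: eq_bigr => j _; rewrite mxE.
transitivity (\sum_(s : 'S_r) \det (A *m B^T)).
  by rewrite sumr_const card_Sn mulr_natl.
under eq_bigr => s _ do rewrite (detE s).
rewrite exchange_big; apply: eq_bigr => f _ /=.
rewrite -big_distrl mulrC; congr (_ * _) => /=.
rewrite -[RHS]det_tr; apply: eq_bigr => s _; congr (_ * _).
by apply: eq_bigr => j _; rewrite !mxE.
Qed.

(** Distinct values have distinct ranks, so ranking is a permutation of the indices, and its inverse
    sorts. *)
Lemma injective_sort (r : nat) (T : finType) d (P : orderType d) (g : T -> P)
    (f : 'I_r -> T) :
  injective g -> injective f ->
  exists s : 'S_r, forall i j : 'I_r, (i < j)%N -> (g (f (s i)) < g (f (s j)))%O.
Proof.
move=> ginj finj.
pose rk (t : 'I_r) := #|[pred u : 'I_r | (g (f u) < g (f t))%O]|.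
have rk_lt t : (rk t < r)%N.
  rewrite -[X in (_ < X)%N]card_ord; apply: proper_card.
  by apply/properP; split; [exact: subset_predT|exists t; rewrite ?inE ?ltxx].
have rk_mono t u : (g (f t) < g (f u))%O -> (rk t < rk u)%N.
  move=> tu; apply: proper_card; apply/properP; split.
    by apply/fintype.subsetP => x; rewrite !inE => /lt_trans; apply.
  by exists t; rewrite !inE ?ltxx.
pose h t := Ordinal (rk_lt t).
have hinj : injective h.
  move=> t u /(congr1 val) /= rktu; apply/finj/ginj.
  by case: (ltgtP (g (f t)) (g (f u))) => // /rk_mono; rewrite rktu ltnn.
pose s : 'S_r := ((perm hinj)^-1)%g; exists s => i j ij.
have hs t : h (s t) = t by rewrite -(permE hinj) permKV.
case: (ltgtP (g (f (s i))) (g (f (s j)))) => //.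
  move=> /rk_mono; rewrite -[rk _]/(val (h _)) -[rk (s i)]/(val (h _)).
  by rewrite !hs /= ltnNge ltnW.
by move=> /ginj/finj/perm_inj eqij; rewrite eqij ltnn in ij.
Qed.

(** * Cyclically extended columns and the Veronese curve *)

Lemma int_modE (n : nat) (j : int) : (0 < n)%N -> exists q : int, exists c : 'I_n,
  j = (c : nat).+1%:Z + q * n%:Z.
Proof.
move=> n_gt0.
have nz : n%:Z != 0 by rewrite eqz_nat -lt0n.
have m0 := modz_ge0 (j - 1) nz; have ml := ltz_mod (j - 1) nz.
have lt : (`|((j - 1) %% n%:Z)%Z| < n)%N by lia.
exists ((j - 1) %/ n%:Z)%Z; exists (Ordinal lt) => /=.
have := divz_eq (j - 1) n%:Z; lia.
Qed.

Section ExtCol.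
Variables (R : realType) (n : nat).
Hypothesis n_gt0 : (0 < n)%N.
Variables (e : R) (r : nat).
Hypothesis e_neq0 : e != 0.
Implicit Types (M : 'M[R]_(r, n)) (j : int).

Lemma ext_col_ord M (c : 'I_n) : ext_col e M (c : nat).+1%:Z = col c M.
Proof.
rewrite /ext_col intS addrC addKr.
have cn : (c%:Z < n%:Z)%R by rewrite ltz_nat.
rewrite divz_small ?modz_small ?expr0z ?scale1r //= insubT //=.
by congr (col _ M); apply: val_inj.
Qed.

Lemma ext_colMn M j (q : int) :
  ext_col e M (j + q * n%:Z) = e ^ q *: ext_col e M j.
Proof.
have nz : n%:Z != 0 by rewrite eqz_nat -lt0n.
rewrite /ext_col addrAC -[_ + q * _](addrC (q * n%:Z)).
by rewrite divzMDl // modzMDl exprzDr ?unitfE // scalerA.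
Qed.

Lemma ext_colD M j : ext_col e M (j + n%:Z) = e *: ext_col e M j.
Proof. by rewrite -[n%:Z]mul1r ext_colMn expr1z. Qed.

End ExtCol.

Lemma ext_col_mul (R : realType) (n r p : nat) (e : R) (g : 'M[R]_(p, r))
    (M : 'M[R]_(r, n)) (j : int) : ext_col e (g *m M) j = g *m ext_col e M j.
Proof.
rewrite /ext_col -scalemxAr; congr (_ *: _).
by case: insubP => [i _ _|_] /=; rewrite ?mulmx0 ?colE ?mulmxA.
Qed.

Lemma ext_col_col_mx (R : realType) (n r p : nat) (e : R) (A : 'M[R]_(r, n))
    (B : 'M[R]_(p, n)) (j : int) :
  ext_col e (col_mx A B) j = col_mx (ext_col e A j) (ext_col e B j).
Proof.
rewrite /ext_col -scale_col_mx; congr (_ *: _).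
case: insubP => [i _ _|_] /=; last by rewrite col_mx0.
by apply/matrixP => x y; rewrite !mxE; case: fintype.split => z; rewrite !mxE.
Qed.

Definition mcols (R : realType) (n r N : nat) (e : R) (M : 'M[R]_(r, n))
    (f : 'I_N -> int) : 'M[R]_(r, N) := \matrix_(i, t) ext_col e M (f t) i 0.

Lemma mcols_mul (R : realType) (n r p N : nat) (e : R) (g : 'M[R]_(p, r))
    (M : 'M[R]_(r, n)) (f : 'I_N -> int) :
  mcols e (g *m M) f = g *m mcols e M f.
Proof.
apply/matrixP => i t; rewrite [LHS]mxE ext_col_mul mxE [RHS]mxE.
by apply: eq_bigr => a _; rewrite [in RHS]mxE.
Qed.

Lemma mcols_col_mx (R : realType) (n r p N : nat) (e : R) (A : 'M[R]_(r, n))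
    (B : 'M[R]_(p, n)) (f : 'I_N -> int) :
  mcols e (col_mx A B) f = col_mx (mcols e A f) (mcols e B f).
Proof.
apply/matrixP => i t; rewrite [LHS]mxE ext_col_col_mx mxE [RHS]mxE.
by case: fintype.split => a; rewrite [in RHS]mxE.
Qed.

Lemma det_scale_cols (R : comPzRingType) (r : nat) (a : 'I_r -> R)
    (A : 'M[R]_r) :
  \det (\matrix_(i, t) (a t * A i t)) = (\prod_t a t) * \det A.
Proof.
rewrite (_ : \matrix_(i, t) _ = A *m diag_mx (\row_t a t)); last first.
  by apply/matrixP => i j; rewrite mul_mx_diag !mxE mulrC.
rewrite det_mulmx det_diag mulrC; congr (_ * _).
by apply: eq_bigr => t _; rewrite mxE.
Qed.

(* The sign by which the columns of an [r x n] matrix are naturally extended: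
   moving the first column to the end then preserves maximal minors. *)
Definition twist_sign (R : realType) (r : nat) : R := (-1) ^ (r%:Z - 1).

Lemma twist_sign_neq0 (R : realType) (r : nat) : twist_sign R r != 0.
Proof. by rewrite expfz_neq0 // oppr_eq0 oner_eq0. Qed.

Section Reference.
Variables (R : realType) (n : nat).
Hypothesis n_gt0 : (0 < n)%N.

(** Steps of pi / n make a shift by n a half turn. The offset 1/2 puts the angles of 1, ..., n
    strictly between -pi/2 and pi/2, so that no cosine vanishes. *)
Definition angle (j : int) : R := pi * (j%:~R - 2^-1) / n%:R - pi / 2.

(** The rational normal curve of degree r - 1 in homogeneous form: a half turn multiplies it by
    (-1)^(r - 1), the sign [twist_sign]. *)
Definition veronese (r : nat) (j : int) : 'cV[R]_r :=
  \col_i (cos (angle j) ^+ (r.-1 - i) * sin (angle j) ^+ i).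

(* The minor on the columns f of the matrix whose j-th column is
   [veronese r j], computed by Vandermonde; for increasing f within one period
   it is positive, so it carries the sign of every minor of a nonnegative
   matrix on arbitrary cyclically extended columns. *)
Definition ref_minor (r : nat) (f : 'I_r -> int) : R :=
  \prod_(s < r) \prod_(t < r | (s < t)%N) sin (angle (f t) - angle (f s)).

Let nR : n%:R != 0 :> R. Proof. by rewrite pnatr_eq0 -lt0n. Qed.

Lemma angleD j : angle (j + n%:Z) = angle j + pi.
Proof.
by rewrite /angle intrD [_ + n%:~R - _]addrAC mulrDr mulrDl mulfK // addrAC.
Qed.

Lemma angleB j i : angle j - angle i = pi * (j - i)%:~R / n%:R.
Proof. by rewrite /angle intrB; lra. Qed.

Lemma angle_Mn j (q : int) :
  (cos (angle (j + q * n%:Z)) = (-1) ^ q * cos (angle j)) *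
  (sin (angle (j + q * n%:Z)) = (-1) ^ q * sin (angle j)).
Proof.
elim/int_ind: q => [|q [IHc IHs]|q [IHc IHs]].
- by rewrite mul0r addr0 expr0z !mul1r.
- rewrite intS [1 + _]addrC mulrDl mul1r addrA angleD cosDpi sinDpi IHc IHs.
  by rewrite exprzDr ?unitrN1 // expr1z; split; lra.
- have E : j + - q%:Z * n%:Z = j + - q.+1%:Z * n%:Z + n%:Z by lia.
  have Em : (-1) ^ (- q.+1%:Z) = - (-1) ^ (- q%:Z) :> R.
    by rewrite intS opprD exprzDr ?unitrN1 // expN1r mulN1r.
  move: IHc IHs; rewrite E angleD cosDpi sinDpi => /(canRL opprK) -> /(canRL opprK) ->.
  by rewrite Em !mulNr.
Qed.

Lemma cos_angle_neq0 j : cos (angle j) != 0.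
Proof.
have [q [c ->]] := int_modE j n_gt0.
rewrite angle_Mn mulf_neq0 ?expfz_neq0 ?oppr_eq0 ?oner_eq0 // gt_eqF //.
apply: cos_gt0_pihalf; rewrite /angle -pmulrn.
have lec : (c : nat).+1%:R <= n%:R :> R by rewrite ler_nat.
have lec1 : 1 <= (c : nat).+1%:R :> R by rewrite ler1n.
have pp := pi_gt0 R; have n0 : 0 < n%:R :> R by rewrite ltr0n.
have x0 : 0 < pi * ((c : nat).+1%:R - 2^-1) / n%:R :> R.
  by rewrite mulr_gt0 ?invr_gt0 // mulr_gt0 //; lra.
have xpi : pi * ((c : nat).+1%:R - 2^-1) / n%:R < pi :> R.
  by rewrite ltr_pdivrMr // ltr_pM2l //; lra.
by apply/andP; split; lra.
Qed.

Lemma prod_pairs_mul (r : nat) (c : 'I_r -> R) :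
  \prod_(s < r) \prod_(t < r | (s < t)%N) (c s * c t) = \prod_s c s ^+ r.-1.
Proof.
transitivity (\prod_(s < r) ((\prod_(t < r | (s < t)%N) c s) *
                             \prod_(t < r | (s < t)%N) c t)).
  by apply: eq_bigr => s _; rewrite -big_split.
rewrite big_split /= [X in _ * X](exchange_big_dep xpredT) //= -big_split /=.
apply: eq_bigr => s _; rewrite !prodr_const -exprD; congr (_ ^+ _).
rewrite -[in RHS](card_ord r) -(cardC1 s).
rewrite -cardUI [X in (_ + X)%N](_ : _ = 0%N) ?addn0.
  by apply: eq_card => t; rewrite !inE -(inj_eq val_inj) neq_ltn orbC.
apply: eq_card0 => t; apply/negP; rewrite !inE /= !unfold_in -!/(leq _ _) => /andP[st ts].
by have := ltn_trans st ts; rewrite ltnn.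
Qed.

(** Dividing each column by the power [r.-1] of its cosine leaves a Vandermonde matrix in the
    tangents. Each index lies in [r.-1] pairs, and two cosines times the difference of their
    tangents give the sine of the difference of the angles. *)
Lemma det_veronese (r : nat) (f : 'I_r -> int) :
  \det (\matrix_(i, t) veronese r (f t) i 0) = ref_minor f.
Proof.
transitivity ((\prod_t cos (angle (f t)) ^+ r.-1) *
   \det (Vandermonde r (\row_t tan (angle (f t))))).
  rewrite -det_scale_cols; congr (\det _); apply/matrixP => i t; rewrite !mxE.
  have ir : (i <= r.-1)%N by case: r i {t f} => [[]//|r] i; rewrite -ltnS.
  rewrite -[in RHS](subnK ir) exprD /tan expr_div_n -!mulrA; congr (_ * _).
  by rewrite mulrC mulfVK // expf_neq0 // cos_angle_neq0.
rewrite det_Vandermonde -prod_pairs_mul -big_split; apply: eq_bigr => s _ /=.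
rewrite -big_split; apply: eq_bigr => t _ /=; rewrite !mxE sinB /tan.
have helper (a b x y : R) : a != 0 -> b != 0 ->
    a * b * (x / b - y / a) = x * a - b * y.
  move=> a0 b0; have /divff ha := a0; have /divff hb := b0.
  have -> : a * b * (x / b - y / a) = a * x * (b / b) - b * y * (a / a) by lra.
  by rewrite ha hb; lra.
by rewrite helper ?cos_angle_neq0.
Qed.

Definition veronese_mx (r : nat) : 'M[R]_(r, n) :=
  \matrix_(i, c) veronese r (c : nat).+1%:Z i 0.

Lemma veronese_Mn r j (q : int) :
  veronese r (j + q * n%:Z) = twist_sign R r ^ q *: veronese r j.
Proof.
case: r => [|r]; first by apply/matrixP => -[].
apply/matrixP => i z; rewrite !mxE !angle_Mn !exprMn mulrACA -exprD.
rewrite subnK -1?ltnS //; congr (_ * _).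
by rewrite /twist_sign intS addrAC subrr add0r exprzAC exprnP.
Qed.

Lemma ext_col_veronese r j :
  ext_col (twist_sign R r) (veronese_mx r) j = veronese r j.
Proof.
have [q [c ->]] := int_modE j n_gt0.
rewrite ext_colMn ?twist_sign_neq0 // ext_col_ord veronese_Mn; congr (_ *: _).
by apply/matrixP => i z; rewrite !mxE.
Qed.

Lemma ref_minorE r (f : 'I_r -> int) :
  ref_minor f = \det (mcols (twist_sign R r) (veronese_mx r) f).
Proof.
rewrite -det_veronese; congr (\det _); apply/matrixP => i t.
by rewrite [RHS]mxE ext_col_veronese mxE.
Qed.

Lemma sin_angleB_gt0 i j : i < j < i + n%:Z -> 0 < sin (angle j - angle i).
Proof.
move=> ij; rewrite angleB; apply: sin_gt0_pi.
have n0 : 0 < n%:R :> R by rewrite ltr0n.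
have pp := pi_gt0 R.
have d0 : 0 < (j - i)%:~R :> R by rewrite ltr0z; lia.
have dn : (j - i)%:~R < n%:R :> R by rewrite pmulrn ltr_int; lia.
by rewrite divr_gt0 ?mulr_gt0 //= ltr_pdivrMr // ltr_pM2l.
Qed.

Lemma ref_minor_gt0 r (f : 'I_r -> int) :
  (forall s t : 'I_r, (s < t)%N -> f s < f t < f s + n%:Z) -> 0 < ref_minor f.
Proof.
move=> fP; apply: prodr_gt0 => s _; apply: prodr_gt0 => t /fP fst.
exact: sin_angleB_gt0.
Qed.

Lemma ref_minor_ge0 r (f : 'I_r -> int) :
  (forall s t : 'I_r, (s < t)%N -> f s <= f t <= f s + n%:Z) ->
  0 <= ref_minor f.
Proof.
move=> fP; apply: prodr_ge0 => s _; apply: prodr_ge0 => t /fP fst.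
rewrite angleB; apply: sin_ge0_pi.
have n0 : 0 < n%:R :> R by rewrite ltr0n.
have pp := pi_gt0 R.
have d0 : 0 <= (f t - f s)%:~R :> R by rewrite ler0z; lia.
have dn : (f t - f s)%:~R <= n%:R :> R by rewrite pmulrn ler_int; lia.
have pp0 := ltW pp.
by rewrite ler_pdivrMr // ler_pM2l // dn divr_ge0 // mulr_ge0.
Qed.

(** Reduction modulo n costs a factor that depends on [f] only. The Veronese matrix acquires the
    same factor, so comparisons with it see only a square. *)
Lemma det_mcols_mod r (f : 'I_r -> int) : exists a : R, exists rho : 'I_r -> 'I_n,
  a != 0 /\ forall M : 'M[R]_(r, n),
    \det (mcols (twist_sign R r) M f) = a * \det (colsub rho M).
Proof.
have /choice[q /choice[rho fE]] := fun t => int_modE (f t) n_gt0.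
exists (\prod_t twist_sign R r ^ q t); exists rho; split=> [|M].
  by apply/prodf_neq0 => t _; rewrite expfz_neq0 ?twist_sign_neq0.
rewrite -det_scale_cols; congr (\det _); apply/matrixP => i t.
rewrite [LHS]mxE [in LHS]fE ext_colMn ?twist_sign_neq0 // ext_col_ord.
by rewrite !mxE.
Qed.

End Reference.

Section Positivity.
Variables (R : realType) (n : nat).
Hypothesis n_gt0 : (0 < n)%N.

(** The scalar [c], of either sign, absorbs the determinant of a change of basis. As [gnn 0 M]
    always holds, [c != 0] is required separately where it matters. *)
Definition gnn (r : nat) (c : R) (M : 'M[R]_(r, n)) :=
  forall s : 'I_r -> 'I_n, increasing s -> 0 <= c * maximal_minor M s.

Definition gpos (r : nat) (c : R) (M : 'M[R]_(r, n)) :=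
  forall s : 'I_r -> 'I_n, increasing s -> 0 < c * maximal_minor M s.

Lemma gpos_gnn r c (M : 'M[R]_(r, n)) : gpos c M -> gnn c M.
Proof. by move=> cM s si; apply/ltW/cM. Qed.

Lemma maximal_minorE r (M : 'M[R]_(r, n)) (s : 'I_r -> 'I_n) :
  maximal_minor M s =
  \det (mcols (twist_sign R r) M (fun t => (s t : nat).+1%:Z)).
Proof.
congr (\det _); apply/matrixP => i t.
by rewrite [RHS]mxE ext_col_ord ?twist_sign_neq0 // !mxE.
Qed.

Lemma veronese_gpos r : gpos 1 (veronese_mx R n r).
Proof.
move=> s si; rewrite mul1r maximal_minorE -ref_minorE //.
apply: ref_minor_gt0 => // a b /si.
by have := ltn_ord (s b); lia.
Qed.

Lemma colsub_sort r (rho : 'I_r -> 'I_n) : injective rho ->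
  exists s : 'I_r -> 'I_n, exists e : R, [/\ increasing s, e ^+ 2 = 1 &
    forall M : 'M[R]_(r, n), \det (colsub rho M) = e * maximal_minor M s].
Proof.
move=> rinj; have [p pP] := injective_sort (@ord_inj n) rinj.
exists (rho \o p); exists ((-1) ^+ (p : bool)); split=> // [|M].
  by rewrite sqrr_sign.
by rewrite /maximal_minor det_colsub_perm mulrA -signr_addb addbb mul1r.
Qed.

Lemma colsub_ninj r (rho : 'I_r -> 'I_n) (M : 'M[R]_(r, n)) :
  ~ injective rho -> \det (colsub rho M) = 0.
Proof.
move=> /injectiveP/injectivePn[i [j ij rij]]; rewrite -det_tr.
by apply: (determinant_alternate ij) => x; rewrite !mxE rij.
Qed.

(** Both minors are the same multiple of a maximal minor on sorted columns, so a square factors out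
    and the Veronese minor is positive. Columns that coincide modulo n make both minors vanish. *)
Lemma gnn_ref r c (M : 'M[R]_(r, n)) (f : 'I_r -> int) : gnn c M ->
  0 <= c * \det (mcols (twist_sign R r) M f) * ref_minor R n f.
Proof.
move=> cM; rewrite (ref_minorE _ n_gt0).
have [a [rho [a0 aE]]] := det_mcols_mod R n_gt0 f; rewrite !aE.
have [rinj|/colsub_ninj rninj] := pselect (injective rho); last first.
  by rewrite !rninj !mulr0.
have [s [e [si e2 eE]]] := colsub_sort rinj; rewrite !eE.
rewrite (_ : _ * _ = (a * e) ^+ 2 * ((c * maximal_minor M s) *
                          maximal_minor (veronese_mx R n r) s)); last by lra.
rewrite mulr_ge0 ?sqr_ge0 // mulr_ge0 ?cM //.
by rewrite -[X in 0 <= X]mul1r ltW // veronese_gpos.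
Qed.

Lemma gpos_ref r c (M : 'M[R]_(r, n)) (f : 'I_r -> int) : gpos c M ->
  ref_minor R n f != 0 ->
  0 < c * \det (mcols (twist_sign R r) M f) * ref_minor R n f.
Proof.
move=> cM; rewrite (ref_minorE _ n_gt0).
have [a [rho [a0 aE]]] := det_mcols_mod R n_gt0 f; rewrite !aE.
have [rinj|/colsub_ninj rninj] := pselect (injective rho); last first.
  by rewrite !rninj !mulr0 eqxx.
have [s [e [si e2 eE]]] := colsub_sort rinj; rewrite !eE => _.
have e0 : e != 0 by apply: contraTneq (oner_neq0 R) => e0; rewrite -e2 e0 expr0n eqxx.
rewrite (_ : _ * _ = (a * e) ^+ 2 * ((c * maximal_minor M s) *
                          maximal_minor (veronese_mx R n r) s)); last by lra.
rewrite mulr_gt0 ?exprn_even_gt0 ?mulf_neq0 // mulr_gt0 ?cM //.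
by rewrite -[X in 0 < X]mul1r veronese_gpos.
Qed.

End Positivity.

(** * Orthogonal complements of positive matrices *)

Lemma mulmx_tr_eq0 (R : realDomainType) (n : nat) (v : 'rV[R]_n) :
  v *m v^T = 0 -> v = 0.
Proof.
move=> /matrixP/(_ 0 0); rewrite !mxE => /psumr_eq0P v0.
apply/rowP => i; rewrite mxE; apply/eqP; rewrite -sqrf_eq0 expr2.
by have := v0 _ i isT; rewrite mxE => -> // j _; rewrite mxE -expr2 sqr_ge0.
Qed.

Lemma gram_unit (R : realFieldType) (r n : nat) (A : 'M[R]_(r, n)) :
  row_free A -> A *m A^T \in unitmx.
Proof.
move=> Afree; rewrite -row_free_unit -kermx_eq0; apply/rowV0P => v.
move=> /sub_kermxP vA; apply/eqP; rewrite -(mulmx_free_eq0 _ Afree); apply/eqP.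
by apply: mulmx_tr_eq0; rewrite trmx_mul mulmxA -(mulmxA v) vA mul0mx.
Qed.

Lemma minor_row_free (R : fieldType) (r n : nat) (M : 'M[R]_(r, n))
    (f : 'I_r -> 'I_n) : \det (colsub f M) != 0 -> row_free M.
Proof.
move=> dM; have : colsub f M \in unitmx by rewrite unitmxE unitfE.
rewrite -row_free_unit -[M in colsub f M]mulmx1 -mulmx_colsub.
by rewrite /row_free => /eqP rk; rewrite eqn_leq rank_leq_row -{1}rk mxrankM_maxl.
Qed.

Definition altx (R : pzRingType) (r n : nat) (X : 'M[R]_(r, n)) : 'M[R]_(r, n) :=
  \matrix_(i, c) ((-1) ^+ c * X i c).

Lemma altxK (R : pzRingType) (r n : nat) (X : 'M[R]_(r, n)) : altx (altx X) = X.
Proof. by apply/matrixP => i c; rewrite !mxE mulrA -expr2 sqrr_sign mul1r. Qed.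

Lemma altx_mul (R : comPzRingType) (r p n : nat) (g : 'M[R]_(p, r))
    (X : 'M[R]_(r, n)) : altx (g *m X) = g *m altx X.
Proof.
apply/matrixP => i c; rewrite !mxE big_distrr; apply: eq_bigr => a _ /=.
by rewrite !mxE mulrCA.
Qed.

Lemma altx_mul_tr (R : comPzRingType) (r p n : nat) (X : 'M[R]_(r, n))
    (Y : 'M[R]_(p, n)) : altx X *m (altx Y)^T = X *m Y^T.
Proof.
apply/matrixP => i j; rewrite !mxE; apply: eq_bigr => c _.
by rewrite !mxE mulrACA -expr2 sqrr_sign mul1r.
Qed.

Lemma det_colsub_altx (R : comPzRingType) (r n : nat) (X : 'M[R]_(r, n))
    (f : 'I_r -> 'I_n) :
  \det (colsub f (altx X)) = (\prod_t (-1) ^+ f t) * \det (colsub f X).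
Proof.
by rewrite -det_scale_cols; congr (\det _); apply/matrixP => i t; rewrite !mxE.
Qed.

Lemma row_free_altx (R : fieldType) (r n : nat) (X : 'M[R]_(r, n)) :
  row_free (altx X) = row_free X.
Proof.
suff H Y : row_free Y -> row_free (@altx R r n Y).
  by apply/idP/idP => [/H|/H //]; rewrite altxK.
move=> /row_freeP[B YB]; apply/row_freeP.
exists (altx B^T)^T; by rewrite altx_mul_tr trmxK.
Qed.

(** * The signs of complementary sets of columns *)

Section ComplementarySigns.
Variables (R : realType) (r l : nat).
Let N := (r + l)%N.
Let a (x : 'I_N) : R := angle R N (x : nat).+1%:Z.
Let rfo m (f : 'I_m -> 'I_N) : R := ref_minor R N (fun t => (f t : nat).+1%:Z).

Lemma sin_angle_ord (x y : 'I_N) : (x < y)%N -> 0 < sin (a y - a x).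
Proof.
move=> xy; have N0 : (0 < N)%N by apply: leq_ltn_trans (ltn_ord x).
have H (i j M : nat) : (i < j)%N -> (j < M)%N ->
    i.+1%:Z < j.+1%:Z < i.+1%:Z + M%:Z by lia.
by apply: sin_angleB_gt0; rewrite // H // ltn_ord.
Qed.

(** The factors with x > y are the negative ones, and there are N - 1 - y of them. *)
Lemma sin_angle_row (y : 'I_N) :
  0 < (-1) ^+ N.-1 * (-1) ^+ y * \prod_(x | x != y) sin (a y - a x).
Proof.
have cnt (z M : nat) : (\sum_(x < M) (z < x) = M - z.+1)%N.
  elim: M => [|M IH]; first by rewrite big_ord0 sub0n.
  by rewrite big_ord_recr /= IH; case: (ltnP z M) => zM /=; lia.
have -> : (-1) ^+ N.-1 * (-1) ^+ y = \prod_(x | x != y) (-1) ^+ (y < x)%N :> R.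
  transitivity (\prod_(x < N) (-1) ^+ (y < x)%N : R).
    rewrite prodrXr (cnt y N) -exprD -signr_odd -[RHS]signr_odd; congr (_ ^+ _).
    have H (i M : nat) : (i < M)%N -> odd (M.-1 + i) = odd (M - i.+1) by lia.
    by rewrite H // ltn_ord.
  by rewrite (bigD1 y) //= ltnn mul1r.
rewrite -big_split; apply: prodr_gt0 => x xy /=.
have [yx|yx] := ltnP y x.
  by rewrite expr1 mulN1r -sinN opprB sin_angle_ord.
by rewrite mul1r sin_angle_ord // ltn_neqAle xy.
Qed.

Let joinf (g : 'I_r -> 'I_N) (f : 'I_l -> 'I_N) (u : 'I_N) : 'I_N :=
  match fintype.split u with inl s => g s | inr t => f t end.

Lemma ref_join g f : rfo (joinf g f) =
  rfo g * rfo f * \prod_t \prod_s sin (a (f t) - a (g s)).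
Proof.
have jl s : joinf g f (lshift l s) = g s by rewrite /joinf (unsplitK (inl s)).
have jr t : joinf g f (rshift r t) = f t by rewrite /joinf (unsplitK (inr t)).
transitivity ((\prod_(s < r) ((\prod_(s' < r | (s < s')%N) sin (a (g s') - a (g s)))
      * \prod_(t < l) sin (a (f t) - a (g s)))) *
    \prod_(t < l) \prod_(t' < l | (t < t')%N) sin (a (f t') - a (f t))).
  rewrite /rfo /ref_minor big_split_ord /=; congr (_ * _); apply: eq_bigr => s _.
    rewrite big_split_ord /=; congr (_ * _).
      by apply: eq_bigr => t _; rewrite !jl.
    apply: eq_big => [t|t _]; last by rewrite jl jr.
    by rewrite ltn_addr // ltn_ord.
  rewrite big_split_ord /= big_pred0 ?mul1r => [|t].
    apply: eq_big => [u|u _]; first by rewrite ltn_add2l.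
    by rewrite !jr.
  by rewrite ltnNge ltnW // ltn_addr // ltn_ord.
by rewrite big_split /= [X in _ * X * _ = _]exchange_big /= mulrAC.
Qed.

Let kappa : R := (\prod_(t < l) \prod_(t' < l | (t < t')%N) (-1)) *
                 \prod_(t < l) (-1) ^+ N.-1.

(** Apart from the reference minors of [g] and [f], the sign is that of the product X of the sines
    across the two sets. Multiplied by the sines D inside [f], it runs over all x different from f
    t, where [sin_angle_row] applies; D is a positive number up to one sign per pair. Both
    corrections are collected in [kappa], which depends on [r] and [l] only. *)
Lemma joinf_perm g f : injective (joinf g f) ->
  0 < rfo (joinf g f) * rfo g * rfo f * (kappa * \prod_t (-1) ^+ f t).
Proof.
move=> jinj.
have jl s : joinf g f (lshift l s) = g s by rewrite /joinf (unsplitK (inl s)).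
have jr t : joinf g f (rshift r t) = f t by rewrite /joinf (unsplitK (inr t)).
have finj : injective f by move=> t t'; rewrite -!jr => /jinj/rshift_inj.
have sin0 (x y : 'I_N) : x != y -> sin (a y - a x) != 0.
  rewrite -(inj_eq val_inj) neq_ltn => /orP[xy|yx].
    by rewrite gt_eqF // sin_angle_ord.
  by rewrite -opprB sinN oppr_eq0 gt_eqF // sin_angle_ord.
have g0 : rfo g != 0.
  apply/prodf_neq0 => s _; apply/prodf_neq0 => s' ss'; apply: sin0.
  by rewrite -!jl (inj_eq jinj) (inj_eq (@lshift_inj _ _)) neq_ltn ss'.
have f0 : rfo f != 0.
  apply/prodf_neq0 => s _; apply/prodf_neq0 => s' ss'; apply: sin0.
  by rewrite (inj_eq finj) neq_ltn ss'.
pose X := \prod_t \prod_s sin (a (f t) - a (g s)).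
pose D := \prod_t \prod_(t' | t' != t) sin (a (f t) - a (f t')).
have XD : X * D = \prod_t \prod_(x | x != f t) sin (a (f t) - a x).
  rewrite -big_split; apply: eq_bigr => t _ /=.
  rewrite [RHS](reindex_inj jinj) /= [RHS]big_split_ord /=; congr (_ * _).
    apply: eq_big => [s|s _]; last by rewrite jl.
    by rewrite -(jr t) (inj_eq jinj) eq_lrshift.
  apply: eq_big => [s|s _]; last by rewrite jr.
  by rewrite jr (inj_eq finj).
have Dpos : 0 < D * \prod_(t < l) \prod_(t' < l | (t < t')%N) (-1).
  have -> : D = (\prod_(t < l) \prod_(t' < l | (t < t')%N) sin (a (f t) - a (f t'))) *
      \prod_(t < l) \prod_(t' < l | (t < t')%N) sin (a (f t') - a (f t)).
    rewrite [X in _ = _ * X](exchange_big_dep xpredT) //= -big_split.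
    apply: eq_bigr => /= t _; rewrite (bigID (fun t' : 'I_l => (t < t')%N)) /=.
    congr (_ * _); apply: eq_bigl => t'; rewrite -(inj_eq val_inj) /=;
      by case: ltngtP.
  rewrite -!big_split; apply: prodr_gt0 => t _ /=; rewrite -!big_split.
  apply: prodr_gt0 => t' tt' /=; rewrite mulrN1 -mulNr -sinN opprB -expr2.
  by rewrite exprn_even_gt0 //= sin0 // (inj_eq finj) neq_ltn tt'.
have XDpos : 0 < X * D * ((\prod_(t < l) (-1) ^+ N.-1) * \prod_t (-1) ^+ f t).
  rewrite XD mulrC -!big_split; apply: prodr_gt0 => t _.
  exact: sin_angle_row.
have D0 : D != 0 by apply: contraTneq Dpos => ->; rewrite mul0r ltxx.
rewrite ref_join -/X.
rewrite (_ : _ * _ = (rfo g * rfo f) ^+ 2 * D ^- 2 *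
    ((D * \prod_(t < l) \prod_(t' < l | (t < t')%N) (-1)) *
     (X * D * ((\prod_(t < l) (-1) ^+ N.-1) * \prod_t (-1) ^+ f t)))).
  rewrite mulr_gt0 ?(mulr_gt0 Dpos) // mulr_gt0 ?exprn_even_gt0 ?mulf_neq0 //.
  by rewrite invr_gt0 exprn_even_gt0.
rewrite /kappa.
have DV : D ^+ 2 * D ^- 2 = 1 by rewrite mulfV // expf_neq0.
set A := (X in X * _ * _); set B := (X in _ * X * _); set C := \prod_t _.
have E (x y z w v u p q : R) : q ^+ 2 * p = 1 ->
  x * y * z * x * y * (w * v * u) =
  (x * y) ^+ 2 * p * (q * w * (z * q * (v * u))).
  by move=> qp; rewrite -[LHS]mulr1 -qp; lra.
exact: E.
Qed.

End ComplementarySigns.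

Lemma ref_minor_perm (R : realType) (n : nat) (n_gt0 : (0 < n)%N)
    (f : 'I_n -> 'I_n) (p : 'S_n) : f =1 p ->
  ref_minor R n (fun t => (f t : nat).+1%:Z) =
  (-1) ^+ p * ref_minor R n (fun t : 'I_n => (t : nat).+1%:Z).
Proof.
move=> fp; rewrite !(ref_minorE R n_gt0) -!maximal_minorE // /maximal_minor.
rewrite -det_colsub_perm; congr (\det _).
by apply/matrixP => i j; rewrite !mxE /= fp.
Qed.

Lemma increasing_inj (r n : nat) (s : 'I_r -> 'I_n) : increasing s -> injective s.
Proof.
move=> si x y sxy; apply/val_inj; case: (ltngtP x y) => //= /si;
  by rewrite sxy ltnn.
Qed.

Lemma ref_minor_increasing (R : realType) (n r : nat) (s : 'I_r -> 'I_n) :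
  increasing s -> 0 < ref_minor R n (fun t => (s t : nat).+1%:Z).
Proof.
move=> si; case: (posnP n) => [n0|n_gt0].
  case: r s si => [|r] s si; last first.
    by have := leq_ltn_trans (leq0n _) (ltn_ord (s ord0)) => n1; rewrite n0 in n1.
  by rewrite /ref_minor big_ord0.
apply: ref_minor_gt0 => // a b /si; have := ltn_ord (s b).
by move: (nat_of_ord (s a)) (nat_of_ord (s b)) => x y; lia.
Qed.

Lemma complement_inj (r l : nat) (f : 'I_l -> 'I_(r + l)) : injective f ->
  exists g : 'I_r -> 'I_(r + l), injective (fun u : 'I_(r + l) =>
    match fintype.split u with inl s => g s | inr t => f t end).
Proof.
move=> finj; have cA : #|[predC codom f]| = r.
  apply/eqP; rewrite -(eqn_add2l #|codom f|) cardC card_codom // !card_ord.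
  by rewrite addnC.
pose g s := enum_val (cast_ord (esym cA) s).
have gf s t : g s != f t.
  have := enum_valP (cast_ord (esym cA) s); rewrite inE /= -/(g s).
  by apply: contraNneq => ->; exact: codom_f.
have ginj : injective g by move=> s s' /enum_val_inj/cast_ord_inj.
exists g => u v; case: (splitP u) => s us; case: (splitP v) => t vt /eqP.
- by move=> /eqP/ginj st; apply: val_inj; rewrite /= us vt st.
- by rewrite (negPf (gf _ _)).
- by rewrite eq_sym (negPf (gf _ _)).
- by move=> /eqP/finj st; apply: val_inj; rewrite /= us vt st.
Qed.

Lemma complement_sign_aux (R : realType) (x c G D A C F H I B e : R) :
  B * (e * D) = G * C ->
  x * c * G * D * (A * C) * (F ^+ 2 * H * I) =
  D ^+ 2 * ((c * B * F) * (e * H * F * I * (x * A))).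
Proof.
move=> h; transitivity (x * c * D * A * (F ^+ 2 * H * I) * (G * C)).
  by clear h; lra.
by rewrite -h; clear h; lra.
Qed.

(** Jacobi's relation: up to a common factor, a minor of [W] is the complementary minor of [Z] times
    the sign of the shuffle of columns. By [joinf_perm] the alternation in [altx] compensates this
    sign. *)
Lemma gpos_complement_add (R : realType) (r l : nat) (c : R)
    (Z : 'M[R]_(r, r + l)) (W : 'M[R]_(l, r + l)) :
  gpos c Z -> row_free Z -> row_free W -> Z *m W^T = 0 ->
  exists c', gpos c' (altx W).
Proof.
move=> cZ Zfree Wfree ZW; case: (posnP (r + l)) => [rl0|rl0].
  have l0 : l = 0%N by lia.
  by exists 1 => s _; subst l; rewrite /maximal_minor det_mx00 mul1r.
pose P := col_mx Z W; pose G := \det (Z *m Z^T).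
have G0 : G != 0 by rewrite -unitfE -unitmxE gram_unit.
have PP : P *m P^T = block_mx (Z *m Z^T) 0 0 (W *m W^T).
  rewrite tr_col_mx mul_col_row ZW; congr (block_mx _ _ _ _).
  by rewrite -[LHS]trmxK trmx_mul trmxK ZW trmx0.
have P0 : \det P != 0.
  have : \det (P *m P^T) != 0.
    by rewrite PP det_ublock mulf_neq0 // -unitfE -unitmxE gram_unit.
  by rewrite det_mulmx det_tr mulf_eq0 negb_or => /andP[].
pose kap : R := (\prod_(t < l) \prod_(t' < l | (t < t')%N) (-1)) *
                \prod_(t < l) (-1) ^+ (r + l).-1.
exists (kap * c * G * \det P) => f fi.
have [g hinj] := complement_inj (increasing_inj fi).
pose h := fun u : 'I_(r + l) =>
  match fintype.split u with inl s => g s | inr t => f t end.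
have jl s : h (lshift l s) = g s by rewrite /h (unsplitK (inl s)).
have jr t : h (rshift r t) = f t by rewrite /h (unsplitK (inr t)).
pose p := perm (hinj : injective h).
have := joinf_perm R hinj; rewrite -/h.
have dP : \det (colsub h P) = (-1) ^+ p * \det P.
  rewrite -[in RHS](mxsub_id P) -det_colsub_perm; congr (\det _).
  by apply/matrixP => i j; rewrite [LHS]mxE [RHS]mxE /= permE.
(* The matrix with block rows [colsub h Z] and (0, 1) is multiplied by the transpose of
   [colsub h P]. Orthogonality makes the product block triangular, with diagonal blocks [Z *m Z^T]
   and the transpose of [colsub f W]. *)
have key : \det (colsub g Z) * \det (colsub h P) = G * \det (colsub f W).
  rewrite -[\det (colsub h P)]det_tr.
  have -> : colsub g Z = lsubmx (colsub h Z).
    by apply/matrixP => i j; rewrite !mxE jl.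
  rewrite -[\det (lsubmx _)]mulr1 -(det1 R l) -(det_ublock _ (rsubmx (colsub h Z))).
  have -> : (colsub h P)^T = row_mx (colsub h Z)^T (colsub h W)^T.
    rewrite -tr_col_mx; congr _^T.
    by apply/matrixP => i j; rewrite !mxE; case: fintype.split => x; rewrite !mxE.
  rewrite -det_mulmx block_mxEv hsubmxK mul_col_row.
  have reidx m m' (A : 'M[R]_(m, r + l)) (B : 'M[R]_(m', r + l)) :
      colsub h A *m (colsub h B)^T = A *m B^T.
    apply/matrixP => i j; rewrite !mxE [RHS](reindex_inj hinj).
    by apply: eq_bigr => u _; rewrite !mxE.
  rewrite !reidx ZW det_lblock; congr (_ * _).
  rewrite -[colsub h W]hsubmxK tr_row_mx mul_row_col mul0mx add0r mul1mx.
  by rewrite -[\det _]det_tr trmxK; congr (\det _); apply/matrixP => i j; rewrite !mxE jr.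
rewrite /maximal_minor det_colsub_altx.
have hp : h =1 p by move=> u; rewrite permE.
have Zg : \det (colsub g Z) != 0 -> 0 < c * \det (colsub g Z) *
    ref_minor R (r + l) (fun t => (g t : nat).+1%:Z).
  move=> Zg0; have ginj : injective g.
    by apply: contrapT => /colsub_ninj gi; rewrite gi eqxx in Zg0.
  have [s [e [si e2 eE]]] := colsub_sort R ginj.
  have M (A : 'M[R]_(r, r + l)) : \det (colsub g A) =
      \det (mcols (twist_sign R r) A (fun t => (g t : nat).+1%:Z)).
    by rewrite -[LHS]/(maximal_minor A g) maximal_minorE.
  rewrite M; apply: gpos_ref => //; rewrite ref_minorE // -M eE mulf_neq0 //.
    by apply: contraTneq (oner_neq0 R) => e0; rewrite -e2 e0 expr0n eqxx.
  by have := veronese_gpos R rl0 si; rewrite mul1r => /gt_eqF ->.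
move=> sgn.
have Zg0 : \det (colsub g Z) != 0.
  have ginj : injective g.
    move=> x y gxy; have : h (lshift l x) = h (lshift l y) by rewrite !jl gxy.
    by move=> /(hinj _ _)/lshift_inj.
  have [s [e [si e2 ->]]] := colsub_sort R ginj; rewrite mulf_neq0 //.
    by apply: contraTneq (oner_neq0 R) => e0; rewrite -e2 e0 expr0n eqxx.
  by have := cZ _ si; apply: contraTneq => ->; rewrite mulr0 ltxx.
move: (Zg Zg0) => {}Zg.
have fpos := ref_minor_increasing R fi.
have idpos := @ref_minor_increasing R (r + l) (r + l) id (fun _ _ => id).
rewrite dP in key; move: sgn; rewrite (ref_minor_perm R rl0 hp) -/kap.
move: (ref_minor R _ _) (ref_minor R _ _) (ref_minor R _ _) fpos idpos Zg.
move: (\prod_t _) (\det (colsub g Z)) (\det (colsub f W)) key => A B C key.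
have e2 : ((-1) ^+ p) ^+ 2 = 1 :> R by rewrite sqrr_sign.
move: ((-1) ^+ p) (\det P) P0 key e2 => e D D0 key e2 F H I F0 H0 I0 sg.
have F20 : F != 0 by apply: contraTneq I0 => ->; rewrite mulr0 ltxx.
have F2 : 0 < F ^+ 2 by rewrite exprn_even_gt0.
rewrite -(pmulr_lgt0 _ (mulr_gt0 (mulr_gt0 F2 H0) F0)).
rewrite (complement_sign_aux _ _ _ _ _ _ key).
by rewrite mulr_gt0 ?exprn_even_gt0 // mulr_gt0.
Qed.

Lemma gpos_row_free (R : realType) (r n : nat) (c : R) (M : 'M[R]_(r, n)) :
  (r <= n)%N -> gpos c M -> row_free M.
Proof.
move=> rn cM; apply: (@minor_row_free _ _ _ _ (widen_ord rn)).
have si : increasing (widen_ord rn) by [].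
by have := cM _ si; apply: contraTneq; rewrite /maximal_minor => ->; rewrite mulr0 ltxx.
Qed.

Lemma gpos_complement (R : realType) (r l n : nat) (c : R)
    (Z : 'M[R]_(r, n)) (W : 'M[R]_(l, n)) :
  (r + l)%N = n -> gpos c Z -> row_free W -> Z *m W^T = 0 ->
  exists c', gpos c' (altx W).
Proof.
move=> rl; case: n / rl Z W => Z W cZ Wfree.
by apply: (gpos_complement_add cZ) => //; apply: (gpos_row_free _ cZ); rewrite leq_addr.
Qed.

Lemma gpos_mul (R : realType) (r n : nat) (c : R) (g : 'M[R]_r) (M : 'M[R]_(r, n)) :
  \det g != 0 -> gpos c M -> gpos (c / \det g) (g *m M).
Proof.
move=> g0 cM s si; rewrite /maximal_minor -mulmx_colsub det_mulmx mulrA divfK //.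
exact: cM.
Qed.

Lemma gnn_mul (R : realType) (r n : nat) (c : R) (g : 'M[R]_r) (M : 'M[R]_(r, n)) :
  \det g != 0 -> gnn c M -> gnn (c / \det g) (g *m M).
Proof.
move=> g0 cM s si; rewrite /maximal_minor -mulmx_colsub det_mulmx mulrA divfK //.
exact: cM.
Qed.

Lemma orth_basis (R : realFieldType) (l n : nat) (W : 'M[R]_(l, n)) (r : nat) :
  row_free W -> (r + l)%N = n ->
  exists Z : 'M[R]_(r, n), row_free Z /\ Z *m W^T = 0.
Proof.
move=> Wfree rl; have rk : \rank (kermx W^T) = r.
  by rewrite mxrank_ker mxrank_tr (eqP Wfree) -rl addnK.
case: r / rk rl => rl; exists (row_base (kermx W^T)); split.
  exact: row_base_free.
by apply/sub_kermxP; rewrite eq_row_base.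
Qed.

Lemma row_free_minor (R : fieldType) (r n : nat) (A : 'M[R]_(r, n)) :
  row_free A -> exists f : 'I_r -> 'I_n, \det (colsub f A) != 0.
Proof.
move=> Afree; have Afull : row_full A^T by rewrite /row_full mxrank_tr.
exists (fullrankfun Afull).
have := fullrowsub_unit Afull; rewrite unitmxE unitfE.
by rewrite -det_tr; congr (_ != 0); congr (\det _); apply/matrixP => i j; rewrite !mxE.
Qed.

Lemma colsub_inj (R : realType) (r n : nat) (A : 'M[R]_(r, n))
    (f : 'I_r -> 'I_n) : \det (colsub f A) != 0 -> injective f.
Proof.
by move=> Af; apply: contrapT => /(colsub_ninj A) Af0; rewrite Af0 eqxx in Af.
Qed.

(* The determinant is a sum of products of minors, all of the same sign. *)
Lemma det_gnn_gpos (R : realType) (r n : nat) (c d : R) (A B : 'M[R]_(r, n)) :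
  gnn c A -> c != 0 -> gpos d B -> row_free A -> \det (A *m B^T) != 0.
Proof.
move=> cA c0 dB Afree.
have H f : 0 <= c * d * (\det (colsub f A) * \det (colsub f B)).
  have [finj|/colsub_ninj fn] := pselect (injective f); last by rewrite !fn !mulr0.
  have [s [e [si e2 eE]]] := colsub_sort R finj; rewrite !eE.
  rewrite (_ : _ * _ = e ^+ 2 * ((c * maximal_minor A s) * (d * maximal_minor B s))).
    by rewrite e2 mul1r mulr_ge0 ?cA // ltW // dB.
  by lra.
have [f f0] := row_free_minor Afree.
have cd0 : c * d != 0.
  have [s [e [si e2 eE]]] := colsub_sort R (colsub_inj f0).
  by rewrite mulf_neq0 //; apply: contraTneq (dB _ si) => ->; rewrite mul0r ltxx.
suff : 0 < c * d * ((r`!)%:R * \det (A *m B^T)).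
  by apply: contraTneq => ->; rewrite !mulr0 ltxx.
rewrite Cauchy_Binet_fact big_distrr (bigD1 (finfun f)) //= ltr_wpDr //.
  by rewrite sumr_ge0.
have fE (M : 'M[R]_(r, n)) : colsub (finfun f) M = colsub f M.
  by apply/matrixP => i j; rewrite !mxE ffunE.
rewrite lt_neqAle H andbT eq_sym !fE mulf_neq0 // mulf_neq0 //.
have [s [e [si e2 ->]]] := colsub_sort R (colsub_inj f0); rewrite mulf_neq0 //.
  by apply: contraTneq (oner_neq0 R) => e0; rewrite -e2 e0 expr0n eqxx.
by apply: contraTneq (dB _ si) => ->; rewrite mulr0 ltxx.
Qed.

Definition wmx (R : realType) (n r : nat) (e : R) (M : 'M[R]_(r, n)) (a : int)
    (N : nat) : 'M[R]_(r, N) := mcols e M (fun t : 'I_N => a + (t : nat)%:Z).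

Lemma row_free_rowsub (R : fieldType) (q r N : nat) (A : 'M[R]_(r, N))
    (f : 'I_q -> 'I_r) : row_free A -> injective f -> row_free (rowsub f A).
Proof.
move=> /row_freeP[C AC] finj; apply/row_freeP; exists (colsub f C).
rewrite -mxsub_mul AC; apply/matrixP => i j.
by rewrite !mxE (inj_eq finj).
Qed.

(** * Windows of the stacked matrix *)

Section Windows.
Variables (R : realType) (k l m n : nat).
Hypotheses (n_gt0 : (0 < n)%N) (m_even : ~~ odd m) (klm : (k + l + m)%N = n).

(** The parity of m enters here: n + l - 1 and k - 1 differ by 2l + m. *)
Lemma twist_signE : twist_sign R k = (-1) ^+ n * twist_sign R l.
Proof.
rewrite /twist_sign exprnP -exprzDr ?unitrN1 // -klm.
have -> : (k + l + m)%N%:Z + (l%:Z - 1) = k%:Z - 1 + (l + m./2)%N%:Z * 2.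
  by have := odd_double_half m; rewrite (negbTE m_even) add0n -muln2; lia.
have sq (z : int) : (-1) ^ (z * 2) = 1 :> R.
  by rewrite mulrC -exprz_exp -exprnP sqrrN expr1n exp1rz.
by rewrite [RHS]exprzDr ?unitrN1 // sq mulr1.
Qed.

Lemma ext_col_altx (X : 'M[R]_(l, n)) (j : int) :
  ext_col (twist_sign R k) (altx X) j =
  (-1) ^ (j - 1) *: ext_col (twist_sign R l) X j.
Proof.
have [q [c ->]] := int_modE j n_gt0.
rewrite !ext_colMn ?twist_sign_neq0 // !ext_col_ord ?twist_sign_neq0 // scalerA.
have -> : (c : nat).+1%:Z + q * n%:Z - 1 = c%:Z + n%:Z * q by lia.
rewrite exprzDr ?unitrN1 // -exprz_exp twist_signE.
rewrite exprzMl ?unitrX ?unitrN1 ?unitfE ?twist_sign_neq0 //.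
by apply/matrixP => x y; rewrite !mxE -!exprnP; lra.
Qed.

(** On a window of k + l <= n columns [V] stays nonnegative and [X] positive, since increasing
    selections there have positive reference minors. The orthogonal complement Y of the alternated
    window of [X] is then positive up to a scalar, so [V] pairs with it invertibly, and no nonzero
    combination of rows of [V] lies in the span of the rows of [altx X]. *)
Lemma windows_unit (c d : R) (V : 'M[R]_(k, n)) (X : 'M[R]_(l, n)) (a : int) :
  gnn c V -> c != 0 -> gpos d X ->
  row_free (wmx (twist_sign R k) V a (k + l)) ->
  wmx (twist_sign R k) (col_mx V (altx X)) a (k + l) \in unitmx.
Proof.
move=> cV c0 dX Vfree; pose N := (k + l)%N.
have fpos r (s : 'I_r -> 'I_N) : increasing s ->
    0 < ref_minor R n (fun t => a + (s t : nat)%:Z).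
  move=> si; apply: ref_minor_gt0 => // x y /si.
  have := ltn_ord (s y); have : (N <= n)%N by rewrite -klm leq_addr.
  by move: (nat_of_ord (s x)) (nat_of_ord (s y)) => *; lia.
have sE r (M : 'M[R]_(r, n)) (s : 'I_r -> 'I_N) :
    colsub s (wmx (twist_sign R r) M a N) =
    mcols (twist_sign R r) M (fun t => a + (s t : nat)%:Z).
  by apply/matrixP => i t; rewrite !(mxE, mxE _ _ i t).
pose VW := wmx (twist_sign R k) V a N; pose XW := wmx (twist_sign R l) X a N.
have cVW : gnn c VW.
  move=> s si; rewrite /maximal_minor sE.
  by have := gnn_ref n_gt0 (fun t => a + (s t : nat)%:Z) cV; rewrite pmulr_lge0 ?fpos.
have dXW : gpos d XW.
  move=> s si; rewrite /maximal_minor sE -(pmulr_lgt0 _ (fpos _ _ si)).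
  by apply: gpos_ref => //; rewrite gt_eqF // fpos.
have XWfree : row_free XW by apply: (gpos_row_free _ dXW); rewrite leq_addl.
have [Y [Yfree YX]] := @orth_basis R l N (altx XW) k (etrans (row_free_altx XW) XWfree) erefl.
have [d' dY] : exists d', gpos d' Y.
  rewrite -[Y]altxK; apply: (gpos_complement _ dXW); rewrite ?row_free_altx //.
    by rewrite addnC.
  by rewrite -[XW]altxK altx_mul_tr -[LHS]trmxK trmx_mul trmxK YX trmx0.
have VY : VW *m Y^T \in unitmx.
  by rewrite unitmxE unitfE (det_gnn_gpos cVW c0 dY).
have -> : wmx (twist_sign R k) (col_mx V (altx X)) a N =
    col_mx VW ((-1) ^ (a - 1) *: altx XW).
  rewrite /wmx mcols_col_mx; congr col_mx; apply/matrixP => i t.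
  rewrite [LHS]mxE ext_col_altx [LHS]mxE [RHS]mxE [X in _ = _ * X]mxE.
  rewrite [X in _ = _ * (_ * X)]mxE mulrA exprnP; congr (_ * _).
  by rewrite -exprzDr ?unitrN1 // addrAC.
rewrite -row_free_unit -kermx_eq0; apply/rowV0P => v /sub_kermxP.
rewrite -[v]hsubmxK mul_row_col => H.
have e0 : (-1) ^ (a - 1) != 0 :> R by rewrite expfz_neq0 // oppr_eq0 oner_eq0.
have p0 : lsubmx v = 0.
  apply/eqP; rewrite -(mulmx_free_eq0 _ (_ : row_free (VW *m Y^T))) ?row_free_unit //.
  rewrite mulmxA; move: H => /(congr1 (mulmx^~ Y^T)).
  rewrite mul0mx mulmxDl -scalemxAr -scalemxAl -[_ *m altx XW *m _]mulmxA.
  have -> : altx XW *m Y^T = 0 by rewrite -[LHS]trmxK trmx_mul trmxK YX trmx0.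
  by rewrite mulmx0 scaler0 addr0 => ->.
move: H; rewrite p0 mul0mx add0r -scalemxAr => /eqP.
rewrite scaler_eq0 (negPf e0) /= mulmx_free_eq0 ?row_free_altx // => /eqP ->.
by rewrite row_mx0.
Qed.

End Windows.

(** * The dual of a stacked matrix *)

Definition cdot (R : pzRingType) (N : nat) (u v : 'cV[R]_N) : R := (u^T *m v) 0 0.

Lemma cdotZl (R : comPzRingType) (N : nat) (a : R) (u v : 'cV[R]_N) :
  cdot (a *: u) v = a * cdot u v.
Proof. by rewrite /cdot linearZ /= -scalemxAl mxE. Qed.

Lemma cdotZr (R : comPzRingType) (N : nat) (a : R) (u v : 'cV[R]_N) :
  cdot u (a *: v) = a * cdot u v.
Proof. by rewrite /cdot -scalemxAr mxE. Qed.

Lemma cdotC (R : comPzRingType) (N : nat) (u v : 'cV[R]_N) : cdot u v = cdot v u.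
Proof. by rewrite /cdot -{1}[v]trmxK -trmx_mul mxE. Qed.

Section Dual.
Variables (R : realType) (k l n : nat) (b : bool).
Implicit Types (M : 'M[R]_(k + l, n)) (u : 'cV[R]_(k + l)) (j : int).

Definition Uwin M j : 'M[R]_(k + l) :=
  wmx (twist_sign R k) M (j - l%:Z + b%:Z) (k + l).

Definition dual_rhs j : 'cV[R]_(k + l) :=
  (-1) ^ j *: \col_t ((t : nat) == if b then (k + l).-1 else 0)%:R.

(* For [b = false] this is the column of the stacked twist; for [b = true] the
   vector is normalised against U(j + k) instead of U(j - l), which gives the
   inverse of the stacked twist. *)
Definition dualcol M j : 'cV[R]_(k + l) := (invmx (Uwin M j))^T *m dual_rhs j.

Definition dualtw M : 'M[R]_(k + l, n) :=
  \matrix_(i, c) dualcol M (c : nat).+1%:Z i 0.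

Definition is_dual M j u := forall i : int,
  j - l%:Z + b%:Z <= i <= j + k%:Z - 1 + b%:Z ->
  cdot u (ext_col (twist_sign R k) M i) =
  (-1) ^ j * (i == if b then j + k%:Z else j - l%:Z)%:R.

Lemma is_dualE M j u : is_dual M j u <-> (Uwin M j)^T *m u = dual_rhs j.
Proof.
have pE t : ((Uwin M j)^T *m u) t 0 =
    cdot u (ext_col (twist_sign R k) M (j - l%:Z + b%:Z + (t : nat)%:Z)).
  by rewrite /cdot !mxE; apply: eq_bigr => x _; rewrite mxE [_^T _ _]mxE [RHS]mulrC mxE.
split=> [H|/matrixP H i ij].
  apply/matrixP => t z; rewrite (ord1 z) pE H; last by have := ltn_ord t; lia.
  rewrite !mxE; congr (_ * _%:R); have := ltn_ord t.
  by case: b => /=; lia.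
pose d := i - (j - l%:Z + b%:Z).
have lt : (`|d| < k + l)%N by rewrite /d; lia.
have := H (Ordinal lt) 0; rewrite pE /=.
have -> : j - l%:Z + b%:Z + `|d|%N%:Z = i by rewrite /d; lia.
move=> ->; rewrite !mxE /=; congr (_ * _%:R); move: ij lt.
by rewrite /d; case: b => /=; lia.
Qed.

Lemma dualcolP M j : Uwin M j \in unitmx -> is_dual M j (dualcol M j).
Proof.
by move=> Uu; apply/is_dualE; rewrite mulmxA -trmx_mul mulVmx // trmx1 mul1mx.
Qed.

Lemma dualcol_uniq M j u : Uwin M j \in unitmx -> is_dual M j u -> u = dualcol M j.
Proof.
move=> Uu /is_dualE; rewrite /dualcol => <-.
by rewrite mulmxA -trmx_mul mulmxV // trmx1 mul1mx.
Qed.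

End Dual.

Section DualTheory.
Variables (R : realType) (k l m n : nat).
Hypotheses (n_gt0 : (0 < n)%N) (m_even : ~~ odd m) (klm : (k + l + m)%N = n).
Implicit Types (M : 'M[R]_(k + l, n)) (b : bool).

Definition windows_free M :=
  forall a : int, wmx (twist_sign R k) M a (k + l) \in unitmx.

Lemma windows_freeM M (g : 'M[R]_(k + l)) : g \in unitmx ->
  windows_free M -> windows_free (g *m M).
Proof. by move=> gu Mw a; rewrite /wmx mcols_mul unitmx_mul gu Mw. Qed.

Lemma dualcol_mul b M (g : 'M[R]_(k + l)) j : g \in unitmx -> windows_free M ->
  g^T *m dualcol b (g *m M) j = dualcol b M j.
Proof.
move=> gu Mw; apply: dualcol_uniq; first exact: Mw.
move=> i ij; have := dualcolP (windows_freeM gu Mw _ : Uwin b (g *m M) j \in _) ij.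
move: (dualcol _ _ _) => u.
by rewrite ext_col_mul /cdot trmx_mul trmxK -mulmxA => ->.
Qed.

Lemma dualtw_mul b M (g : 'M[R]_(k + l)) : g \in unitmx -> windows_free M ->
  g^T *m dualtw b (g *m M) = dualtw b M.
Proof.
move=> gu Mw; apply/matrixP => i c; rewrite [RHS]mxE -(dualcol_mul _ _ gu Mw).
by rewrite !mxE; apply: eq_bigr => x _; rewrite [dualtw _ _ _ _]mxE.
Qed.

(** Over a period the prescribed pairings change by (-1)^n and the columns of [M] by
    [twist_sign R k]. By [twist_signE] this leaves the natural sign for [l] rows, the size of the
    lower half. *)
Lemma dualcolD b M (Mw : windows_free M) j :
  dualcol b M (j + n%:Z) = twist_sign R l *: dualcol b M j.
Proof.
apply/esym/dualcol_uniq; first exact: Mw.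
move=> i ij; have ij' : j - l%:Z + b%:Z <= i - n%:Z <= j + k%:Z - 1 + b%:Z by lia.
have := dualcolP (Mw _ : Uwin b M j \in _) ij'.
move: (dualcol _ _ _) => u E.
have -> : i = i - n%:Z + n%:Z by lia.
rewrite ext_colD ?twist_sign_neq0 // cdotZl cdotZr E.
rewrite (twist_signE R n_gt0 m_even klm) exprzDr ?unitrN1 // -exprnP.
have l2 : twist_sign R l * twist_sign R l = 1.
  by rewrite -expr2 /twist_sign exprnP exprz_exp mulrC -exprz_exp -exprnP sqrrN expr1n exp1rz.
have -> : (i - n%:Z == if b then j + k%:Z else j - l%:Z) =
          (i - n%:Z + n%:Z == if b then j + n%:Z + k%:Z else j + n%:Z - l%:Z).
  by case: b {E ij ij'} => /=; lia.
move: (twist_sign R l) l2 => e e2; rewrite !mulrA [_ * e]mulrC !mulrA e2.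
by rewrite mul1r [_ * (-1) ^+ n]mulrC.
Qed.

Lemma ext_col_dualtw b M (Mw : windows_free M) j :
  ext_col (twist_sign R l) (dualtw b M) j = dualcol b M j.
Proof.
have [q [c ->]] := int_modE j n_gt0.
elim/int_ind: q => [|q IH|q IH].
- rewrite mul0r addr0 ext_col_ord ?twist_sign_neq0 //.
  by apply/matrixP => x y; rewrite !mxE (ord1 y).
- have -> : (c : nat).+1%:Z + q.+1%:Z * n%:Z = (c : nat).+1%:Z + q%:Z * n%:Z + n%:Z by lia.
  by rewrite dualcolD // -IH ext_colD ?twist_sign_neq0.
- have E : (c : nat).+1%:Z + (- q%:Z) * n%:Z = (c : nat).+1%:Z + - q.+1%:Z * n%:Z + n%:Z by lia.
  move: IH; rewrite E dualcolD // ext_colD ?twist_sign_neq0 //.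
  by apply: scalerI; exact: twist_sign_neq0.
Qed.

End DualTheory.

(** * Ranks of the windows of the dual *)

Lemma rank_row_mxr0 (F : fieldType) (m n p : nat) (A : 'M[F]_(m, n)) :
  \rank (row_mx A (0 : 'M[F]_(m, p))) = \rank A.
Proof. by rewrite rank_row_mx0. Qed.

Lemma row_free_swap (F : fieldType) (q k l : nat) (A : 'M[F]_(q, k))
    (B : 'M[F]_(q, l)) : row_free (row_mx A B) -> row_free (row_mx B A).
Proof.
move=> AB; rewrite -kermx_eq0; apply/rowV0P => v /sub_kermxP.
rewrite mul_mx_row -row_mx0 => /eq_row_mx[vB vA].
by apply/eqP; rewrite -(mulmx_free_eq0 _ AB) mul_mx_row vA vB row_mx0.
Qed.

(** By the dimension count the two row spaces are exact orthogonal complements. The vectors (x, 0)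
    of the first one correspond both to the left kernel of [P2] and to the x orthogonal to [Q1];
    hence q - rank P2 = k - rank Q1. *)
Lemma rank_orth_half (F : fieldType) (p q k l : nat) (P1 : 'M[F]_(q, k))
    (P2 : 'M[F]_(q, l)) (Q1 : 'M[F]_(p, k)) (Q2 : 'M[F]_(p, l)) :
  (p + q = k + l)%N -> row_free (row_mx P1 P2) -> row_free (row_mx Q1 Q2) ->
  P1 *m Q1^T + P2 *m Q2^T = 0 ->
  (\rank P2 + k = q + \rank Q1)%N.
Proof.
move=> pq Pfree Qfree PQ.
pose K := kermx P2; pose L := kermx Q1^T.
have KP : K *m row_mx P1 P2 = row_mx (K *m P1) 0 by rewrite mul_mx_row (mulmx_ker P2).
have rKP : \rank (K *m P1) = \rank K.
  by rewrite -(@rank_row_mxr0 _ _ _ l) -KP mxrankMfree.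
have KL : (K *m P1 <= L)%MS.
  apply/sub_kermxP; rewrite -mulmxA.
  by move/eqP: PQ; rewrite addr_eq0 => /eqP ->; rewrite mulmxN mulmxA mulmx_ker mul0mx oppr0.
have PQT : row_mx P1 P2 *m (row_mx Q1 Q2)^T = 0 by rewrite tr_row_mx mul_row_col.
have Psub : (row_mx P1 P2 <= kermx (row_mx Q1 Q2)^T)%MS by apply/sub_kermxP.
have Peq : (kermx (row_mx Q1 Q2)^T <= row_mx P1 P2)%MS.
  rewrite -(geq_leqif (mxrank_leqif_sup Psub)) mxrank_ker mxrank_tr.
  by rewrite (eqP Qfree) (eqP Pfree); lia.
have LK : (L <= K *m P1)%MS.
  have : (row_mx L 0 <= row_mx P1 P2)%MS.
    apply: submx_trans Peq; apply/sub_kermxP.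
    by rewrite tr_row_mx mul_row_col mulmx_ker mul0mx addr0.
  case/submxP => D; rewrite mul_mx_row => /eq_row_mx[-> D0].
  by apply: submxMr; apply/sub_kermxP.
have : \rank K = \rank L.
  by apply/eqP; rewrite eqn_leq -rKP (mxrankS KL) (mxrankS LK).
rewrite !mxrank_ker mxrank_tr; have := rank_leq_row P2; have := rank_leq_col Q1.
by lia.
Qed.

Section RankDuality.
Variables (R : realType) (k l m n : nat).
Hypotheses (n_gt0 : (0 < n)%N) (m_even : ~~ odd m) (klm : (k + l + m)%N = n).
Variables (b : bool) (M : 'M[R]_(k + l, n)).
Hypothesis Mw : windows_free M.
Let T := dualtw b M.

Lemma cdot_dualtw (i j : int) : j - l%:Z + b%:Z <= i <= j + k%:Z - 1 + b%:Z ->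
  cdot (ext_col (twist_sign R l) T j) (ext_col (twist_sign R k) M i) =
  (-1) ^ j * (i == if b then j + k%:Z else j - l%:Z)%:R.
Proof.
by move=> ij; rewrite (ext_col_dualtw n_gt0 m_even klm) // (dualcolP (Mw _)).
Qed.

Lemma wmx_tr_mul (r N1 N2 : nat) (e1 e2 : R) (A B : 'M[R]_(r, n)) a1 a2 s t :
  ((wmx e1 A a1 N1)^T *m wmx e2 B a2 N2) s t =
  cdot (ext_col e1 A (a1 + (s : nat)%:Z)) (ext_col e2 B (a2 + (t : nat)%:Z)).
Proof.
rewrite /cdot [LHS]mxE [RHS]mxE; apply: eq_bigr => x _.
by rewrite [_^T s x]mxE [_^T 0 x]mxE; congr (_ * _); rewrite mxE.
Qed.

(** The pairings of this window with the window of [M] shifted by k or -l form a triangular matrix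
    with diagonal entries 1 or -1; [b] decides which triangle vanishes. *)
Lemma dual_windows_unit (a : int) : wmx (twist_sign R l) T a (k + l) \in unitmx.
Proof.
pose G := (wmx (twist_sign R l) T a (k + l))^T *m
  wmx (twist_sign R k) M (a + if b then k%:Z else - l%:Z) (k + l).
suff : G \in unitmx by rewrite unitmx_mul unitmx_tr => /andP[].
have GE (s t : 'I_(k + l)) : (if b then t <= s else s <= t)%N ->
    G s t = (-1) ^ (a + (s : nat)%:Z) * (s == t)%:R.
  move=> st; rewrite wmx_tr_mul cdot_dualtw; last first.
    by have := ltn_ord s; have := ltn_ord t; case: b st => /=; lia.
  congr (_ * _%:R); rewrite -(inj_eq val_inj) /=.
  by case: b st => /=; lia.
have diag s : G s s != 0.
  by rewrite GE ?eqxx ?mulr1 ?expfz_neq0 ?oppr_eq0 ?oner_eq0 //; case: (b).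
have trig c : is_trig_mx c -> (forall s, c s s != 0) -> (c : 'M[R]_(k + l)) \in unitmx.
  by move=> ct cd; rewrite unitmxE unitfE det_trig //; apply/prodf_neq0 => s _.
case bE : b; last first.
  apply: trig => //; apply/is_trig_mxP => s t st; rewrite GE ?bE 1?ltnW //.
  by rewrite -(inj_eq val_inj) /= ltn_eqF // mulr0.
rewrite -unitmx_tr; apply: trig => [|s]; last by rewrite mxE.
apply/is_trig_mxP => s t st; rewrite mxE GE ?bE 1?ltnW //.
by rewrite -(inj_eq val_inj) /= gtn_eqF // mulr0.
Qed.

Lemma wmx_sub_free (r N q : nat) (e : R) (A : 'M[R]_(r, n)) a :
  r = N -> row_full (wmx e A a N) -> (q <= N)%N -> row_free (wmx e A a q)^T.
Proof.
move=> rN; case: N / rN => Afull qr.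
have -> : (wmx e A a q)^T = rowsub (widen_ord qr) (wmx e A a r)^T.
  by apply/matrixP => s t; rewrite 2![LHS]mxE 3![RHS]mxE.
apply: row_free_rowsub; first by rewrite row_free_unit unitmx_tr -row_full_unit.
by move=> x y /(congr1 val) /= xy; apply: val_inj.
Qed.

(** For either [b], the q columns of the dual from a on are orthogonal to the columns a + q - l,
    ..., a + k - 1 of [M]. Both families are free and their sizes add up to k + l, so
    [rank_orth_half] applies, once for each half. *)
Lemma rank_dual (a : int) (q : nat) : (q <= k + l)%N ->
  (\rank (wmx (twist_sign R l) (dsubmx T) a q) + k =
   q + \rank (wmx (twist_sign R k) (usubmx M) (a + q%:Z - l%:Z) (k + l - q)))%N /\
  (\rank (wmx (twist_sign R l) (usubmx T) a q) + l =
   q + \rank (wmx (twist_sign R k) (dsubmx M) (a + q%:Z - l%:Z) (k + l - q)))%N.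
Proof.
move=> qN.
have Pfree : row_free (wmx (twist_sign R l) T a q)^T.
  by apply: (@wmx_sub_free _ (k + l)) => //; rewrite row_full_unit dual_windows_unit.
have Qfree : row_free (wmx (twist_sign R k) M (a + q%:Z - l%:Z) (k + l - q))^T.
  by apply: (@wmx_sub_free _ (k + l)); rewrite ?row_full_unit ?Mw ?leq_subr.
have PQ : (wmx (twist_sign R l) T a q)^T *m
    wmx (twist_sign R k) M (a + q%:Z - l%:Z) (k + l - q) = 0.
  apply/matrixP => s t; rewrite wmx_tr_mul mxE.
  have := ltn_ord s; have := ltn_ord t => tN sN; rewrite cdot_dualtw; last first.
    by case: (b) => /=; lia.
  rewrite (_ : (_ == _) = false) ?mulr0 //.
  by case: (b) => /=; lia.
have trE r1 r2 e (A : 'M[R]_(r1 + r2, n)) a' N : (wmx e A a' N)^T =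
    row_mx (wmx e (usubmx A) a' N)^T (wmx e (dsubmx A) a' N)^T.
  by rewrite -{1}(vsubmxK A) /wmx mcols_col_mx tr_col_mx.
rewrite -[wmx _ M _ _]trmxK !trE tr_row_mx mul_row_col in PQ.
rewrite !trE in Pfree Qfree.
have pq : (k + l - q + q = k + l)%N by rewrite subnK.
rewrite -!(mxrank_tr (wmx _ _ _ q)).
split.
  by rewrite -(mxrank_tr (wmx _ (usubmx M) _ _)) (rank_orth_half pq Pfree Qfree) // !trmxK.
rewrite -(mxrank_tr (wmx _ (dsubmx M) _ _)).
have pq' : (k + l - q + q = l + k)%N by rewrite subnK // addnC.
by rewrite (rank_orth_half pq' (row_free_swap Pfree) (row_free_swap Qfree)) // addrC.
Qed.

End RankDuality.

(** * Exchanging the two blocks and dualising twice *)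

Definition swapmx (R : Type) (k l n : nat) (M : 'M[R]_(k + l, n)) : 'M[R]_(l + k, n) :=
  col_mx (dsubmx M) (usubmx M).

Section Involution.
Variables (R : realType) (k l m n : nat).
Hypotheses (n_gt0 : (0 < n)%N) (m_even : ~~ odd m) (klm : (k + l + m)%N = n).
Variables (b : bool) (M : 'M[R]_(k + l, n)).
Hypothesis Mw : windows_free M.

Lemma swapmx_windows (e : R) (A : 'M[R]_(k + l, n)) (a : int) (N : nat) :
  wmx e (swapmx A) a N = swapmx (wmx e A a N).
Proof.
rewrite /swapmx -{3 4}(vsubmxK A) /wmx !mcols_col_mx.
by rewrite col_mxKd col_mxKu.
Qed.

Lemma row_free_swapmx r (A : 'M[R]_(k + l, r)) : \rank (swapmx A) = \rank A.
Proof.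
rewrite /swapmx -[in RHS](vsubmxK A).
by rewrite -!addsmxE (addsmxC (dsubmx A)).
Qed.

Lemma windows_free_swap (A : 'M[R]_(k + l, n)) :
  (forall a, wmx (twist_sign R l) A a (k + l) \in unitmx) ->
  windows_free (swapmx A).
Proof.
move=> Aw a; rewrite -row_free_unit /row_free swapmx_windows row_free_swapmx.
suff /(_ (l + k)%N) -> : forall N, N = (k + l)%N ->
    \rank (wmx (twist_sign R l) A a N) = N by rewrite // addnC.
by move=> _ ->; apply/eqP; rewrite -/(row_free _) row_free_unit.
Qed.

Lemma cdot_swap (u v : 'cV[R]_(k + l)) : cdot (swapmx u) (swapmx v) = cdot u v.
Proof.
rewrite /cdot /swapmx tr_col_mx mul_row_col -{3}(vsubmxK u) -{3}(vsubmxK v).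
by rewrite tr_col_mx mul_row_col addrC.
Qed.

Lemma ext_col_swap (e : R) (A : 'M[R]_(k + l, n)) j :
  ext_col e (swapmx A) j = swapmx (ext_col e A j).
Proof.
by rewrite /swapmx -{3 4}(vsubmxK A) !ext_col_col_mx col_mxKd col_mxKu.
Qed.

(** The pairings can be read from either side: a column of [M] solves the equations of the dual of
    the dual, normalised at the other end of the window. The sign is then taken at an index that
    differs by k or l, which accounts for the scalar. *)
Lemma dualtw_involutive :
  exists2 s : R, s != 0 & dualtw (~~ b) (swapmx (dualtw b M)) = s *: swapmx M.
Proof.
pose s : R := (-1) ^ (if b then k else l)%:Z.
have Tw : windows_free (swapmx (dualtw b M)).
  by apply: windows_free_swap; apply: (dual_windows_unit n_gt0 m_even klm).
exists s; first by rewrite expfz_neq0 // oppr_eq0 oner_eq0.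
suff H (c : 'I_n) : s *: swapmx (ext_col (twist_sign R k) M (c : nat).+1%:Z) =
    dualcol (~~ b) (swapmx (dualtw b M)) (c : nat).+1%:Z.
  apply/matrixP => i c; rewrite [LHS]mxE -H [LHS]mxE [RHS]mxE; congr (_ * _).
  rewrite ext_col_ord ?twist_sign_neq0 // /swapmx !mxE.
  by case: fintype.split => x; rewrite !mxE.
apply: dualcol_uniq; first exact: Tw.
move: (_.+1%:Z) => j i ij.
rewrite cdotZl ext_col_swap cdot_swap cdotC (cdot_dualtw n_gt0 m_even klm) //; last first.
  by move: ij; case: (b) => /=; lia.
have -> : (j == (if b then i + k%:Z else i - l%:Z)) =
          (i == (if ~~ b then j + l%:Z else j - k%:Z)).
  by case: (b) => /=; lia.
case: eqP => [->|_]; rewrite ?mulr0 // !mulr1 /s.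
have sq (x : int) : (-1) ^ x * (-1) ^ x = 1 :> R.
  by rewrite -exprzDr ?unitrN1 // -mulr2n -mulr_natr mulrC -exprz_exp -exprnP sqrrN expr1n exp1rz.
case: (b) => /=; last by rewrite exprzDr ?unitrN1 // mulrCA sq mulr1.
by rewrite -exprzDr ?unitrN1 //; congr (_ ^ _); lia.
Qed.

End Involution.

(** * Positivity from consecutive minors *)

Definition replcol (R : Type) (r : nat) (B : 'M[R]_r) (u : 'I_r) (w : 'cV[R]_r) :
    'M[R]_r := \matrix_(i, t) if t == u then w i 0 else B i t.

Lemma det_replcol (R : comPzRingType) (r : nat) (B : 'M[R]_r) (u : 'I_r)
    (w : 'cV[R]_r) : \det (replcol B u w) = (\adj B *m w) u 0.
Proof.
rewrite (expand_det_col _ u) mxE; apply: eq_bigr => i _.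
rewrite !mxE eqxx mulrC; congr (_ * _); rewrite /cofactor; congr (_ * \det _).
by apply/matrixP => x y; rewrite !mxE -[lift u y == u]negbK eq_sym neq_lift.
Qed.

Lemma det_replcol_mul (R : comPzRingType) (r : nat) (B : 'M[R]_r) (u : 'I_r)
    (a : 'cV[R]_r) : \det (replcol B u (B *m a)) = \det B * a u 0.
Proof. by rewrite det_replcol mulmxA mul_adj_mx mul_scalar_mx mxE. Qed.

(** Over a field, [\adj B *m w] lies on the kernel of a singular [B] if this is a line, and vanishes
    if it is larger. Cramer's rule applied in two columns gives the proportionality without
    distinguishing ranks. *)
Lemma adj_kernel (R : comPzRingType) (r : nat) (B : 'M[R]_r) (v w : 'cV[R]_r)
    (x t : 'I_r) : x != t -> B *m v = 0 ->
  (\adj B *m w) x 0 * v t 0 = (\adj B *m w) t 0 * v x 0.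
Proof.
move=> xt Bv; rewrite -!det_replcol -det_replcol_mul.
have -> : replcol B x w *m v = v x 0 *: (w - col x B).
  apply/matrixP => i z; rewrite !mxE (ord1 z) (bigD1 x) //= !mxE eqxx.
  have /matrixP/(_ i 0) := Bv; rewrite !mxE (bigD1 x) //= => /eqP.
  rewrite addrC addr_eq0 => /eqP E.
  under eq_bigr => s /negPf sx do rewrite mxE sx.
  by rewrite E mulrBr mulrC [B i x * _]mulrC.
have lin (C : 'M[R]_r) a (z : 'cV[R]_r) : \det (replcol C t (a *: (w - z))) =
    a * (\det (replcol C t w) - \det (replcol C t z)).
  by rewrite !det_replcol -scalemxAr mulmxBr !mxE.
rewrite lin [RHS]mulrC; congr (_ * _).
have -> : \det (replcol (replcol B x w) t w) = 0.
  rewrite -det_tr; apply: (determinant_alternate xt) => i; rewrite !mxE !eqxx.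
  by rewrite (negPf xt).
rewrite sub0r -[replcol (replcol _ _ _) _ _](_ : colsub (tperm x t) (replcol B t w) = _).
  rewrite (det_colsub_perm _ id) odd_tperm xt expr1 mulN1r opprK.
  by congr (\det _); apply/matrixP => i j; rewrite mxE.
apply/matrixP => i j; rewrite !mxE; case: tpermP => [->|->|/eqP jx /eqP jt].
- by rewrite eqxx (negPf xt) eqxx.
- by rewrite (negPf xt) eqxx.
- by rewrite (negPf jx) (negPf jt).
Qed.

Lemma ltn_lift (r : nat) (p : 'I_r.+1) (x y : 'I_r) :
  (x < y)%N -> (lift p x < lift p y)%N.
Proof. by rewrite /= /bump => xy; case: (leqP p x); case: (leqP p y); lia. Qed.

Section ConsecutiveMinors.
Variable R : realType.

Definition cmx (r : nat) (A : nat -> 'cV[R]_r) (f : 'I_r -> nat) : 'M[R]_r :=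
  \matrix_(i, t) A (f t) i 0.

Definition incn (r : nat) (f : 'I_r -> nat) :=
  forall s t : 'I_r, (s < t)%N -> (f s < f t)%N.

Definition cons0 (r : nat) (f : 'I_r -> nat) (t : 'I_r.+1) : nat :=
  if unlift ord0 t is Some u then (f u).+1 else 0.

Lemma cons0_0 r (f : 'I_r -> nat) : cons0 f ord0 = 0%N.
Proof. by rewrite /cons0 unlift_none. Qed.

Lemma cons0_lift r (f : 'I_r -> nat) u : cons0 f (lift ord0 u) = (f u).+1.
Proof. by rewrite /cons0 liftK. Qed.

Lemma incn_cons0 r (f : 'I_r -> nat) : incn f -> incn (cons0 f).
Proof.
move=> fi s t; case: (unliftP ord0 s) => [s' ->|->]; case: (unliftP ord0 t) => [t' ->|->];
  rewrite ?cons0_0 ?cons0_lift //=.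
by rewrite /bump /= !add1n !ltnS => /fi.
Qed.

(** [lift_perm ord0 p 1] brings position p to the front and keeps the order of the others, a cycle
    of sign (-1)^p. *)
Lemma det_cmx_front r (A : nat -> 'cV[R]_r.+1) (f : 'I_r.+1 -> nat) (p : 'I_r.+1) :
  \det (cmx A (f \o lift_perm ord0 p 1)) = (-1) ^+ p * \det (cmx A f).
Proof.
have -> : cmx A (f \o lift_perm ord0 p 1) = colsub (id \o lift_perm ord0 p 1) (cmx A f).
  by apply/matrixP => i j; rewrite !mxE.
rewrite det_colsub_perm odd_lift_perm /= odd_perm1 addbF signr_odd.
by congr (_ * \det _); apply/matrixP => i j; rewrite mxE.
Qed.

(** Minors through column 0 are minors of the quotient by that column; this lowers r in the
    induction below. *)
Lemma cmx_project r (A : nat -> 'cV[R]_r.+1) (g : 'M[R]_r.+1) (f : 'I_r -> nat) :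
  g *m A 0 = delta_mx ord0 0 ->
  \det g * \det (cmx A (cons0 f)) =
  \det (cmx (fun j => \col_i (g *m A j.+1) (lift ord0 i) 0) f).
Proof.
move=> gA; rewrite -det_mulmx.
have -> : g *m cmx A (cons0 f) = cmx (fun j => g *m A j) (cons0 f).
  apply/matrixP => i t; rewrite !mxE; apply: eq_bigr => x _.
  by rewrite mxE.
rewrite (expand_det_col _ ord0) big_ord_recl big1 => [|i _].
  rewrite mxE cons0_0 gA mxE eqxx mul1r addr0 /cofactor expr0 mul1r.
  by congr (\det _); apply/matrixP => x y; rewrite !mxE cons0_lift.
by rewrite mxE cons0_0 gA mxE mul0r.
Qed.

Lemma kernel_vector r (B : 'M[R]_r) : \det B = 0 ->
  exists2 v : 'cV[R]_r, v != 0 & B *m v = 0.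
Proof.
move=> B0; have /det0P[v v0 vB] : \det B^T == 0 by rewrite det_tr B0.
exists v^T; last by rewrite -[LHS]trmxK trmx_mul trmxK vB trmx0.
by apply: contraNneq v0 => v0; rewrite -[v]trmxK v0 trmx0.
Qed.

Section Step.
Variables (r N : nat) (c : R) (A : nat -> 'cV[R]_r.+1).
Hypothesis N_gt0 : (0 < N)%N.
Hypothesis nn : forall f : 'I_r.+1 -> nat, incn f -> (forall t, (f t < N)%N) ->
  0 <= c * \det (cmx A f).

Lemma det_cmx_zero_at (f : 'I_r.+1 -> nat) (p : 'I_r.+1) : f p = 0%N ->
  (forall x, 0 < f (lift p x) < N)%N -> incn (f \o lift p) ->
  0 <= c * ((-1) ^+ p * \det (cmx A f)).
Proof.
move=> fp fN fi; rewrite -det_cmx_front; apply: nn => [s t|t] /=.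
  case: (unliftP ord0 s) => [s' ->|->]; case: (unliftP ord0 t) => [t' ->|->] //=;
    rewrite ?lift_perm_id ?lift_perm_lift ?perm1 ?fp //.
    by rewrite /bump /= !add1n !ltnS => /fi.
  by move=> _; have /andP[] := fN t'.
case: (unliftP ord0 t) => [t' ->|->].
  by rewrite lift_perm_lift perm1; have /andP[] := fN t'.
by rewrite lift_perm_id fp.
Qed.

End Step.

Lemma replcol_cmx r (A : nat -> 'cV[R]_r) (f : 'I_r -> nat) p y :
  replcol (cmx A f) p (A y) = cmx A (fun t => if t == p then y else f t).
Proof. by apply/matrixP => i t; rewrite !mxE; case: eqP. Qed.

Lemma eq_cmx r (A : nat -> 'cV[R]_r) (f f' : 'I_r -> nat) : f =1 f' -> cmx A f = cmx A f'.
Proof. by move=> ff; apply/matrixP => i t; rewrite !mxE ff. Qed.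

Lemma replcolZ r (B : 'M[R]_r) p a (w : 'cV[R]_r) :
  \det (replcol B p (a *: w)) = a * \det (replcol B p w).
Proof. by rewrite !det_replcol -scalemxAr mxE. Qed.

(* If column 0 lay in the span of the run [j + 1 .. j + r], its coefficients
   would have to alternate in sign both when compared with the left and when
   compared with the right neighbour of the run, with opposite phases. *)
Lemma zero_run_neq0 (r N : nat) (c : R) (A : nat -> 'cV[R]_r.+1) (j : nat) :
  c != 0 ->
  (forall f : 'I_r.+1 -> nat, incn f -> (forall t, (f t < N)%N) ->
     0 <= c * \det (cmx A f)) ->
  (forall j, (j + r.+1 <= N)%N -> \det (cmx A (fun t : 'I_r.+1 => j + t)%N) != 0) ->
  A 0 != 0 -> (0 < j)%N -> (j + r.+1 < N)%N ->
  \det (cmx A (cons0 (fun t : 'I_r => j + t)%N)) != 0.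
Proof.
move=> c0 nn lin A0 j0 jN; apply/eqP => /kernel_vector[v v0 Bv].
have N0 : (0 < N)%N by apply: leq_ltn_trans jN.
have linp i : (i + r.+1 <= N)%N -> 0 < c * \det (cmx A (fun t : 'I_r.+1 => i + t)%N).
  move=> iN; rewrite lt_neqAle nn ?andbT => [|s t st|t]; last 2 first.
  - by rewrite ltn_add2l.
  - by have := ltn_ord t; lia.
  by rewrite eq_sym mulf_neq0 ?lin.
have sumv : \sum_(u < r) v (lift ord0 u) 0 *: A (j + u).+1 = - v 0 0 *: A 0.
  apply/matrixP => i z; rewrite (ord1 z) summxE [RHS]mxE.
  have /matrixP/(_ i 0) := Bv; rewrite !mxE big_ord_recl !mxE cons0_0 => /eqP.
  rewrite addrC addr_eq0 mulNr [v 0 0 * _]mulrC => /eqP <-.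
  by apply: eq_bigr => u _; rewrite !mxE cons0_lift mulrC.
(* Column j + u + 1 has position u + 1 in the run from j and position u in the run from j + 1.
   Putting column 0 in its place therefore gives opposite signs in [D1] and [D2]. *)
have D1 u : \det (cmx A (fun t : 'I_r.+1 => j + t)%N) * v (lift ord0 u) 0 =
    - v 0 0 * \det (cmx A (fun t : 'I_r.+1 => if t == lift ord0 u then 0 else j + t)%N).
  pose a : 'cV[R]_r.+1 := \col_t if t == 0 then 0 else v t 0.
  have -> : v (lift ord0 u) 0 = a (lift ord0 u) 0 by rewrite mxE.
  rewrite -det_replcol_mul -replcol_cmx -replcolZ; congr (\det (replcol _ _ _)).
  rewrite -sumv; apply/matrixP => i z; rewrite (ord1 z) summxE mxE big_ord_recl.
  rewrite [a _ _]mxE eqxx mulr0 add0r; apply: eq_bigr => x _.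
  by rewrite !mxE /= mulrC /bump /= add1n addnS.
have D2 u : \det (cmx A (fun t : 'I_r.+1 => j.+1 + t)%N) * v (lift ord0 u) 0 =
    - v 0 0 * \det (cmx A (fun t : 'I_r.+1 => if t == lift ord_max u then 0 else j.+1 + t)%N).
  pose a : 'cV[R]_r.+1 := \col_t if unlift ord_max t is Some u then v (lift ord0 u) 0 else 0.
  have -> : v (lift ord0 u) 0 = a (lift ord_max u) 0 by rewrite mxE liftK.
  rewrite -det_replcol_mul -replcol_cmx -replcolZ; congr (\det (replcol _ _ _)).
  rewrite -sumv; apply/matrixP => i z; rewrite (ord1 z) summxE mxE big_ord_recr /=.
  rewrite [a _ _]mxE unlift_none mulr0 addr0; apply: eq_bigr => x _.
  have -> : widen_ord (leqnSn r) x = lift ord_max x.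
    by apply: val_inj; rewrite /= /bump leqNgt ltn_ord.
  by rewrite !mxE liftK mulrC /= /bump leqNgt ltn_ord.
have vu u : v (lift ord0 u) 0 = 0.
  apply/eqP; apply: contraT => vu0.
  have s1 : 0 <= c * ((-1) ^+ (lift ord0 u) *
    \det (cmx A (fun t : 'I_r.+1 => if t == lift ord0 u then 0 else j + t)%N)).
    apply: (det_cmx_zero_at N0 nn); first by rewrite eqxx.
      move=> x; rewrite eq_sym (negPf (neq_lift _ _)).
      by have := ltn_ord (lift (lift ord0 u) x); lia.
    move=> x y xy /=; rewrite eq_sym (negPf (neq_lift _ _)) eq_sym (negPf (neq_lift _ _)).
    by rewrite ?addSn ?ltnS ltn_add2l; apply: (@ltn_lift _ (lift ord0 u)).
  have s2 : 0 <= c * ((-1) ^+ (lift ord_max u) *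
    \det (cmx A (fun t : 'I_r.+1 => if t == lift ord_max u then 0 else j.+1 + t)%N)).
    apply: (det_cmx_zero_at N0 nn); first by rewrite eqxx.
      move=> x; rewrite eq_sym (negPf (neq_lift _ _)).
      by have := ltn_ord (lift (lift ord_max u) x); lia.
    move=> x y xy /=; rewrite eq_sym (negPf (neq_lift _ _)) eq_sym (negPf (neq_lift _ _)).
    by rewrite ?addSn ?ltnS ltn_add2l; apply: (@ltn_lift _ (lift ord_max u)).
  have p1 := linp j ltac:(lia); have p2 := linp j.+1 ltac:(lia).
  move: (D1 u) (D2 u) s1 s2; rewrite lift0 lift_max exprS mulN1r.
  move: (\det _) (\det _) (\det _) (\det _) p1 p2 (v _ 0) vu0 => d1 d2 e1 e2 p1 p2 w w0 E1 E2.
  move=> s1 s2.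
  have cross : e2 * d1 = e1 * d2.
    by apply: (mulIf w0); rewrite mulrAC E1 [RHS]mulrAC E2; lra.
  have h1 := mulr_ge0 (ltW p1) s2.
  have E : c * e2 * (c * ((-1) ^+ u * d1)) = c * e1 * (c * ((-1) ^+ u * d2)).
    transitivity (c * c * (-1) ^+ u * (e2 * d1)); first by lra.
    by rewrite cross; lra.
  rewrite E pmulr_rge0 // in h1.
  have : c * ((-1) ^+ u * d2) = 0 by apply/eqP; rewrite eq_le h1 andbT; lra.
  move/eqP; rewrite !mulf_eq0 (negPf c0) signr_eq0 /= => /eqP d20.
  move/eqP: E1; rewrite d20 mulr0 mulf_eq0 (negPf w0) orbF => /eqP e20.
  by rewrite e20 mulr0 ltxx in p1.
have /eqP := v0; case; apply/matrixP => i z; rewrite (ord1 z) mxE.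
case: (unliftP ord0 i) => [u ->|->]; first exact: vu.
move: sumv; rewrite big1 => [/esym/eqP|u _]; last by rewrite vu scale0r.
by rewrite scaler_eq0 oppr_eq0 (negPf A0) orbF => /eqP.
Qed.

(** The two consecutivity hypotheses cover the cyclic windows. Minors through column 0 follow by
    induction on r in the quotient by it; the others by induction on the sum of their indices,
    closing gaps one unit at a time. *)
Lemma consecutive_minors_neq0 (r N : nat) (c : R) (A : nat -> 'cV[R]_r) :
  (r <= N)%N -> c != 0 ->
  (forall f : 'I_r -> nat, incn f -> (forall t, (f t < N)%N) ->
     0 <= c * \det (cmx A f)) ->
  (forall j, (j + r <= N)%N -> \det (cmx A (fun t : 'I_r => j + t)%N) != 0) ->
  (forall j, (j <= r)%N ->
     \det (cmx A (fun t : 'I_r => if (t < j)%N then t : nat else N - r + t)%N) != 0) ->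
  forall f : 'I_r -> nat, incn f -> (forall t, (f t < N)%N) -> \det (cmx A f) != 0.
Proof.
elim: r N c A => [|r IH] N c A rN c0 nn lin wrap.
  by move=> f _ _; rewrite det_mx00 oner_neq0.
have N0 : (0 < N)%N by apply: leq_ltn_trans rN.
pose B := cmx A (fun t : 'I_r.+1 => 0 + t)%N.
have Bu : B \in unitmx by rewrite unitmxE unitfE lin.
have gA : invmx B *m A 0 = delta_mx ord0 0.
  rewrite (_ : A 0 = B *m delta_mx ord0 0) ?mulKmx // -colE.
  by apply/matrixP => i z; rewrite !mxE (ord1 z).
have A0 : A 0 != 0.
  apply: contra_eq_neq gA => ->; rewrite mulmx0 eq_sym.
  by apply/eqP => /matrixP/(_ ord0 0)/eqP; rewrite !mxE !eqxx oner_eq0.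
have g0 : \det (invmx B) != 0 by rewrite -unitfE -unitmxE unitmx_inv.
have part1 (f : 'I_r -> nat) : incn f -> (forall t, ((f t).+1 < N)%N) ->
    \det (cmx A (cons0 f)) != 0.
  move=> fi fN; suff : \det (invmx B) * \det (cmx A (cons0 f)) != 0.
    by rewrite mulf_eq0 negb_or => /andP[].
  rewrite (cmx_project f gA); apply: (IH N.-1 (c / \det (invmx B))) => //.
  - by lia.
  - by rewrite mulf_neq0 // invr_eq0.
  - move=> h hi hN; rewrite -(cmx_project h gA) mulrA divfK //; apply: nn.
      exact: incn_cons0.
    move=> t; case: (unliftP ord0 t) => [u ->|->]; rewrite ?cons0_0 ?cons0_lift //.
    by have := hN u; lia.
  (* With column 0 restored, a run of the quotient is, according to [j], a run from 0, column 0 next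
     to an interior run ([zero_run_neq0]), or a wrapped window. *)
  - move=> j jN; rewrite -(cmx_project _ gA) mulf_neq0 //.
    case: (posnP j) => [->|j0].
      rewrite (@eq_cmx _ _ _ (fun t : 'I_r.+1 => 0 + t)%N) ?lin // => t.
      by case: (unliftP ord0 t) => [u ->|->]; rewrite ?cons0_0 ?cons0_lift //= lift0.
    case: (ltnP (j + r.+1) N) => jN'; first exact: (zero_run_neq0 c0 nn lin A0 j0 jN').
    rewrite (@eq_cmx _ _ _ (fun t : 'I_r.+1 =>
      if (t < 1)%N then t : nat else N - r.+1 + t)%N) ?wrap // => t.
    case: (unliftP ord0 t) => [u ->|->]; rewrite ?cons0_0 ?cons0_lift //= /bump /=.
    by lia.
  - move=> j jr; rewrite -(cmx_project _ gA) mulf_neq0 //.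
    rewrite (@eq_cmx _ _ _ (fun t : 'I_r.+1 =>
      if (t < j.+1)%N then t : nat else N - r.+1 + t)%N) ?wrap // => t.
    case: (unliftP ord0 t) => [u ->|->]; rewrite ?cons0_0 ?cons0_lift //= /bump /=.
    by rewrite add1n ltnS; case: ltnP; lia.
  - by move=> t; have := fN t; lia.
have part1' (f : 'I_r.+1 -> nat) : incn f -> (forall t, (f t < N)%N) -> f ord0 = 0%N ->
    \det (cmx A f) != 0.
  move=> fi fN f0; rewrite (@eq_cmx _ _ _ (cons0 (fun u => (f (lift ord0 u)).-1))).
    apply: part1 => [s t st|t].
      have := fi (lift ord0 s) (lift ord0 t) (ltn_lift _ st).
      by have := fi ord0 (lift ord0 s) isT; rewrite f0; lia.
    by have := fN (lift ord0 t); have := fi ord0 (lift ord0 t) isT; rewrite f0; lia.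
  move=> t; case: (unliftP ord0 t) => [u ->|->]; rewrite ?cons0_0 ?cons0_lift //.
  by have := fi ord0 (lift ord0 u) isT; rewrite f0 => h; exact: (esym (prednK h)).
have front (f : 'I_r.+1 -> nat) (p : 'I_r.+1) : incn f ->
    (forall t, (f t < N)%N) -> (0 < f ord0)%N ->
    0 < c * ((-1) ^+ p * \det (cmx A (fun t => if t == p then 0%N else f t))).
  move=> fi fN f0.
  have fpos x : (0 < f x)%N.
    by case: (unliftP ord0 x) => [u ->|-> //]; have := fi ord0 (lift ord0 u) isT; lia.
  rewrite lt_neqAle (det_cmx_zero_at N0 nn) ?andbT.
  - rewrite eq_sym mulf_neq0 // -det_cmx_front; apply: part1'.
    + move=> s t /=; case: (unliftP ord0 s) => [s' ->|->]; case: (unliftP ord0 t) => [t' ->|->] //=;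
        rewrite ?lift_perm_id ?lift_perm_lift ?perm1 ?eqxx //;
        rewrite ?[lift p _ == p]eq_sym ?(negPf (neq_lift _ _)) //.
      by rewrite /bump /= !add1n !ltnS => st; apply/fi/ltn_lift.
    + move=> t /=; case: (unliftP ord0 t) => [t' ->|->];
        rewrite ?lift_perm_id ?lift_perm_lift ?perm1 ?eqxx //.
      by rewrite eq_sym (negPf (neq_lift _ _)).
    + by rewrite /= lift_perm_id eqxx.
  - by rewrite eqxx.
  - by move=> x; rewrite eq_sym (negPf (neq_lift _ _)) fpos fN.
  - move=> x y xy /=; rewrite eq_sym (negPf (neq_lift _ _)) eq_sym (negPf (neq_lift _ _)).
    exact/fi/ltn_lift.
move=> f; have [s] := ubnP (\sum_t f t)%N; elim: s f => // s IHs f fs fi fN.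
case: (posnP (f ord0)) => [|f0]; first exact: part1'.
apply/eqP => df.
have [p [q [pq fpq]]] : exists p q : 'I_r.+1, q = p.+1 :> nat /\ ((f p).+1 < f q)%N.
  apply: contrapT => nopq.
  have fint (t : 'I_r.+1) : f t = (f ord0 + t)%N.
    case: t => t tr; elim: t tr => [|t IHt] tr; first by rewrite addn0; congr f; apply: val_inj.
    have tr' : (t < r.+1)%N by lia.
    have lt : (f (Ordinal tr') < f (Ordinal tr))%N by apply: fi.
    have : ~ ((f (Ordinal tr')).+1 < f (Ordinal tr))%N.
      by move=> H; apply: nopq; exists (Ordinal tr'), (Ordinal tr).
    by move: lt; rewrite IHt /=; lia.
  have /eqP := df; apply/negP; rewrite (@eq_cmx _ _ _ (fun t : 'I_r.+1 => f ord0 + t)%N) //.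
  by apply: lin; have := fN ord_max; rewrite fint /=; lia.
(* Because of the gap, [y] lies strictly between [f p] and [f q]. Moving q to [y] lowers the sum of
   the indices, so that minor is nonzero by induction; moving p to [y] is only known to give a
   nonnegative one. *)
pose y := (f q).-1.
have pqn : p != q by rewrite -(inj_eq val_inj) /= pq neq_ltn ltnSn.
have mono (x z : 'I_r.+1) : (x < z)%N -> (f x < f z)%N by exact: fi.
have mono' (x z : 'I_r.+1) : (x <= z)%N -> (f x <= f z)%N.
  by rewrite leq_eqVlt => /orP[/eqP/val_inj-> //|/mono/ltnW].
have fqi : incn (fun t => if t == q then y else f t).
  move=> x z xz; rewrite -!(inj_eq val_inj) /=; case: eqP => xq; case: eqP => zq; rewrite /y.
  - by lia.
  - by have := mono q z ltac:(lia); lia.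
  - by have := mono' x p ltac:(lia); lia.
  - exact: mono.
have fpi : incn (fun t => if t == p then y else f t).
  move=> x z xz; rewrite -!(inj_eq val_inj) /=; case: eqP => xq; case: eqP => zq; rewrite /y.
  - by lia.
  - by have := mono' q z ltac:(lia); lia.
  - by have := mono x p ltac:(lia); lia.
  - exact: mono.
have yN : (y < N)%N by have := fN q; rewrite /y; lia.
have Dq : 0 < c * \det (cmx A (fun t => if t == q then y else f t)).
  rewrite lt_neqAle nn ?andbT //; last by move=> t; case: eqP.
  rewrite eq_sym mulf_neq0 // IHs //; last by move=> t; case: eqP.
  rewrite -ltnS (leq_trans _ fs) // ltnS (bigD1 q) //= eqxx [in X in (_ < X)%N](bigD1 q) //=.
  rewrite -addSn leq_add //; first by rewrite /y; lia.
  by apply: leq_sum => t /negPf ->.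
have Dp : 0 <= c * \det (cmx A (fun t => if t == p then y else f t)).
  by apply: nn => // t; case: eqP.
have D0p := front f p fi fN f0; have D0q := front f q fi fN f0.
have [v v0 Bv] := kernel_vector df.
(* A three-term Pluecker relation in which one term drops out because the minor of [f] vanishes.
   Column 0 in the adjacent positions p and q has opposite signs, so a positive number would equal a
   nonpositive one. *)
have key : \det (cmx A (fun t => if t == p then 0%N else f t)) *
           \det (cmx A (fun t => if t == q then y else f t)) =
           \det (cmx A (fun t => if t == q then 0%N else f t)) *
           \det (cmx A (fun t => if t == p then y else f t)).
  rewrite -!replcol_cmx !det_replcol; apply: adj_kernel => //.
  by rewrite mulmxA mul_mx_adj df mul_scalar_mx scale0r.
move: D0p D0q Dp Dq key; rewrite pq exprS mulN1r.
set a1 := \det _; set a2 := \det _; set a3 := \det _; set a4 := \det _.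
move=> h1 h2 h3 h4 key.
have h5 := mulr_gt0 h1 h4; have h6 := mulr_ge0 (ltW h2) h3.
have E : c * ((-1) ^+ p * a1) * (c * a4) = - (c * (- (-1) ^+ p * a2) * (c * a3)).
  transitivity (c * c * (-1) ^+ p * (a1 * a4)); first by lra.
  by rewrite key; lra.
by rewrite E oppr_gt0 ltNge h6 in h5.
Qed.

End ConsecutiveMinors.

(** * Cyclic sweeps *)

Section SweepE.
Variables (R : realType) (n : nat).
Hypothesis n_gt0 : (0 < n)%N.

Lemma gnn_weak r c (M : 'M[R]_(r, n)) (f : 'I_r -> int) : gnn c M ->
  (forall s t : 'I_r, (s < t)%N -> f s <= f t <= f s + n%:Z) ->
  0 <= c * \det (mcols (twist_sign R r) M f).
Proof.
move=> cM /(ref_minor_ge0 R n_gt0); rewrite le_eqVlt => /orP[/eqP ref0|refpos].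
  have [a [rho [a0 aE]]] := det_mcols_mod R n_gt0 f.
  move: ref0; rewrite (ref_minorE _ n_gt0) !aE => /esym/eqP.
  rewrite mulf_eq0 (negPf a0) /= => rho0.
  rewrite (@colsub_ninj R n r rho) ?mulr0 // => rinj.
  have [s [e [si e2 eE]]] := colsub_sort R rinj; move: rho0; rewrite eE mulf_eq0.
  have := veronese_gpos R n_gt0 si; rewrite mul1r => /gt_eqF ->.
  by rewrite orbF => /eqP e0; move: e2; rewrite e0 expr0n => /eqP; rewrite eq_sym oner_eq0.
by have := gnn_ref n_gt0 f cM; rewrite pmulr_lge0.
Qed.

Lemma gnn_strict r c (M : 'M[R]_(r, n)) (f : 'I_r -> int) : gnn c M ->
  (forall s t : 'I_r, (s < t)%N -> f s < f t < f s + n%:Z) ->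
  0 <= c * \det (mcols (twist_sign R r) M f).
Proof. by move=> cM fi; apply: gnn_weak => // s t /fi/andP[/ltW-> /ltW->]. Qed.

Lemma gnn_consecutive r c (M : 'M[R]_(r, n)) (s : 'I_r -> 'I_n) :
  (r <= n)%N -> c != 0 -> gnn c M ->
  (forall a, wmx (twist_sign R r) M a r \in unitmx) ->
  increasing s -> maximal_minor M s != 0.
Proof.
move=> rn c0 cM Mu si; pose A j := ext_col (twist_sign R r) M (1 + j%:Z).
have AE f : cmx A f = mcols (twist_sign R r) M (fun t => 1 + (f t)%:Z).
  by apply/matrixP => i t; rewrite [LHS]mxE [RHS]mxE.
rewrite maximal_minorE -[mcols _ _ _](_ : cmx A s = _); last first.
  by rewrite AE; apply/matrixP => i t; rewrite [LHS]mxE [RHS]mxE intS.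
apply: (consecutive_minors_neq0 rn c0) => [f fi fN|j jN|j jr|//|t]; last exact: ltn_ord.
- rewrite AE; apply: gnn_strict => // x y /fi; have := fN y.
  by move: (f x) (f y) => a b; lia.
- rewrite AE -unitfE -unitmxE.
  rewrite (_ : mcols _ _ _ = wmx (twist_sign R r) M (1 + j%:Z) r); first exact: Mu.
  by apply/matrixP => i t; rewrite [LHS]mxE [RHS]mxE PoszD addrA.
- rewrite AE -unitfE -unitmxE -row_free_unit -kermx_eq0; apply/rowV0P => v.
  move=> /sub_kermxP vh.
  have {}vh (t : 'I_r) : v *m ext_col (twist_sign R r) M
      (1 + (if (t < j)%N then t : nat else n - r + t)%N%:Z) = 0.
    apply/matrixP => a b; have /matrixP/(_ a t) := vh; rewrite !mxE => E.
    rewrite -[RHS]E; apply: eq_bigr => x _; congr (_ * _).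
    by rewrite [RHS]mxE (ord1 b).
  (* The wrapped columns are those of the window from [a], rotated and partly rescaled by the twist
     sign. Left kernels do not see either change, so no determinant sign has to be computed. *)
  pose a := (n - r + j).+1%:Z.
  apply/eqP; rewrite -(mulmx_free_eq0 _ (_ : row_free (wmx (twist_sign R r) M a r))).
    apply/eqP/matrixP => x t; rewrite (ord1 x) [LHS]mxE [RHS]mxE.
    have : v *m ext_col (twist_sign R r) M (a + (t : nat)%:Z) = 0.
      case: (ltnP (t + j) r) => tj.
        have := vh (Ordinal tj); rewrite /= ltnNge leq_addl /= => <-.
        by congr (_ *m ext_col _ _ _); rewrite /a; lia.
      have tr : (t + j - r < r)%N by have := ltn_ord t; lia.
      have := vh (Ordinal tr); rewrite /= (_ : (_ < j)%N); last by have := ltn_ord t; lia.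
      move=> E; have -> : a + (t : nat)%:Z = 1 + (t + j - r)%N%:Z + n%:Z.
        by rewrite /a; have := ltn_ord t; lia.
      by rewrite ext_colD ?twist_sign_neq0 // -scalemxAr E scaler0.
    move=> /matrixP/(_ 0 0); rewrite !mxE => E; rewrite -[RHS]E.
    by apply: eq_bigr => z _; congr (_ * _); rewrite [LHS]mxE.
  by rewrite row_free_unit Mu.
Qed.

(* Right multiplication by a totally nonnegative cyclic bidiagonal matrix. *)
Definition sweep r (s : R) (M : 'M[R]_(r, n)) : 'M[R]_(r, n) :=
  \matrix_(i, c) (ext_col (twist_sign R r) M (c : nat).+1%:Z i 0 +
                  s * ext_col (twist_sign R r) M (c : nat).+2%:Z i 0).

Lemma ext_col_sweep r s (M : 'M[R]_(r, n)) j :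
  ext_col (twist_sign R r) (sweep s M) j =
  ext_col (twist_sign R r) M j + s *: ext_col (twist_sign R r) M (j + 1).
Proof.
have [q [c ->]] := int_modE j n_gt0.
rewrite addrAC !ext_colMn ?twist_sign_neq0 //.
rewrite [s *: _]scalerA [s * _]mulrC -scalerA -scalerDr; congr (_ *: _).
rewrite ext_col_ord ?twist_sign_neq0 //; apply/matrixP => i z.
rewrite (ord1 z) mxE [LHS]mxE [RHS]mxE [X in _ = _ + X]mxE; congr (_ + _ * _).
by congr (ext_col _ _ _ _ _); lia.
Qed.

Lemma sweep_mul r s (g : 'M[R]_r) (M : 'M[R]_(r, n)) : sweep s (g *m M) = g *m sweep s M.
Proof.
apply/matrixP => i c; rewrite mxE !ext_col_mul [RHS]mxE.
under [RHS]eq_bigr => x _ do rewrite mxE mulrDr mulrCA.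
by rewrite big_split -mulr_sumr /= ![(_ *m _) _ _]mxE.
Qed.

Lemma sweep0 r (M : 'M[R]_(r, n)) : sweep 0 M = M.
Proof.
apply/matrixP => i c; rewrite mxE mul0r addr0 ext_col_ord ?twist_sign_neq0 //.
by rewrite mxE.
Qed.

Lemma det_sweep r s (M : 'M[R]_(r, n)) (f : 'I_r -> int) :
  \det (mcols (twist_sign R r) (sweep s M) f) =
  \sum_(S : {ffun 'I_r -> bool}) (\prod_t (if S t then s else 1)) *
    \det (mcols (twist_sign R r) M (fun t => f t + (S t : nat)%:Z)).
Proof.
transitivity (\det (\matrix_(i < r, t < r) \sum_(a : bool) (if a then s else 1) *
      ext_col (twist_sign R r) M (f t + (a : nat)%:Z) i 0)).
  congr (\det _); apply/matrixP => i t; rewrite [LHS]mxE [RHS]mxE ext_col_sweep.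
  by rewrite big_bool /= addr0 mul1r [LHS]mxE [X in _ + X = _]mxE addrC.
rewrite (det_sum_cols (fun (a : bool) i t => (if a then s else 1) *
      ext_col (twist_sign R r) M (f t + (a : nat)%:Z) i 0)).
apply: eq_bigr => S _; rewrite -det_scale_cols; congr (\det _).
by apply/matrixP => i t; rewrite [LHS]mxE [RHS]mxE [in RHS]mxE.
Qed.

Lemma gnn_sweep r c s (M : 'M[R]_(r, n)) : 0 <= s -> gnn c M -> gnn c (sweep s M).
Proof.
move=> s0 cM x xi; rewrite maximal_minorE det_sweep mulr_sumr.
apply: sumr_ge0 => S _; rewrite mulrCA mulr_ge0 //.
  by apply: prodr_ge0 => t _; case: ifP.
apply: gnn_weak => // a b /xi; have := ltn_ord (x b).
by move: (nat_of_ord (x a)) (nat_of_ord (x b)) => u v; case: (S a); case: (S b); lia.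
Qed.

Lemma gnn_iter_sweep r c s K (M : 'M[R]_(r, n)) : 0 <= s -> gnn c M ->
  gnn c (iter K (sweep s) M).
Proof. by move=> s0 cM; elim: K => [|K IH] //=; apply: gnn_sweep. Qed.

(** In the expansion [det_sweep], the term where exactly the columns behind their target advance is
    positive by induction; all others are nonnegative. *)
Lemma iter_sweep_gt0 r c s K (M : 'M[R]_(r, n)) (f g : 'I_r -> int) :
  0 < s -> gnn c M ->
  (forall a b : 'I_r, (a < b)%N -> g a < g b < g a + n%:Z) ->
  0 < c * \det (mcols (twist_sign R r) M g) ->
  (forall a b : 'I_r, (a < b)%N -> f a < f b < f a + n%:Z) ->
  (forall t, f t <= g t <= f t + K%:Z) ->
  0 < c * \det (mcols (twist_sign R r) (iter K (sweep s) M) f).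
Proof.
move=> s0 cM gi gpos; elim: K f => [|K IH] f fi fg.
  rewrite (_ : mcols _ _ _ = mcols (twist_sign R r) M g) //.
  apply/matrixP => i t; rewrite [LHS]mxE [RHS]mxE; congr (ext_col _ _ _ _ _).
  by have := fg t; lia.
rewrite iterS det_sweep mulr_sumr; pose S := [ffun t : 'I_r => f t < g t].
rewrite (bigD1 S) //= ltr_wpDr //.
  apply: sumr_ge0 => S' _; rewrite mulrCA mulr_ge0 //.
    by apply: prodr_ge0 => t _; case: ifP; rewrite ?ltW.
  apply: gnn_weak => [|a b /fi]; first exact/gnn_iter_sweep/cM/ltW.
  by case: (S' a); case: (S' b); lia.
rewrite mulrCA mulr_gt0 //; first by apply: prodr_gt0 => t _; case: ifP.
apply: IH => [a b ab|t]; rewrite !ffunE.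
  by have := fi a b ab; have := gi a b ab; have := fg a; have := fg b; lia.
by have := fg t; lia.
Qed.

(** The targets are the columns of a nonzero minor moved one period ahead. Any selection in 1, ...,
    n then lies behind them by at most 2n, the number of sweeps. *)
Lemma gpos_iter_sweep r c s (M : 'M[R]_(r, n)) (x : 'I_r -> 'I_n) :
  0 < s -> gnn c M -> increasing x -> c * maximal_minor M x != 0 ->
  gpos c (iter (n + n) (sweep s) M).
Proof.
move=> s0 cM xi x0 y yi; rewrite maximal_minorE.
apply: (@iter_sweep_gt0 _ _ _ _ _ _ (fun t => (x t : nat).+1%:Z + n%:Z)) => //.
- move=> a b /xi; have := ltn_ord (x b).
  by move: (nat_of_ord (x a)) (nat_of_ord (x b)) => u v; lia.
- rewrite lt_neqAle gnn_strict ?andbT //; last first.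
    move=> a b /xi; have := ltn_ord (x b).
    by move: (nat_of_ord (x a)) (nat_of_ord (x b)) => u v; lia.
  rewrite eq_sym; move: x0; rewrite maximal_minorE !mulf_eq0 !negb_or => /andP[-> x0].
  rewrite (_ : mcols _ _ _ = \matrix_(i, t) (twist_sign R r *
      mcols (twist_sign R r) M (fun t => (x t : nat).+1%:Z) i t)).
    rewrite det_scale_cols mulf_neq0 // prodr_const expf_neq0 // twist_sign_neq0 //.
  apply/matrixP => i t; rewrite [LHS]mxE ext_colD ?twist_sign_neq0 // [LHS]mxE.
  by rewrite [RHS]mxE [in RHS]mxE.
- by move=> a b /yi; have := ltn_ord (y b); move: (nat_of_ord (y a)) (nat_of_ord (y b)) => u v; lia.
- move=> t; have := ltn_ord (x t); have := ltn_ord (y t).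
  by move: (nat_of_ord (x t)) (nat_of_ord (y t)) => u v; lia.
Qed.

End SweepE.

(** * Connectedness of the positive matrices *)

Section EntrywiseLimits.
Variables (R : realType) (T : Type) (F : set_system T).
Context {FF : Filter F}.

(** Working with entries reduces limits of determinants and inverses to limits of real sums and
    products; [mcvg_cvg] returns to the topology of matrices. *)
Definition mcvg (m n : nat) (A : T -> 'M[R]_(m, n)) (A0 : 'M[R]_(m, n)) :=
  forall i j, A x i j @[x --> F] --> A0 i j.

Lemma cvg_sumr (I : Type) (r : seq I) (P : pred I) (f : I -> T -> R) (a : I -> R) :
  (forall i, f i x @[x --> F] --> a i) ->
  \sum_(i <- r | P i) f i x @[x --> F] --> \sum_(i <- r | P i) a i.
Proof.
move=> fa; elim: r => [|i r IH].
  under eq_fun do rewrite big_nil.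
  by rewrite big_nil; exact: cvg_cst.
under eq_fun do rewrite big_cons.
rewrite big_cons; case: (P i) => //.
exact: (cvgD (fa i) IH).
Qed.

Lemma cvg_prodr (I : Type) (r : seq I) (P : pred I) (f : I -> T -> R) (a : I -> R) :
  (forall i, f i x @[x --> F] --> a i) ->
  \prod_(i <- r | P i) f i x @[x --> F] --> \prod_(i <- r | P i) a i.
Proof.
move=> fa; elim: r => [|i r IH].
  under eq_fun do rewrite big_nil.
  by rewrite big_nil; exact: cvg_cst.
under eq_fun do rewrite big_cons.
rewrite big_cons; case: (P i) => //.
exact: (cvgM (fa i) IH).
Qed.

Lemma mcvg_cst m n (A : 'M[R]_(m, n)) : mcvg (fun=> A) A.
Proof. by move=> i j; exact: cvg_cst. Qed.

Lemma mcvg_mul m n p (A : T -> 'M[R]_(m, n)) (B : T -> 'M[R]_(n, p)) A0 B0 :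
  mcvg A A0 -> mcvg B B0 -> mcvg (fun x => A x *m B x) (A0 *m B0).
Proof.
move=> AA BB i j; under eq_fun do rewrite mxE.
by rewrite mxE; apply: cvg_sumr => k; exact: cvgM.
Qed.

Lemma mcvg_det n (A : T -> 'M[R]_n) A0 :
  mcvg A A0 -> \det (A x) @[x --> F] --> \det A0.
Proof.
move=> AA; apply: cvg_sumr => s; apply: cvgM; first exact: cvg_cst.
by apply: cvg_prodr => i; exact: AA.
Qed.

Lemma mcvg_tr m n (A : T -> 'M[R]_(m, n)) A0 :
  mcvg A A0 -> mcvg (fun x => (A x)^T) A0^T.
Proof. by move=> AA i j; under eq_fun do rewrite mxE; rewrite mxE; exact: AA. Qed.

Lemma mcvg_sub m n m' n' (f : 'I_m' -> 'I_m) (g : 'I_n' -> 'I_n)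
    (A : T -> 'M[R]_(m, n)) A0 :
  mcvg A A0 -> mcvg (fun x => mxsub f g (A x)) (mxsub f g A0).
Proof. by move=> AA i j; under eq_fun do rewrite mxE; rewrite mxE; exact: AA. Qed.

Lemma mcvg_inv n (A : T -> 'M[R]_n) A0 :
  A0 \in unitmx -> mcvg A A0 -> mcvg (fun x => invmx (A x)) (invmx A0).
Proof.
move=> A0u AA i j.
have A00 : \det A0 != 0 by rewrite -unitfE -unitmxE.
have Adet := mcvg_det AA.
have near_u : \forall x \near F, \det (A x) != 0.
  by apply: (cvgr_neq0 _ Adet).
have -> : invmx A0 i j = (\det A0)^-1 * cofactor A0 j i.
  by rewrite /invmx A0u !mxE.
have C : (\det (A x))^-1 * cofactor (A x) j i @[x --> F] -->
    (\det A0)^-1 * cofactor A0 j i.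
  apply: cvgM; first exact: cvgV.
  apply: cvgM; first exact: cvg_cst.
  apply: mcvg_det => a b; under eq_fun do rewrite !mxE.
  by rewrite !mxE; exact: AA.
apply: cvg_trans C; apply: near_eq_cvg.
by apply: filterS near_u => x xu; rewrite /= /invmx unitmxE unitfE xu /= !mxE.
Qed.

Lemma mcvg_ext_col r n e (M : T -> 'M[R]_(r, n)) M0 j : mcvg M M0 ->
  mcvg (fun x => ext_col e (M x) j) (ext_col e M0 j).
Proof.
move=> MM i z; rewrite /ext_col mxE; under eq_fun do rewrite mxE.
apply: cvgM; first exact: cvg_cst.
case: insubP => [c _ _|_] /=; last exact: cvg_cst.
by rewrite mxE; under eq_fun do rewrite mxE; exact: MM.
Qed.

Lemma mcvg_mcols r n N e (M : T -> 'M[R]_(r, n)) M0 (f : 'I_N -> int) : mcvg M M0 ->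
  mcvg (fun x => mcols e (M x) f) (mcols e M0 f).
Proof.
move=> MM i t; rewrite /mcols mxE; under eq_fun do rewrite mxE.
exact: mcvg_ext_col.
Qed.

Lemma mcvg_sweep r n (s : T -> R) s0 (M : T -> 'M[R]_(r, n)) M0 :
  s x @[x --> F] --> s0 -> mcvg M M0 -> mcvg (fun x => sweep (s x) (M x)) (sweep s0 M0).
Proof.
move=> ss MM i c; rewrite /sweep mxE; under eq_fun do rewrite mxE.
by apply: cvgD; [|apply: cvgM => //]; exact: mcvg_ext_col.
Qed.

Lemma mcvg_iter_sweep r n (s : T -> R) s0 (M : T -> 'M[R]_(r, n)) M0 K :
  s x @[x --> F] --> s0 -> mcvg M M0 ->
  mcvg (fun x => iter K (sweep (s x)) (M x)) (iter K (sweep s0) M0).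
Proof. by move=> ss MM; elim: K => [|K IH] //=; apply: mcvg_sweep. Qed.

Lemma mcvg_dualtw k l n b (M : T -> 'M[R]_(k + l, n)) M0 : windows_free M0 ->
  mcvg M M0 -> mcvg (fun x => dualtw b (M x)) (dualtw b M0).
Proof.
move=> Mw MM i c; rewrite /dualtw mxE; under eq_fun do rewrite mxE.
apply: mcvg_mul; last exact: mcvg_cst.
apply: mcvg_tr; apply: mcvg_inv; first exact: Mw.
exact: mcvg_mcols.
Qed.

Lemma mcvg_minor r n (M : T -> 'M[R]_(r, n)) M0 s : mcvg M M0 ->
  maximal_minor (M x) s @[x --> F] --> maximal_minor M0 s.
Proof. by move=> MM; apply: mcvg_det; apply: mcvg_sub. Qed.

Lemma mcvg_altx r n (M : T -> 'M[R]_(r, n)) M0 : mcvg M M0 ->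
  mcvg (fun x => altx (M x)) (altx M0).
Proof.
move=> MM i j; rewrite mxE; under eq_fun do rewrite mxE.
by apply: cvgM; [exact: cvg_cst|exact: MM].
Qed.

Lemma mcvg_col_mx m1 m2 n (A : T -> 'M[R]_(m1, n)) (B : T -> 'M[R]_(m2, n)) A0 B0 :
  mcvg A A0 -> mcvg B B0 -> mcvg (fun x => col_mx (A x) (B x)) (col_mx A0 B0).
Proof.
move=> AA BB i j; rewrite mxE; under eq_fun do rewrite mxE.
by case: fintype.split => x; [exact: AA|exact: BB].
Qed.

End EntrywiseLimits.

Lemma segment_constant (R : realType) (P : R -> Prop) :
  (forall t, 0 <= t <= 1 -> P t -> \forall u \near t, 0 <= u <= 1 -> P u) ->
  (forall t, 0 <= t <= 1 -> ~ P t -> \forall u \near t, 0 <= u <= 1 -> ~ P u) ->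
  P 0 -> P 1.
Proof.
move=> oP oN P0; pose I : set R := [set` `[0, 1]].
have II t : I t = (0 <= t <= 1) by rewrite /I /= in_itv.
suff E : I `&` [set t | P t] = I.
  by have : I 1 by [rewrite II ler01 lexx]; rewrite -E => -[].
apply: (@segment_connected R 0 1) => [| |].
- by exists 0; split => //; rewrite -/I II lexx ler01.
- exists ([set t | 0 <= t <= 1 -> P t]^°); first exact: open_interior.
  apply/seteqP; split=> t [It Pt]; split=> //.
    by apply: oP => //; rewrite -II.
  by apply: (interior_subset Pt); rewrite -II.
- exists (~` [set t | 0 <= t <= 1 -> ~ P t]^°).
    exact/open_closedC/open_interior.
  apply/seteqP; split=> t [It Pt]; split=> //.
    by move=> /interior_subset; apply; rewrite -?II.
  by apply: contrapT => nP; apply: Pt; apply: oN.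
Qed.

Section Connectedness.
Variables (R : realType) (r n : nat).
Hypotheses (n_gt0 : (0 < n)%N) (rn : (r <= n)%N).

Definition is_gpos (M : 'M[R]_(r, n)) := exists c, gpos c M.

(* Sweeping joins M to a swept matrix; scaling the columns of index at least r
   to 0 before sweeping then joins it to a translate of a fixed matrix. *)
Lemma gpos_connected (Q : 'M[R]_(r, n) -> Prop) :
  (forall g M, g \in unitmx -> Q M -> Q (g *m M)) ->
  (forall gam : R -> 'M[R]_(r, n),
     (forall t, mcvg (nbhs t) gam (gam t)) ->
     (forall t, 0 <= t <= 1 -> is_gpos (gam t)) -> (Q (gam 0) <-> Q (gam 1))) ->
  forall M M', is_gpos M -> is_gpos M' -> Q M -> Q M'.
Proof.
move=> Qg Qpath.
pose Y0 := iter (n + n) (sweep 1) (pid_mx r : 'M[R]_(r, n)).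
suff H M : is_gpos M -> (Q M <-> Q Y0) by move=> M M' /H MY /H MY' /MY/MY'.
move=> [c cM]; pose w := widen_ord rn.
have wi : increasing w by [].
have cw : c * maximal_minor M w != 0 by rewrite gt_eqF // cM.
pose gam1 s := iter (n + n) (sweep s) M.
have Q1 : Q M <-> Q (gam1 1).
  rewrite -[M in Q M](_ : gam1 0 = M); last first.
    by rewrite /gam1; elim: (n + n)%N => //= K ->; rewrite sweep0.
  apply: Qpath => [t|t /andP[t0 _]].
    by apply: mcvg_iter_sweep; [exact: cvg_id|exact: mcvg_cst].
  exists c; move: t0; rewrite le_eqVlt => /orP[/eqP <-|t0].
    by rewrite /gam1; elim: (n + n)%N => //= K; rewrite sweep0.
  by apply: (gpos_iter_sweep n_gt0 t0 _ wi cw); exact: gpos_gnn.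
pose D (h : R) : 'M[R]_(r, n) := \matrix_(i, j) ((if (j < r)%N then 1 else h) * M i j).
pose gam2 h := iter (n + n) (sweep 1) (D h).
have Q2 : Q (gam2 0) <-> Q (gam2 1).
  apply: Qpath => [t|t /andP[t0 _]].
    apply: mcvg_iter_sweep; first exact: cvg_cst.
    move=> i j; rewrite /D mxE; under eq_fun do rewrite mxE.
    by apply: cvgM; [case: ifP => _; [exact: cvg_cst|exact: cvg_id]|exact: cvg_cst].
  have Dm s : maximal_minor (D t) s =
      (\prod_(i < r) (if (s i < r)%N then 1 else t)) * maximal_minor M s.
    rewrite /maximal_minor -det_scale_cols; congr (\det _).
    by apply/matrixP => i j; rewrite !mxE.
  (* At t = 0 the scaled matrix need only be nonnegative, but its leading minor is unchanged, and
     one nonzero minor suffices for the sweeps. *)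
  exists c; apply: (gpos_iter_sweep n_gt0 ltr01 _ wi) => [s si|].
    rewrite Dm mulrCA mulr_ge0 //; first by apply: prodr_ge0 => i _; case: ifP.
    exact/ltW/cM.
  by rewrite Dm big1 ?mul1r // => i _; rewrite /= ltn_ord.
rewrite Q1 -[gam1 1](_ : gam2 1 = _); last first.
  by congr (iter _ _ _); apply/matrixP => i j; rewrite mxE if_same mul1r.
rewrite -Q2.
have G : colsub w M \in unitmx.
  by rewrite unitmxE unitfE; move: cw; rewrite mulf_eq0 negb_or => /andP[].
have -> : gam2 0 = colsub w M *m Y0.
  have -> : colsub w M *m Y0 = iter (n + n) (sweep 1) (colsub w M *m (pid_mx r : 'M[R]_(r, n))).
    by rewrite /Y0; elim: (n + n)%N => //= K <-; rewrite sweep_mul.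
  congr (iter _ _ _); apply/matrixP => i j; rewrite !mxE.
  case: ltnP => jr.
    rewrite mul1r (bigD1 (Ordinal jr)) //= big1 ?addr0 => [|x xj].
      by rewrite !mxE eqxx ltn_ord /= mulr1; congr (M i _); apply: val_inj.
    rewrite !mxE (_ : (_ == _) = false) ?mulr0 //.
    by apply/negbTE; apply: contra xj => /eqP xj; apply/eqP/val_inj.
  rewrite mul0r big1 // => x _; rewrite !mxE (_ : (_ == _) = false) ?mulr0 //.
  by apply/negbTE; rewrite neq_ltn (leq_trans (ltn_ord x) jr).
split; last exact: Qg.
by move=> /(Qg (invmx (colsub w M))); rewrite unitmx_inv mulKmx // => /(_ G).
Qed.

End Connectedness.

(** * The dual of the Veronese matrices *)

Section VeroneseShift.
Variables (R : realType) (n : nat).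
Hypothesis n_gt0 : (0 < n)%N.

Lemma gpos_window_unit r c (M : 'M[R]_(r, n)) a : (r <= n)%N -> gpos c M ->
  wmx (twist_sign R r) M a r \in unitmx.
Proof.
move=> rn cM; rewrite unitmxE unitfE.
have refp : 0 < ref_minor R n (fun t : 'I_r => a + (t : nat)%:Z).
  by apply: ref_minor_gt0 => // s t st; have := ltn_ord t; lia.
have := gpos_ref n_gt0 cM (lt0r_neq0 refp).
by apply: contraTneq; rewrite /wmx => ->; rewrite mulr0 mul0r ltxx.
Qed.

Lemma wmx_widen_free r N N' e (M : 'M[R]_(r, n)) a : (N <= N')%N ->
  row_free (wmx e M a N) -> row_free (wmx e M a N').
Proof.
move=> NN; have -> : wmx e M a N = wmx e M a N' *m colsub (widen_ord NN) 1%:M.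
  rewrite mulmx_colsub mulmx1; apply/matrixP => i t.
  by rewrite [LHS]mxE [RHS]mxE [RHS]mxE.
rewrite /row_free => /eqP rk; rewrite eqn_leq rank_leq_row -{1}rk.
exact: mxrankM_maxl.
Qed.

Lemma wmx_row_free r N e (M : 'M[R]_(r, n)) a :
  row_free (wmx e M a N) -> row_free M.
Proof.
move=> Mw; rewrite -kermx_eq0; apply/rowV0P => v /sub_kermxP vM.
apply/eqP; rewrite -(mulmx_free_eq0 _ Mw) /wmx -mcols_mul vM.
apply/eqP/matrixP => i t; rewrite [LHS]mxE [RHS]mxE /ext_col mxE.
by case: insubP => [c _ _|_] /=; rewrite mxE ?mxE mulr0.
Qed.

Lemma gpos_window_free r c (M : 'M[R]_(r, n)) a N : (r <= N)%N -> (r <= n)%N ->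
  gpos c M -> row_free (wmx (twist_sign R r) M a N).
Proof.
move=> rN rn cM; apply: (wmx_widen_free rN).
by rewrite row_free_unit (gpos_window_unit _ _ cM).
Qed.

(** The rotation-invariant form on binary forms of degree r - 1: by the binomial theorem it pairs
    two Veronese vectors to a power of the cosine of their angle difference. *)
Definition binomial_form (r : nat) : 'M[R]_r := diag_mx (\row_i ('C(r.-1, i))%:R).

Lemma binomial_form_unit r : binomial_form r \in unitmx.
Proof.
rewrite unitmxE unitfE det_diag; apply/prodf_neq0 => i _; rewrite mxE.
rewrite pnatr_eq0 -lt0n bin_gt0; case: r i => [[]//|r] i.
by rewrite -ltnS.
Qed.

Lemma veronese_form r i j :
  (0 < r)%N -> ((veronese R n r i)^T *m binomial_form r *m veronese R n r j) 0 0 =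
  cos (angle R n i - angle R n j) ^+ r.-1.
Proof.
case: r => // r _; rewrite cosB exprDn mxE; apply: eq_bigr => s _.
rewrite mul_mx_diag !mxE /= -[RHS]mulr_natr !exprMn.
have E (x y z u v : R) : x * y * z * (u * v) = x * u * (y * v) * z by lra.
exact: E.
Qed.

(** [A] is defined on the vectors 1, ..., r. Since pairings depend only on differences of indices,
    it shifts all the other vectors as well and preserves the form. *)
Lemma veronese_shift r : (r <= n)%N -> exists A : 'M[R]_r,
  (forall j, veronese R n r (j + 1) = A *m veronese R n r j) /\
  A^T *m binomial_form r *m A = binomial_form r.
Proof.
move=> rn; case: (posnP r) => [->|r_gt0].
  by exists 0; split=> [j|]; apply/matrixP => -[].
pose W a := \matrix_(i, t < r) veronese R n r (a + (t : nat)%:Z) i 0.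
have Wu a : W a \in unitmx.
  rewrite unitmxE unitfE det_veronese // gt_eqF // ref_minor_gt0 // => s t st /=.
  by have := ltn_ord t; lia.
pose H := binomial_form r; pose V := veronese R n r.
have ent a (B : 'M[R]_r) j t : ((W a)^T *m B *m V j) t 0 =
    ((V (a + (t : nat)%:Z))^T *m B *m V j) 0 0.
  rewrite mxE [RHS]mxE; apply: eq_bigr => x _; congr (_ * _).
  rewrite mxE [RHS]mxE; apply: eq_bigr => y _; congr (_ * _).
  by rewrite !mxE.
have shift j : (W 2)^T *m H *m V (j + 1) = (W 1)^T *m H *m V j.
  apply/matrixP => t z; rewrite (ord1 z) !ent !veronese_form //.
  by rewrite !angleB; congr (cos (_ * _%:~R / _) ^+ _); lia.
have W2H : (W 2)^T *m H \in unitmx.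
  by rewrite unitmx_mul unitmx_tr Wu binomial_form_unit.
pose A := W 2 *m invmx (W 1).
have colW a t : col t (W a) = V (a + (t : nat)%:Z).
  by apply/matrixP => x z; rewrite !mxE.
have WW : (W 2)^T *m H *m W 2 = (W 1)^T *m H *m W 1.
  apply/matrixP => s t; have /matrixP/(_ s 0) := shift (1 + (t : nat)%:Z).
  rewrite (_ : 1 + t%:Z + 1 = 2 + t%:Z) -?colW; last by lia.
  by rewrite !colE !mulmxA -!colE !mxE.
have AW : A *m W 1 = W 2 by rewrite mulmxKV.
have VA j : V (j + 1) = A *m V j.
  apply: (can_inj (mulKmx W2H)); rewrite shift /A !mulmxA WW.
  by rewrite mulmxK.
have W1T : (W 1)^T \in unitmx by rewrite unitmx_tr.
clearbody A; exists A; split=> //.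
apply: (can_inj (mulKmx W1T)); apply: (can_inj (mulmxK (Wu 1))).
by rewrite -WW -AW trmx_mul !mulmxA.
Qed.

(* The rows of a sequence intertwined with the Veronese shift lie in the row
   space of the Veronese matrix, since the shift commutes with itself. *)
Lemma veronese_intertwined r (A : 'M[R]_r) (y : int -> 'cV[R]_r) : (r <= n)%N ->
  (forall j, veronese R n r (j + 1) = A *m veronese R n r j) ->
  (forall j, y (j + 1) = A *m y j) ->
  exists C : 'M[R]_r, forall q : nat, y q.+1%:Z = C *m veronese R n r q.+1%:Z.
Proof.
move=> rn VA yA; pose V := veronese R n r.
pose W := \matrix_(i, t < r) V (1 + (t : nat)%:Z) i 0.
have Wu : W \in unitmx.
  rewrite unitmxE unitfE det_veronese // gt_eqF // ref_minor_gt0 // => s t st /=.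
  by have := ltn_ord t; lia.
have VAt t j : V (j + t%:Z) = iter t (mulmx A) (V j).
  elim: t => [|t IH]; first by rewrite addr0.
  by rewrite iterS -IH -VA; congr V; lia.
(* These are the coordinates of [y 1] in the basis A^t V(1), t < r. They give y 1 = C V(1) with C a
   polynomial in [A], which commutes with [A]. *)
pose al := invmx W *m y 1.
pose Apow t := iter t (mulmx A) 1%:M.
have itE t (v : 'cV[R]_r) : iter t (mulmx A) v = Apow t *m v.
  by elim: t => [|t IH]; rewrite /Apow /= ?mul1mx // IH mulmxA.
have comm t : Apow t *m A = A *m Apow t.
  by elim: t => [|t IH]; rewrite /Apow /= ?mul1mx ?mulmx1 // -mulmxA -/(Apow t) IH.
exists (\sum_t al t 0 *: Apow t) => q; elim: q => [|q IH].
  rewrite -[y 1](mulKVmx Wu) -/al mulmx_suml.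
  apply/matrixP => i z; rewrite (ord1 z) mxE summxE; apply: eq_bigr => t _.
  by rewrite -scalemxAl -itE -VAt !mxE mulrC.
have -> : q.+2%:Z = q.+1%:Z + 1 by lia.
rewrite yA IH VA !mulmxA; congr (_ *m _).
rewrite mulmx_suml mulmx_sumr; apply: eq_bigr => t _.
by rewrite -scalemxAl -scalemxAr comm.
Qed.

End VeroneseShift.

Lemma rank_wmx_altx (R : realType) (k l m n : nat) (N : nat) (X : 'M[R]_(l, n)) a :
  (0 < n)%N -> ~~ odd m -> (k + l + m)%N = n ->
  \rank (wmx (twist_sign R k) (altx X) a N) = \rank (wmx (twist_sign R l) X a N).
Proof.
move=> n_gt0 m_even klm.
pose d : 'rV[R]_N := \row_t (-1) ^ (a + (t : nat)%:Z - 1).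
have -> : wmx (twist_sign R k) (altx X) a N = wmx (twist_sign R l) X a N *m diag_mx d.
  apply/matrixP => i t; rewrite mul_mx_diag [LHS]mxE (ext_col_altx n_gt0 m_even klm).
  by rewrite [LHS]mxE [RHS]mxE mulrC [X in _ = X * _]mxE [X in _ = _ * X]mxE.
apply: mxrankMfree; rewrite row_free_unit unitmxE unitfE det_diag.
by apply/prodf_neq0 => t _; rewrite mxE expfz_neq0 // oppr_eq0 oner_eq0.
Qed.

Section Halves.
Variables (R : realType) (k l m n : nat).
Hypotheses (n_gt0 : (0 < n)%N) (m_even : ~~ odd m) (klm : (k + l + m)%N = n).
Variables (b : bool) (V : 'M[R]_(k, n)) (X : 'M[R]_(l, n)).
Let M := col_mx V (altx X).
Let T := dualtw b M.
Hypothesis Mw : windows_free M.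

Lemma lkm : (l + k + m)%N = n. Proof. by rewrite (addnC l). Qed.

(** [rank_dual] with q = k compares these windows with windows of l columns of [altx X], which have
    full rank; for the lower half q = l and [V] are used. *)
Lemma dual_top_windows d a : gpos d X ->
  wmx (twist_sign R k) (altx (usubmx T)) a k \in unitmx.
Proof.
move=> dX; rewrite -row_free_unit /row_free.
rewrite -(rank_wmx_altx _ _ _ n_gt0 m_even lkm) altxK.
have [_] := rank_dual n_gt0 m_even klm b Mw a (leq_addr l k).
rewrite addKn col_mxKd (rank_wmx_altx _ _ _ n_gt0 m_even klm).
have ln : (l <= n)%N by rewrite -klm; lia.
have /eqP -> := gpos_window_free n_gt0 (a + k%:Z - l%:Z) (leqnn l) ln dX.
by move=> /addIn ->.
Qed.

Lemma dual_bottom_windows c a : gpos c V ->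
  wmx (twist_sign R l) (dsubmx T) a l \in unitmx.
Proof.
move=> cV; rewrite -row_free_unit /row_free.
have [+ _] := rank_dual n_gt0 m_even klm b Mw a (leq_addl k l).
rewrite addnK col_mxKu.
have kn : (k <= n)%N by rewrite -klm; lia.
have /eqP -> := gpos_window_free n_gt0 (a + l%:Z - l%:Z) (leqnn k) kn cV.
by rewrite addnC [RHS]addnC => /addnI ->.
Qed.

End Halves.

(** * Positivity of the dual *)

Lemma signzS (R : unitRingType) (x : int) : (-1) ^ (x + 1) = - (-1) ^ x :> R.
Proof. by rewrite exprzDr ?unitrN1 // expr1z mulrN1. Qed.

Section RelativePositivity.
Variables (R : realType) (n r : nat).
Hypotheses (n_gt0 : (0 < n)%N) (rn : (r <= n)%N).
Implicit Types M : 'M[R]_(r, n).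

Lemma increasing_widen : increasing (widen_ord rn).
Proof. by []. Qed.

Lemma window_first_minor M : wmx (twist_sign R r) M 1 r \in unitmx ->
  maximal_minor M (widen_ord rn) != 0.
Proof.
rewrite unitmxE unitfE maximal_minorE /wmx.
by rewrite (_ : mcols _ _ _ = mcols (twist_sign R r) M (fun t => (widen_ord rn t : nat).+1%:Z)).
Qed.

(** One fixed minor replaces the unknown scalar, so that the hypotheses pass to limits;
    [gnn_consecutive] then makes the inequalities strict. *)
Lemma relative_gpos M :
  (forall a, wmx (twist_sign R r) M a r \in unitmx) ->
  (forall s, increasing s ->
     0 <= maximal_minor M (widen_ord rn) * maximal_minor M s) -> is_gpos M.
Proof.
move=> Mu M0; have m0 := window_first_minor (Mu 1).
exists (maximal_minor M (widen_ord rn)) => s si.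
rewrite lt_neqAle M0 // andbT eq_sym mulf_neq0 //.
exact: (gnn_consecutive n_gt0 rn m0).
Qed.

Lemma is_gpos_mul M (g : 'M[R]_r) : g \in unitmx -> is_gpos M -> is_gpos (g *m M).
Proof.
by rewrite unitmxE unitfE => gu [c cM]; exists (c / \det g); exact: gpos_mul.
Qed.

Lemma is_gpos_prod M s s' : is_gpos M -> increasing s -> increasing s' ->
  0 < maximal_minor M s * maximal_minor M s'.
Proof.
move=> [c cM] si si'; have := mulr_gt0 (cM _ si) (cM _ si').
have c0 : c != 0 by apply: contraTneq (cM _ si) => ->; rewrite mul0r ltxx.
have E (x y z : R) : x * y * (x * z) = x ^+ 2 * (y * z) by lra.
by rewrite E pmulr_rgt0 // exprn_even_gt0.
Qed.

(** Positivity consists of finitely many strict inequalities. Given nonvanishing windows,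
    [relative_gpos] detects its failure by a strictly negative product of two minors, which persists
    nearby too. *)
Lemma is_gpos_clopen (A : R -> 'M[R]_(r, n)) (t : R) : mcvg (nbhs t) A (A t) ->
  (forall a, wmx (twist_sign R r) (A t) a r \in unitmx) ->
  (is_gpos (A t) -> \forall u \near t, is_gpos (A u)) /\
  (~ is_gpos (A t) -> \forall u \near t, ~ is_gpos (A u)).
Proof.
move=> At Au; split=> [[c cA]|nA].
  have H : \forall u \near t, forall s : {ffun 'I_r -> 'I_n}, increasing s ->
      0 < c * maximal_minor (A u) s.
    pose P (s : {ffun 'I_r -> 'I_n}) : set R :=
      [set u | increasing s -> 0 < c * maximal_minor (A u) s].
    suff HP : forall s, \forall u \near t, P s u.
      exact: (@filter_forall R _ P (nbhs t) _ HP).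
    move=> s; have [si|nsi] := pselect (increasing s); last first.
      by apply: filterS filterT => u _ /nsi.
    have cs : c * maximal_minor (A u) s @[u --> t] --> c * maximal_minor (A t) s.
      by apply: cvgM; [exact: cvg_cst|exact: mcvg_minor].
    by apply: filterS (cvgr_gt _ cs _ (cA s si)) => u ult _.
  apply: filterS H => u H; exists c => s si.
  have := H (finfun s); rewrite /maximal_minor.
  have -> : colsub (finfun s) (A u) = colsub s (A u).
    by apply/matrixP => i j; rewrite !mxE ffunE.
  by apply => i j; rewrite !ffunE; exact: si.
have [s [si sneg]] : exists s, increasing s /\
    maximal_minor (A t) (widen_ord rn) * maximal_minor (A t) s < 0.
  apply: contrapT => H; apply/nA/relative_gpos => // s si.
  by rewrite leNgt; apply/negP => sneg; apply: H; exists s.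
have cs : maximal_minor (A u) (widen_ord rn) * maximal_minor (A u) s @[u --> t] -->
    maximal_minor (A t) (widen_ord rn) * maximal_minor (A t) s.
  by apply: cvgM; exact: mcvg_minor.
apply: filterS (cvgr_lt _ cs _ sneg) => u ult uA.
have := is_gpos_prod uA increasing_widen si.
by rewrite ltNge ltW.
Qed.

End RelativePositivity.

Section DualPositivity.
Variables (R : realType) (k l m n : nat).
Hypotheses (n_gt0 : (0 < n)%N) (m_even : ~~ odd m) (klm : (k + l + m)%N = n).
Variable b : bool.
Implicit Types (V : 'M[R]_(k, n)) (X : 'M[R]_(l, n)).

Let kn : (k <= n)%N. Proof. by rewrite -klm -addnA leq_addr. Qed.
Let ln : (l <= n)%N. Proof. by rewrite -klm addnAC leq_addl. Qed.

Definition dual_top V X : 'M[R]_(k, n) := altx (usubmx (dualtw b (col_mx V (altx X)))).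
Definition dual_bottom V X : 'M[R]_(l, n) := dsubmx (dualtw b (col_mx V (altx X))).

Lemma gpos_windows_free V X : is_gpos V -> is_gpos X -> windows_free (col_mx V (altx X)).
Proof.
move=> [c cV] [d dX] a.
have c0 : c != 0.
  have := cV _ (increasing_widen kn).
  by apply: contraTneq => ->; rewrite mul0r ltxx.
apply: (windows_unit n_gt0 m_even klm (gpos_gnn cV) c0 dX).
by apply: (gpos_window_free n_gt0 a (leq_addr l k) kn cV).
Qed.

Let Good V X := [/\ windows_free (col_mx V (altx X)),
  is_gpos (dual_top V X) & is_gpos (dual_bottom V X)].

Lemma good_mul V X (g : 'M[R]_k) (h : 'M[R]_l) : g \in unitmx -> h \in unitmx ->
  Good V X -> Good (g *m V) (h *m X).
Proof.
move=> gu hu [Mw top bot].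
pose G := block_mx g 0 0 h.
have Gu : G \in unitmx by rewrite unitmxE det_ublock unitrM -!unitmxE gu hu.
have GM : col_mx (g *m V) (altx (h *m X)) = G *m col_mx V (altx X).
  by rewrite altx_mul /G mul_block_col !mul0mx addr0 add0r.
have GT : G^T *m dualtw b (col_mx (g *m V) (altx (h *m X))) = dualtw b (col_mx V (altx X)).
  by rewrite GM dualtw_mul.
move: GT; rewrite /G tr_block_mx !trmx0 -[X in _ *m X]vsubmxK mul_block_col.
rewrite !mul0mx addr0 add0r => GT.
split; first by rewrite GM; apply: windows_freeM.
- move: top; rewrite /dual_top -GT col_mxKu altx_mul => /(is_gpos_mul (g := invmx g^T)).
  by rewrite unitmx_inv unitmx_tr gu mulKmx ?unitmx_tr // => /(_ isT).
- move: bot; rewrite /dual_bottom -GT col_mxKd => /(is_gpos_mul (g := invmx h^T)).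
  by rewrite unitmx_inv unitmx_tr hu mulKmx ?unitmx_tr // => /(_ isT).
Qed.

(* The maximal minors of both halves of the dual on cyclic windows never
   vanish, and by [gnn_consecutive] a limit of positive matrices with this
   property is positive: positivity is both open and closed along the path. *)
Lemma good_path_const (V : R -> 'M[R]_(k, n)) (X : R -> 'M[R]_(l, n)) :
  (forall t : R, mcvg (nbhs t) V (V t)) -> (forall t : R, mcvg (nbhs t) X (X t)) ->
  (forall t : R, 0 <= t <= 1 -> is_gpos (V t)) ->
  (forall t : R, 0 <= t <= 1 -> is_gpos (X t)) ->
  Good (V 0) (X 0) <-> Good (V 1) (X 1).
Proof.
move=> Vc Xc Vp Xp.
pose A (t : R) := dual_top (V t) (X t); pose B t := dual_bottom (V t) (X t).
have Mw (t : R) : 0 <= t <= 1 -> windows_free (col_mx (V t) (altx (X t))).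
  by move=> t01; apply: gpos_windows_free; [exact: Vp|exact: Xp].
have Tc (t : R) : 0 <= t <= 1 -> mcvg (nbhs t) (fun u => dualtw b (col_mx (V u) (altx (X u))))
    (dualtw b (col_mx (V t) (altx (X t)))).
  by move=> t01; apply: mcvg_dualtw; [exact: Mw|apply: mcvg_col_mx => //; exact: mcvg_altx].
have Ac (t : R) : 0 <= t <= 1 -> mcvg (nbhs t) A (A t).
  move=> t01; apply: mcvg_altx; rewrite usubmxEsub.
  by apply: mcvg_sub; exact: Tc.
have Bc (t : R) : 0 <= t <= 1 -> mcvg (nbhs t) B (B t).
  move=> t01; rewrite /B /dual_bottom dsubmxEsub.
  by apply: mcvg_sub; exact: Tc.
have Acl (t : R) : 0 <= t <= 1 -> (is_gpos (A t) -> \forall u \near t, is_gpos (A u)) /\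
  (~ is_gpos (A t) -> \forall u \near t, ~ is_gpos (A u)).
  move=> t01; apply: (is_gpos_clopen n_gt0 kn (Ac t t01)) => a.
  have [d dX] := Xp t t01.
  exact: (dual_top_windows n_gt0 m_even klm _ (Mw t t01) _ dX).
have Bcl (t : R) : 0 <= t <= 1 -> (is_gpos (B t) -> \forall u \near t, is_gpos (B u)) /\
  (~ is_gpos (B t) -> \forall u \near t, ~ is_gpos (B u)).
  move=> t01; apply: (is_gpos_clopen n_gt0 ln (Bc t t01)) => a.
  have [c cV] := Vp t t01.
  exact: (dual_bottom_windows n_gt0 m_even klm _ (Mw t t01) _ cV).
pose P (t : R) := is_gpos (A t) /\ is_gpos (B t).
have oP (t : R) : 0 <= t <= 1 -> P t -> \forall u \near t, 0 <= u <= 1 -> P u.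
  move=> t01 [At Bt].
  by apply: filterS2 ((Acl t t01).1 At) ((Bcl t t01).1 Bt) => u uA uB _; split.
have oN (t : R) : 0 <= t <= 1 -> ~ P t -> \forall u \near t, 0 <= u <= 1 -> ~ P u.
  move=> t01 /not_andP[nA|nB].
    by apply: filterS ((Acl t t01).2 nA) => u uA _ -[Au _]; exact: (uA Au).
  by apply: filterS ((Bcl t t01).2 nB) => u uB _ -[_ Bu]; exact: (uB Bu).
have i0 : 0 <= (0 : R) <= 1 by rewrite lexx ler01.
have i1 : 0 <= (1 : R) <= 1 by rewrite lexx ler01.
split=> [[_ A0 B0]|[_ A1 B1]].
  have [A1 B1] := segment_constant oP oN (conj A0 B0).
  by split; [exact: Mw|exact: A1|exact: B1].
have [[A0 B0]|nP0] := pselect (P 0).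
  by split; [exact: Mw|exact: A0|exact: B0].
exfalso.
have : ~ P 1.
  apply: (@segment_constant R (fun t => ~ P t)) => [|t t01 /contrapT Pt|].
  - exact: oN.
  - by apply: filterS (oP t t01 Pt) => u Pu u01; apply; exact: Pu.
  - exact: nP0.
by apply; split; [exact: A1|exact: B1].
Qed.

(** The stacked columns are shifted by [G], whose minus sign comes from [altx]; the dual columns
    move by its inverse transpose, up to sign. The invariant forms turn the inverse transposes of
    [A] and [B] back into [A] and [B], so [veronese_intertwined] recognises both halves as Veronese
    matrices again, up to a basis change and [altx]. *)
Lemma good_veronese : Good (veronese_mx R n k) (veronese_mx R n l).
Proof.
set V := veronese_mx R n k; set X := veronese_mx R n l.
have Mw : windows_free (col_mx V (altx X)).
  by apply: gpos_windows_free; exists 1; exact: veronese_gpos.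
have [A [VA AHA]] := veronese_shift R n_gt0 kn.
have [B [XB BHB]] := veronese_shift R n_gt0 ln.
set M := col_mx V (altx X) in Mw *.
have UE j : ext_col (twist_sign R k) M j =
    col_mx (veronese R n k j) ((-1) ^ (j - 1) *: veronese R n l j).
  by rewrite ext_col_col_mx (ext_col_altx n_gt0 m_even klm) !ext_col_veronese.
pose G := block_mx A 0 0 (- B).
have GU j : ext_col (twist_sign R k) M (j + 1) = G *m ext_col (twist_sign R k) M j.
  rewrite !UE /G mul_block_col !mul0mx addr0 add0r VA XB; congr col_mx.
  rewrite mulNmx -scalemxAr -scaleNr; congr (_ *: _).
  have -> : j + 1 - 1 = j - 1 + 1 by lia.
  by rewrite signzS.
have tG j : - (G^T *m dualcol b M (j + 1)) = dualcol b M j.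
  apply: dualcol_uniq; first exact: Mw.
  move=> i ij; rewrite -scaleN1r cdotZl.
  have ij' : j + 1 - l%:Z + b%:Z <= i + 1 <= j + 1 + k%:Z - 1 + b%:Z by lia.
  have := dualcolP (Mw _ : Uwin b M (j + 1) \in _) ij'.
  rewrite GU; move: (dualcol b M (j + 1)) => u.
  rewrite /cdot trmx_mul trmxK -mulmxA => ->.
  have -> : (i + 1 == (if b then j + 1 + k%:Z else j + 1 - l%:Z)) =
            (i == if b then j + k%:Z else j - l%:Z) by case: b {ij ij'} => /=; lia.
  by rewrite mulN1r signzS mulNr opprK.
pose H := binomial_form R k; pose H' := binomial_form R l.
have Hu : H \in unitmx by exact: binomial_form_unit.
have H'u : H' \in unitmx by exact: binomial_form_unit.
have AH : A^T *m H \in unitmx.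
  have : A^T *m H *m A \in unitmx by rewrite AHA.
  by rewrite unitmx_mul => /andP[].
have BH : B^T *m H' \in unitmx.
  have : B^T *m H' *m B \in unitmx by rewrite BHB.
  by rewrite unitmx_mul => /andP[].
have tGu j : A^T *m usubmx (dualcol b M (j + 1)) = - usubmx (dualcol b M j) /\
             B^T *m dsubmx (dualcol b M (j + 1)) = dsubmx (dualcol b M j).
  move: (dualcol b M (j + 1)) (dualcol b M j) (tG j) => u v <-.
  rewrite /G tr_block_mx !trmx0 -{2 4}(vsubmxK u) mul_block_col !mul0mx addr0 add0r.
  rewrite opp_col_mx col_mxKu col_mxKd opprK; split=> //.
  by rewrite linearN /= mulNmx opprK.
(* The factor (-1)^j removes the minus sign of [tG], and later matches the [altx] of the top half.
   In the lower half the minus sign in [G] has already cancelled it. *)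
pose y j := (-1) ^ j *: (invmx H *m usubmx (dualcol b M j)).
have yA j : y (j + 1) = A *m y j.
  apply: (can_inj (mulKmx AH)); rewrite mulmxA AHA /y -!scalemxAr mulmxA mulmxK //.
  rewrite (tGu j).1 mulKVmx // signzS.
  by rewrite scaleNr scalerN opprK.
pose z j := invmx H' *m dsubmx (dualcol b M j).
have zB j : z (j + 1) = B *m z j.
  apply: (can_inj (mulKmx BH)); rewrite [RHS]mulmxA BHB /z mulmxA mulmxK //.
  by rewrite (tGu j).2 mulKVmx.
have [C yC] := veronese_intertwined n_gt0 kn VA yA.
have [D zD] := veronese_intertwined n_gt0 ln XB zB.
have topE : dual_top V X = (- (H *m C)) *m V.
  apply/matrixP => i c; rewrite /dual_top mxE.
  have -> : usubmx (dualtw b M) i c = usubmx (dualcol b M (c : nat).+1%:Z) i 0.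
    by rewrite !mxE.
  have -> : usubmx (dualcol b M (c : nat).+1%:Z) =
      (-1) ^+ c.+1 *: (H *m C *m veronese R n k (c : nat).+1%:Z).
    rewrite -mulmxA -yC /y -scalemxAr mulKVmx // scalerA -exprnP -expr2 sqrr_sign.
    by rewrite scale1r.
  have vE : veronese R n k (c : nat).+1%:Z = col c V.
    by rewrite -ext_col_veronese // ext_col_ord ?twist_sign_neq0.
  rewrite vE mxE mulrA -exprD addnS exprS -signr_odd addnn odd_double expr0.
  rewrite mulr1 mulN1r mulNmx [RHS]mxE; congr (- _).
  by rewrite !mxE; apply: eq_bigr => x _; rewrite [col c V _ _]mxE.
have botE : dual_bottom V X = (H' *m D) *m X.
  apply/matrixP => i c; rewrite /dual_bottom.
  have -> : dsubmx (dualtw b M) i c = dsubmx (dualcol b M (c : nat).+1%:Z) i 0.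
    by rewrite !mxE.
  have -> : dsubmx (dualcol b M (c : nat).+1%:Z) =
      H' *m D *m veronese R n l (c : nat).+1%:Z.
    by rewrite -mulmxA -zD /z mulKVmx.
  have vE : veronese R n l (c : nat).+1%:Z = col c X.
    by rewrite -ext_col_veronese // ext_col_ord ?twist_sign_neq0.
  by rewrite vE !mxE; apply: eq_bigr => x _; rewrite [col c X _ _]mxE.
have unit_of r (E : 'M[R]_r) (Y : 'M[R]_(r, n)) e :
    wmx e (E *m Y) 1 r \in unitmx -> E \in unitmx.
  by rewrite /wmx mcols_mul unitmx_mul => /andP[].
split=> //.
- rewrite topE; apply: is_gpos_mul; last by exists 1; exact: veronese_gpos.
  apply: (unit_of _ _ V (twist_sign R k)); rewrite -topE.
  exact: (dual_top_windows n_gt0 m_even klm _ Mw _ (veronese_gpos R n_gt0 (r := l))).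
- rewrite botE; apply: is_gpos_mul; last by exists 1; exact: veronese_gpos.
  apply: (unit_of _ _ X (twist_sign R l)); rewrite -botE.
  exact: (dual_bottom_windows n_gt0 m_even klm _ Mw _ (veronese_gpos R n_gt0 (r := k))).
Qed.

(** One argument moves at a time: [X] with the other one fixed at the Veronese matrix, then [V]. *)
Lemma good_gpos V X : is_gpos V -> is_gpos X -> Good V X.
Proof.
move=> Vp Xp.
have Vp0 : is_gpos (veronese_mx R n k) by exists 1; exact: veronese_gpos.
have Xp0 : is_gpos (veronese_mx R n l) by exists 1; exact: veronese_gpos.
have cst p (Y : 'M[R]_(p, n)) (t : R) : mcvg (nbhs t) (fun=> Y) Y by exact: mcvg_cst.
have H : Good (veronese_mx R n k) X.
  apply: (gpos_connected n_gt0 ln _ _ Xp0 Xp good_veronese) => [g Y gu GY|gam gc gp].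
    by rewrite -[veronese_mx R n k]mul1mx; apply: good_mul => //; rewrite unitmx1.
  by apply: (@good_path_const (fun=> veronese_mx R n k)).
apply: (gpos_connected n_gt0 kn (Q := fun V => Good V X) _ _ Vp0 Vp H) => [g Y gu GY|gam gc gp].
  by rewrite -[X]mul1mx; apply: good_mul => //; rewrite unitmx1.
by apply: (@good_path_const _ (fun=> X)).
Qed.

End DualPositivity.

Section DualNonneg.
Variables (R : realType) (k l m n : nat).
Hypotheses (n_gt0 : (0 < n)%N) (m_even : ~~ odd m) (klm : (k + l + m)%N = n).
Variable b : bool.

(* V is the limit of the positive matrices obtained by sweeping it. *)
Lemma is_gnn_dual (c : R) (V : 'M[R]_(k, n)) (X : 'M[R]_(l, n)) :
  gnn c V -> c != 0 -> is_gpos X ->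
  (forall a, row_free (wmx (twist_sign R k) V a (k + l))) ->
  [/\ windows_free (col_mx V (altx X)), is_gpos (dual_top b V X) &
      exists2 c', c' != 0 & gnn c' (dual_bottom b V X)].
Proof.
move=> cV c0 Xp Vw; have [d dX] := Xp.
have kn : (k <= n)%N by rewrite -klm -addnA leq_addr.
have ln : (l <= n)%N by rewrite -klm addnAC leq_addl.
have Mw : windows_free (col_mx V (altx X)).
  by move=> a; exact: (windows_unit n_gt0 m_even klm cV c0 dX (Vw a)).
have [f' f'0] := row_free_minor (wmx_row_free (Vw 0)).
have [x' [e' [x'i e'2 x'E]]] := colsub_sort R (colsub_inj f'0).
have cx : c * maximal_minor V x' != 0.
  by move: f'0; rewrite x'E mulf_eq0 negb_or => /andP[_ x0]; rewrite mulf_neq0.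
pose Vs s := iter (n + n) (sweep s) V.
have Vs0 : Vs 0 = V by rewrite /Vs; elim: (n + n)%N => //= K ->; rewrite sweep0.
(* The limit is taken from the right, where the sweep parameter is positive and the swept matrices
   are totally positive. *)
pose F := (0 : R)^'+.
have FF : ProperFilter F by exact: at_right_proper_filter.
have Vsc : mcvg F Vs V.
  rewrite -[V in mcvg _ _ V]Vs0; apply: mcvg_iter_sweep; last exact: mcvg_cst.
  exact: cvg_at_right_filter cvg_id.
have Tc : mcvg F (fun s => dualtw b (col_mx (Vs s) (altx X))) (dualtw b (col_mx V (altx X))).
  by apply: mcvg_dualtw => //; apply: mcvg_col_mx => //; exact: mcvg_cst.
have Ac : mcvg F (fun s => dual_top b (Vs s) X) (dual_top b V X).
  by apply: mcvg_altx; rewrite usubmxEsub; apply: mcvg_sub.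
have Bc : mcvg F (fun s => dual_bottom b (Vs s) X) (dual_bottom b V X).
  by rewrite /dual_bottom dsubmxEsub; apply: mcvg_sub.
have good s : 0 < s -> is_gpos (dual_top b (Vs s) X) /\ is_gpos (dual_bottom b (Vs s) X).
  move=> s0; have Vp : is_gpos (Vs s).
    by exists c; exact: (gpos_iter_sweep n_gt0 s0 cV x'i cx).
  by have [_ top bot] := good_gpos n_gt0 m_even klm b Vp Xp; split.
have lim r (A : R -> 'M[R]_(r, n)) A0 u v : mcvg F A A0 ->
    (forall s, 0 < s -> is_gpos (A s)) -> increasing u -> increasing v ->
    0 <= maximal_minor A0 u * maximal_minor A0 v.
  move=> AA Ap ui vi; rewrite leNgt; apply/negP => neg.
  have cs : maximal_minor (A s) u * maximal_minor (A s) v @[s --> F] -->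
      maximal_minor A0 u * maximal_minor A0 v.
    by apply: cvgM; exact: mcvg_minor.
  have [s []] := filter_ex (filterI (cvgr_lt _ cs _ neg) (nbhs_right_gt 0)).
  move=> slt s0; have := is_gpos_prod (Ap s s0) ui vi.
  by rewrite ltNge ltW.
split=> //.
- apply: (@relative_gpos R n k n_gt0 kn (dual_top b V X)) => [a|s si].
    exact: (dual_top_windows n_gt0 m_even klm _ Mw _ dX).
  by apply: (lim _ _ _ _ _ Ac) => // t t0; have [] := good t t0.
(* Windows of the lower half may be singular, so only weak inequalities survive. The scalar is any
   nonzero maximal minor; there is one because q = k + l in [rank_dual] yields full rank. *)
- have [] := rank_dual n_gt0 m_even klm b Mw 1 (leqnn (k + l)).
  rewrite subnn [wmx _ (usubmx _) _ 0]thinmx0 mxrank0 addn0 addnC => /addnI rk _.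
  have botfree : row_free (dual_bottom b V X).
    apply: (@wmx_row_free _ _ _ (k + l) (twist_sign R l) _ 1).
    by rewrite /row_free /dual_bottom rk.
  have [h h0] := row_free_minor botfree.
  have [y [e'' [yi _ yE]]] := colsub_sort R (colsub_inj h0).
  exists (maximal_minor (dual_bottom b V X) y).
    by move: h0; rewrite yE mulf_eq0 negb_or => /andP[].
  move=> s si; apply: (lim _ _ _ _ _ Bc) => // t t0.
  by have [] := good t t0.
Qed.

End DualNonneg.

(** * Bounded affine permutations and ranks *)

(** Sums over one explicit interval make cardinalities of sets of integers additive; the interval
    only has to be large enough for all sets involved. *)
Definition int_count (lo : int) (N : nat) (P : int -> bool) : nat :=
  (\sum_(i < N) P (lo + (i : nat)%:Z)%R)%N.

Lemma card_int_count (lo : int) (N : nat) (P : int -> bool) :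
  (forall i, P i -> lo <= i < lo + N%:Z) ->
  ([set i | P i] #= `I_(int_count lo N P))%card.
Proof.
move=> PN; pose A := [pred i : 'I_N | P (lo + (i : nat)%:Z)].
have -> : int_count lo N P = #|A|.
  rewrite /int_count -sum1_card [RHS]big_mkcond; apply: eq_bigr => i _.
  by case: ifP => iA; have := iA; rewrite inE => ->.
pose f (x : 'I_#|A|) : int := lo + (enum_val x : nat)%:Z.
have -> : [set i | P i] = f @` [set: 'I_#|A|].
  apply/seteqP; split=> [i /= Pi|_ [x _ <-]]; last first.
    by have := enum_valP x; rewrite inE.
  have /andP[i1 i2] := PN i Pi.
  have lt : (`|i - lo|%N < N)%N by move: i1 i2; lia.
  have E : lo + `|i - lo|%N%:Z = i by move: i1 i2; lia.
  have Ax : Ordinal lt \in A by rewrite inE /= E.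
  exists (enum_rank_in Ax (Ordinal lt)) => //.
  by rewrite /f enum_rankK_in.
apply: card_eq_trans (inj_card_eq _) _.
  by move=> x y _ _ /addrI [] /ord_inj/enum_val_inj.
by rewrite card_eq_sym; exact: card_II.
Qed.

Lemma int_count_interval (lo x y : int) (N : nat) :
  lo <= x -> x <= y -> y <= lo + N%:Z ->
  (int_count lo N (fun i => (x <= i < y)%R) = `|y - x|)%N.
Proof.
move=> lox; elim: N y => [|N IH] y xy yN; rewrite /int_count ?big_ord0 ?big_ord_recr /=.
  by lia.
have [yle|ygt] := leP y (lo + N%:Z).
  have := IH y xy yle; rewrite /int_count => ->.
  rewrite (_ : (_ && _) = false) ?addn0 //; lia.

have [xN|xN] := leP x (lo + N%:Z); last first.
  rewrite big1 => [|i _]; last by have := ltn_ord i; case: (_ && _) /andP => //; lia.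
  by rewrite (_ : (_ && _) = false); lia.
have := IH (lo + N%:Z) xN (lexx _); rewrite /int_count.
move=> IH'; rewrite (_ : (_ && _) = true); last by lia.
transitivity (`|(lo + N%:Z - x)%R| + 1)%N; last by lia.
congr addn; rewrite -IH'; apply: eq_bigr => i _.
by congr nat_of_bool; have := ltn_ord i; lia.
Qed.

Lemma int_countD (lo : int) (N : nat) (P Q S : int -> bool) :
  (forall i, (P i : nat) + Q i = S i)%N ->
  (int_count lo N P + int_count lo N Q = int_count lo N S)%N.
Proof. by move=> PQ; rewrite /int_count -big_split; apply: eq_bigr => i _; exact: PQ. Qed.

(** Only the vanishing sum needs an argument: displacements of [g] are periodic, and read at f 1,
    ..., f n, which form a full set of residues, they are minus those of [f]. *)
Lemma affine_perm_inv (n k l : nat) (f g : int -> int) : (0 < n)%N ->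
  cancel f g -> cancel g f -> affine_perm n k l f -> affine_perm n l k g.
Proof.
move=> n_gt0 fg gf [_ fper fsum fb].
have gper i : g (i + n%:Z) = g i + n%:Z by rewrite -{1}(gf i) -fper fg.
have gb i : i - l%:Z <= g i <= i + k%:Z by have := fb (g i); rewrite gf; lia.
split=> //; first by exists f.
have gperq (i q : int) : g (i + q * n%:Z) = g i + q * n%:Z.
  elim/int_ind: q => [|q IH|q IH]; first by rewrite mul0r !addr0.
    by rewrite intS mulrDl mul1r [n%:Z + _]addrC !addrA gper IH.
  apply: (addIr n%:Z); rewrite -gper intS opprD !mulrDl mulN1r.
  by rewrite [- n%:Z + _]addrC !addrA !subrK IH.
pose h i := g i - i.
have hper (i q : int) : h (i + q * n%:Z) = h i by rewrite /h gperq; lia.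
have /choice[qq /choice[rho rhoE]] := fun c : 'I_n => int_modE (f (c : nat).+1%:Z) n_gt0.
have rinj : injective rho.
  move=> c c' rcc; have E : f (c : nat).+1%:Z = f (c' : nat).+1%:Z + (qq c - qq c') * n%:Z.
    by rewrite (rhoE c) (rhoE c') rcc mulrBl; lia.
  have : (c : nat).+1%:Z = (c' : nat).+1%:Z + (qq c - qq c') * n%:Z.
    by rewrite -[LHS]fg E gperq fg.
  move=> H; apply: ord_inj; have := ltn_ord c; have := ltn_ord c'.
  move: (nat_of_ord c) (nat_of_ord c') (qq c - qq c') H => x y d H yn xn.
  have [d0|[d0|d0]] : d = 0 \/ (d <= -1 \/ 1 <= d) by lia.
  - by move: H; rewrite d0 mul0r; lia.
  - by nia.
  - by nia.
rewrite big_add1 /= big_mkord (reindex_inj rinj) /=.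
transitivity (\sum_(c < n) - (f (c : nat).+1%:Z - (c : nat).+1%:Z)).
  apply: eq_bigr => c _; have := hper (rho c : nat).+1%:Z (qq c).
  by rewrite -rhoE /h fg => <-; lia.
rewrite sumrN -[RHS]oppr0 -[in RHS]fsum big_add1 /= big_mkord.
by [].
Qed.

Lemma cyclic_columnsE (R : realType) (n r : nat) (M : 'M[R]_(r, n)) a b :
  cyclic_columns M a b = wmx 1 M a `|b - a|%N.
Proof. by apply/matrixP => i t; rewrite !mxE. Qed.

Lemma rank_wmx_sign (R : realType) (n r N : nat) (e : R) (M : 'M[R]_(r, n)) a :
  e != 0 -> \rank (wmx e M a N) = \rank (wmx 1 M a N).
Proof.
move=> e0.
pose d : 'rV[R]_N := \row_t e ^ ((a + (t : nat)%:Z - 1) %/ n%:Z)%Z.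
have -> : wmx e M a N = wmx 1 M a N *m diag_mx d.
  apply/matrixP => i t; rewrite mul_mx_diag [LHS]mxE [RHS]mxE [X in _ = X * _]mxE.
  by rewrite [X in _ = _ * X]mxE /ext_col exp1rz scale1r mxE mulrC.
apply: mxrankMfree; rewrite row_free_unit unitmxE det_diag unitfE.
by apply/prodf_neq0 => t _; rewrite mxE expfz_neq0.
Qed.

Lemma wmx_row_freeT (R : realType) (n r : nat) (e : R) (M : 'M[R]_(r, n)) a :
  (0 < n)%N -> e != 0 -> row_free M -> row_free (wmx e M a n).
Proof.
move=> n_gt0 e0 Mf; rewrite -kermx_eq0.
set K := kermx _; have K0 : K *m wmx e M a n = 0 by exact: mulmx_ker.
suff KM : K *m M = 0.
  by have /eqP := KM; rewrite mulmx_free_eq0 ?Mf // => /eqP ->.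
have colK j : K *m ext_col e M j = 0.
  have [q [c jE]] := int_modE (j - a + 1) n_gt0.
  have -> : j = (a + (c : nat)%:Z) + q * n%:Z by lia.
  rewrite ext_colMn // -scalemxAr -[ext_col _ _ _]/(ext_col e M (a + (c : nat)%:Z)).
  have -> : ext_col e M (a + (c : nat)%:Z) = col c (wmx e M a n).
    by apply/colP => i; rewrite !mxE.
  by rewrite colE mulmxA K0 mul0mx scaler0.
apply/matrixP => i c; have /colP/(_ i) := colK (c : nat).+1%:Z.
by rewrite ext_col_ord // colE mulmxA -colE [LHS]mxE => ->; rewrite !mxE.
Qed.

(** * Duality of positroid cells *)

Section CellDuality.
Variables (R : realType) (k l m n : nat).
Hypotheses (n_gt0 : (0 < n)%N) (m_even : ~~ odd m) (klm : (k + l + m)%N = n).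

Section Cell.
Variables (f : int -> int) (M : 'M[R]_(k, n)).
Hypotheses (fS : affine_perm n k l f) (Mf : row_free M)
  (MC : positroid_cell R n k f (rowspan M)).

Let fb i : i - k%:Z <= f i <= i + l%:Z. Proof. by case: fS. Qed.

Lemma cell_count (e : R) (lo a b : int) (N : nat) : e != 0 -> a <= b ->
  lo <= a - k%:Z - l%:Z -> a <= lo + N%:Z ->
  int_count lo N (fun i => (i < a) && (a <= f i + k%:Z < b)) =
  \rank (wmx e M a `|b - a|%N).
Proof.
move=> e0; rewrite le_eqVlt => /predU1P[<-|ab] loa aN.
  rewrite /int_count big1 => [|i _]; last by case: (_ && _) / and3P => // -[]; lia.
  by apply/esym/eqP; rewrite subrr -leqn0; exact: rank_leq_col.
have [_ /(_ M _ a b ab) H] := MC.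
have {}H := H (conj Mf erefl); rewrite rank_wmx_sign // -cyclic_columnsE.
apply/card_eq_II; apply: card_eq_trans H; rewrite card_eq_sym.
by apply: card_int_count => i; have := fb i; lia.
Qed.

Lemma cell_count_all (lo a : int) (N : nat) :
  lo <= a - k%:Z - l%:Z -> a <= lo + N%:Z ->
  int_count lo N (fun i => (i < a) && (a <= f i + k%:Z)) = k.
Proof.
move=> loa aN.
have /eqP Ma := wmx_row_freeT a n_gt0 (twist_sign_neq0 R k) Mf.
have nE : `|(a + n%:Z - a)%R|%N = n by lia.
have aan : a <= a + n%:Z by lia.
have := cell_count (twist_sign_neq0 R k) aan loa aN; rewrite nE Ma; apply: etrans.
by apply: eq_bigr => i _; congr nat_of_bool; have := fb (lo + (i : nat)%:Z); lia.
Qed.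

(** For i < a the bound f i <= i + l gives f i + k < a + k + l, so the window already counts as much
    as a full period. This supplies the rank hypothesis of [windows_unit]. *)
Lemma cell_window_free (a : int) : row_free (wmx (twist_sign R k) M a (k + l)).
Proof.
have nE : `|(a + (k + l)%N%:Z - a)%R|%N = (k + l)%N by lia.
have aan : a <= a + (k + l)%N%:Z by lia.
pose lo := a - k%:Z - l%:Z.
have aN : a <= lo + (k + l)%N%:Z by rewrite /lo; lia.
have := cell_count (twist_sign_neq0 R k) aan (lexx lo) aN; rewrite nE => rE.
apply/eqP; rewrite -rE; apply: etrans (cell_count_all (lexx lo) aN).
by apply: eq_bigr => i _; congr nat_of_bool; have := fb (lo + (i : nat)%:Z); lia.
Qed.

(* With y = a + q - l, the set to be counted corresponds under f to
   S1 = {p | a - l <= p < y, f p < a}; its complement S2 in [a - l, y) is also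
   the complement of S3, whose size is a rank of M, in a set S4 of size k. *)
Lemma dual_cell_count b (X : 'M[R]_(l, n)) (g : int -> int) (a : int) (q : nat) :
  windows_free (col_mx M X) -> cancel f g -> cancel g f -> (q <= k + l)%N ->
  ([set i : int | ((i < a) && (a <= g i + l%:Z < a + q%:Z))%R]
     #= `I_(\rank (wmx (twist_sign R l) (dsubmx (dualtw b (col_mx M X))) a q)))%card.
Proof.
move=> Uw fg gf qkl; set T := dsubmx _.
have [D _] := rank_dual n_gt0 m_even klm b Uw a qkl.
rewrite col_mxKu -/T in D.
pose y := a + q%:Z - l%:Z.
pose lo := a - k%:Z - l%:Z - k%:Z - l%:Z; pose N := (k + l + k + l + k + l)%N.
pose S1 i : bool := (a - l%:Z <= i < y) && (f i < a).
pose S2 i : bool := (a - l%:Z <= i < y) && (a <= f i).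
pose S3 i : bool := (i < y) && (y <= f i + k%:Z < a + k%:Z).
pose S4 i : bool := (i < y) && (y <= f i + k%:Z).
have E12 : (int_count lo N S1 + int_count lo N S2 = q)%N.
  rewrite (@int_countD _ _ _ _ (fun i => a - l%:Z <= i < y)); last first.
    by move=> i; rewrite /S1 /S2 (leNgt a (f i)); case: (f i < a); rewrite ?andbT ?andbF ?addn0.
  by rewrite int_count_interval /y /lo /N; lia.
have E32 : (int_count lo N S3 + int_count lo N S2 = k)%N.
  rewrite (@int_countD _ _ _ _ S4); first by apply: cell_count_all; rewrite /y /lo /N; lia.
  by move=> i; rewrite /S2 /S3 /S4 /y; have := fb i; lia.
have E3 : int_count lo N S3 = \rank (wmx (twist_sign R k) M y (k + l - q)).
  have yE : `|(a + k%:Z - y)%R|%N = (k + l - q)%N by rewrite /y; lia.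
  by rewrite -yE; apply: cell_count; rewrite ?twist_sign_neq0 // /y /lo /N; lia.
have -> : \rank (wmx (twist_sign R l) T a q) = int_count lo N S1.
  by move: D; rewrite -/y -E3 => D; apply: (@addIn k); lia.
have -> : [set i : int | ((i < a) && (a <= g i + l%:Z < a + q%:Z))%R] =
          f @` [set i | S1 i].
  apply/seteqP; split=> [i /= Hi|_ [i /= Hi <-]]; last first.
    by rewrite fg; move: Hi; rewrite /S1 /y; lia.
  by exists (g i); rewrite ?gf // /S1 gf /y; lia.
apply: card_eq_trans (inj_card_eq _) _; first by move=> i j _ _; exact: (can_inj fg).
by apply: card_int_count => i; rewrite /S1 /lo /N /y; lia.
Qed.

Lemma dual_cell b (X : 'M[R]_(l, n)) (g : int -> int) (a a' : int) :
  windows_free (col_mx M X) -> cancel f g -> cancel g f -> a < a' ->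
  ([set i : int | ((i < a) && (a <= g i + l%:Z < a'))%R]
     #= `I_(\rank (cyclic_columns (dsubmx (dualtw b (col_mx M X))) a a')))%card.
Proof.
move=> Uw fg gf aa'; rewrite cyclic_columnsE -(rank_wmx_sign _ _ _ (twist_sign_neq0 R l)).
have [le|lt] := leqP `|a' - a|%N (k + l).
  by have := dual_cell_count b a Uw fg gf le; congr (_ #= _)%card; apply/seteqP; split=> i /=; lia.
(* From k + l columns on the rank stays at l, and g i <= i + k makes the upper bound in the counted
   set automatic. *)
have Tf : row_free (wmx (twist_sign R l) (dsubmx (dualtw b (col_mx M X))) a (k + l)).
  have [D _] := rank_dual n_gt0 m_even klm b Uw a (leqnn (k + l)).
  move: D; rewrite /row_free; set r := \rank _; set r' := \rank _ => D.
  have r'0 : r' = 0%N by apply/eqP; rewrite -leqn0 -(subnn (k + l)%N); exact: rank_leq_col.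
  by apply/eqP; move: D; rewrite r'0; lia.
have := dual_cell_count b a Uw fg gf (leqnn _).
have /eqP -> := Tf; have /eqP -> := wmx_widen_free (ltnW lt) Tf.
congr (_ #= _)%card; apply/seteqP; split=> i /=; have := fb (g i); rewrite gf; lia.
Qed.

End Cell.
End CellDuality.

(** * Row spans and positive representatives *)

Section RowSpan.
Variables (R : realType) (n : nat).

Lemma mem_rowspan (r : nat) (M : 'M[R]_(r, n)) (u : 'rV[R]_n) :
  (u \in (rowspan M : {vspace _})) = (u <= M)%MS.
Proof.
apply/idP/idP => [uM|/submxP[D ->]].
  rewrite (coord_span (X := in_tuple _) uM) summx_sub // => i _.
  apply: scalemx_sub; rewrite /= (nth_map (enum_val (cast_ord (size_image _ _) i))) ?row_sub //.
  by rewrite -cardE -(size_image (fun i => row i M)).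
rewrite mulmx_sum_row; apply: rpred_sum => i _; apply: rpredZ.
by apply: memv_span; exact: (codom_f (fun i => row i M)).
Qed.

Lemma rowspanS (r s : nat) (M : 'M[R]_(r, n)) (N : 'M[R]_(s, n)) :
  ((rowspan M : {vspace _}) <= (rowspan N : {vspace _}))%VS = (M <= N)%MS.
Proof.
apply/subvP/idP => [MN|MN u]; last by rewrite !mem_rowspan => /submx_trans; apply.
by apply/row_subP => i; rewrite -mem_rowspan MN // mem_rowspan row_sub.
Qed.

Lemma rowspan_unit (r : nat) (g : 'M[R]_r) (M : 'M[R]_(r, n)) : g \in unitmx ->
  rowspan (g *m M) = rowspan M.
Proof.
move=> gu; apply/vspaceP => u; rewrite !mem_rowspan.
by rewrite (eqmxMfull M (_ : row_full g)) // row_full_unit.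
Qed.

Lemma rowspan_eqmx (r s : nat) (M : 'M[R]_(r, n)) (N : 'M[R]_(s, n)) :
  (M :=: N)%MS -> rowspan M = rowspan N.
Proof. by move=> MN; apply/vspaceP => u; rewrite !mem_rowspan MN. Qed.

Lemma row_free_sub_unit (r : nat) (M N : 'M[R]_(r, n)) : row_free M ->
  (M <= N)%MS -> exists2 g, g \in unitmx & M = g *m N.
Proof.
move=> Mf /submxP[g E]; exists g => //; rewrite -row_free_unit -row_leq_rank.
by rewrite -{1}(eqP Mf) E mxrankM_maxl.
Qed.

Lemma rowspan_eq (r : nat) (M N : 'M[R]_(r, n)) : row_free M ->
  rowspan M = rowspan N -> exists2 g, g \in unitmx & M = g *m N.
Proof.
by move=> Mf E; apply: row_free_sub_unit => //; rewrite -rowspanS E subvv.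
Qed.

Lemma rowspan_col_mx (r s : nat) (M : 'M[R]_(r, n)) (N : 'M[R]_(s, n)) :
  rowspan (col_mx M N) = (rowspan M + rowspan N)%VS.
Proof.
apply/vspaceP => u; rewrite mem_rowspan -addsmxE.
apply/sub_addsmxP/memv_addP => [[[A B] /= ->]|[v vM [w wN ->]]].
  by exists (A *m M); [|exists (B *m N)]; rewrite // mem_rowspan submxMl.
move: vM wN; rewrite !mem_rowspan => /submxP[A ->] /submxP[B ->].
by exists (A, B).
Qed.

Lemma dim_rowspan (r : nat) (M : 'M[R]_(r, n)) : row_free M ->
  \dim (rowspan M : {vspace _}) = r.
Proof.
move=> Mf; pose phi := linfun (mulmxr M : 'rV[R]_r -> 'rV[R]_n).
have -> : (rowspan M : {vspace _}) = limg phi.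
  apply/vspaceP => u; rewrite mem_rowspan; apply/submxP/memv_imgP => [[v ->]|[v _ ->]].
    by exists v; rewrite ?memvf // lfunE.
  by exists v; rewrite lfunE.
rewrite limg_dim_eq ?dimvf /dim /= ?mul1n //.
apply/eqP; rewrite capfv -subv0; apply/subvP => v; rewrite memv_ker lfunE /= memv0.
by rewrite mulmx_free_eq0.
Qed.

Lemma rowspan_dim_eq (r s : nat) (M : 'M[R]_(r, n)) (N : 'M[R]_(s, n)) :
  row_free M -> row_free N -> rowspan M = rowspan N -> r = s.
Proof. by move=> Mf Nf E; rewrite -(dim_rowspan Mf) E dim_rowspan. Qed.

End RowSpan.

Section PositiveRepresentatives.
Variables (R : realType) (n : nat).

(** The sign goes into the first row, so a row must exist; without rows the only minor is 1. *)
Lemma minor_sign (r : nat) (c : R) (M : 'M[R]_(r.+1, n)) : row_free M ->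
  c != 0 -> exists N : 'M[R]_(r.+1, n), represents N (rowspan M) /\
    forall s, maximal_minor N s = Num.sg c * maximal_minor M s.
Proof.
move=> Mf c0.
pose d : 'rV[R]_r.+1 := \row_i if i == 0 then Num.sg c else 1.
have detd : \det (diag_mx d) = Num.sg c.
  rewrite det_diag big_ord_recl mxE eqxx big1 ?mulr1 // => i _.
  by rewrite mxE.
have du : diag_mx d \in unitmx by rewrite unitmxE detd unitfE sgr_eq0.
exists (diag_mx d *m M); split; [split; [|exact: rowspan_unit]|].
  by rewrite -row_leq_rank eqmxMfull ?row_leq_rank // row_full_unit.
by move=> s; rewrite /maximal_minor -mulmx_colsub det_mulmx detd.
Qed.

Lemma Gr_nonnegP (r : nat) (M : 'M[R]_(r, n)) : row_free M ->
  Gr_nonneg R n r (rowspan M) <-> exists2 c, c != 0 & gnn c M.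
Proof.
move=> Mf; split=> [[N [Nf NM] Nge]|[c c0 cM]].
  have [g gu ->] := rowspan_eq Mf (esym NM).
  have g0 : \det g != 0 by rewrite -unitfE -unitmxE.
  exists (1 / \det g); first by rewrite mulf_neq0 ?oner_neq0 ?invr_neq0.
  by apply: gnn_mul => // s si; rewrite mul1r Nge.
case: r M Mf cM => [|r] M Mf cM.
  by exists M => // s _; rewrite /maximal_minor det_mx00.
have [N [NM Nm]] := minor_sign Mf c0.
exists N => // s si; rewrite Nm; have := cM s si.
by rewrite {1}[c]numEsg mulrAC pmulr_lge0 // normr_gt0.
Qed.

Lemma Gr_posP (r : nat) (M : 'M[R]_(r, n)) : (r <= n)%N -> row_free M ->
  Gr_pos R n r (rowspan M) <-> is_gpos M.
Proof.
move=> rn Mf; split=> [[N [Nf NM] Nge]|[c cM]].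
  have [g gu ->] := rowspan_eq Mf (esym NM).
  by apply: is_gpos_mul => //; exists 1 => s si; rewrite mul1r Nge.
case: r M Mf cM rn => [|r] M Mf cM rn.
  by exists M => // s _; rewrite /maximal_minor det_mx00.
have c0 : c != 0.
  apply/eqP => c0; have := cM _ (increasing_widen rn).
  by rewrite c0 mul0r ltxx.
have [N [NM Nm]] := minor_sign Mf c0.
exists N => // s si; rewrite Nm; have := cM s si.
by rewrite {1}[c]numEsg mulrAC pmulr_lgt0 // normr_gt0.
Qed.

(** Both directions are [gpos_complement], as [altx] is an involution preserving scalar products. *)
Lemma Gr_perp_posP (r l : nat) (W : subspaces R n) : (r + l)%N = n ->
  Gr_perp_pos R n r W <->
  exists2 X : 'M[R]_(l, n), is_gpos X & W = rowspan (altx X).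
Proof.
move=> rln; have rn : (r <= n)%N by rewrite -rln leq_addr.
have ln : (l <= n)%N by rewrite -rln leq_addl.
have perp (Y : 'M[R]_(r, n)) (X : 'M[R]_(l, n)) : row_free Y -> row_free X ->
    Y *m X^T = 0 -> orthogonal_complement (rowspan Y) (rowspan X).
  move=> Yf Xf YX w; rewrite mem_rowspan.
  have -> : (w <= X)%MS = (w *m Y^T == 0).
    have XK : (X <= kermx Y^T)%MS.
      by rewrite sub_kermx -[X]trmxK -trmx_mul YX trmx0.
    rewrite -sub_kermx; suff /eqmxP -> : (X == kermx Y^T)%MS by [].
    rewrite -(mxrank_leqif_eq XK) mxrank_ker mxrank_tr (eqP Xf) (eqP Yf).
    by rewrite -rln addKn.
  split=> [/eqP wY z|wY].
    by rewrite mem_rowspan => /submxP[D ->]; rewrite trmx_mul mulmxA wY mul0mx mxE.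
  apply/eqP/rowP => j; have := wY (row j Y).
  rewrite mem_rowspan row_sub => /(_ isT) wY0.
  rewrite !mxE; move: wY0; rewrite !mxE => H; rewrite -[RHS]H.
  by apply: eq_bigr => i _; rewrite !mxE.
split.
  move=> [Z [Y [Yf YZ] Yp] ZW].
  have lrn : (l + r)%N = n by rewrite addnC.
  have [Z' [Z'f Z'Y]] := orth_basis Yf lrn.
  have YZ' : Y *m Z'^T = 0 by rewrite -[LHS]trmxK trmx_mul trmxK Z'Y trmx0.
  have Y1 : gpos 1 Y by move=> s si; rewrite mul1r Yp.
  exists (altx Z'); first exact: gpos_complement rln Y1 Z'f YZ'.
  rewrite altxK; apply/vspaceP => w; apply/idP/idP.
    by move/ZW; rewrite -YZ => /(perp Y Z' Yf Z'f YZ').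
  by move/(perp Y Z' Yf Z'f YZ'); rewrite YZ => /ZW.
move=> [X Xp ->]; have [d dX] := Xp; have Xf := gpos_row_free ln dX.
have aXf : row_free (altx X) by rewrite row_free_altx.
have [Y [Yf YX]] := orth_basis aXf rln.
exists (rowspan Y); last exact: perp.
apply/Gr_posP => //; rewrite -[Y]altxK.
have lrn : (l + r)%N = n by rewrite addnC.
apply: (gpos_complement lrn dX); first by rewrite row_free_altx.
by rewrite -[X]altxK altx_mul_tr -[LHS]trmxK trmx_mul trmxK YX trmx0.
Qed.

End PositiveRepresentatives.

(** * Topology of the Grassmannians *)

Section MatrixTopology.
Variables (R : realType) (n : nat).

Lemma mcvg_cvg (T : Type) (F : set_system T) {FF : Filter F} (p q : nat)
    (A : T -> 'M[R]_(p, q)) (A0 : 'M[R]_(p, q)) : mcvg F A A0 -> A @ F --> A0.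
Proof.
move=> AA0 B [P PA PB].
have H : \forall x \near F, forall i j, P i j (A x i j).
  by apply: filter_forall => i; apply: filter_forall => j; exact: AA0 (PA i j).
by apply: filterS H => x Hx; exact: PB.
Qed.

Lemma mcvg_id (p q : nat) (A : 'M[R]_(p, q)) : mcvg (nbhs A) id A.
Proof. by move=> i j; exact: coord_continuous. Qed.

Lemma near_unitmx (T : Type) (F : set_system T) {FF : Filter F} (p : nat)
    (A : T -> 'M[R]_p) (A0 : 'M[R]_p) : A0 \in unitmx -> mcvg F A A0 ->
  \forall x \near F, A x \in unitmx.
Proof.
rewrite unitmxE unitfE => A0u /mcvg_det dA.
have H : \forall x \near F, \det (A x) != 0.
  exact: cvgr_neq0 dA A0u.
by apply: filterS H => x; rewrite unitmxE unitfE.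
Qed.

Lemma near_row_free (r : nat) (M : 'M[R]_(r, n)) : row_free M ->
  \forall N \near M, row_free N.
Proof.
move=> /row_freeP[B MB].
have H : \forall N \near M, N *m B \in unitmx.
  apply: (@near_unitmx _ (nbhs M) _ _ (fun N => N *m B) (M *m B)); first by rewrite MB unitmx1.
  by apply: mcvg_mul; [exact: mcvg_id | exact: mcvg_cst].
apply: filterS H => N NB; rewrite -row_leq_rank; apply: leq_trans (mxrankM_maxl N B).
by rewrite (eqP (_ : row_free _)) ?leqnn // row_free_unit.
Qed.

Lemma rowspan_continuous (r : nat) (M : 'M[R]_(r, n)) : row_free M ->
  {for M, continuous (@rowspan R n r)}.
Proof.
move=> Mf A; rewrite nbhsE => -[Q [oQ QM] QA].
have /open_subspaceP[V oV VQ] := oQ r.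
have /seteqP[VQ1 VQ2] := VQ; have [VM _] := VQ2 M (conj QM Mf).
have H1 : \forall N \near M, V N by apply: open_nbhs_nbhs.
apply: filterS2 H1 (near_row_free Mf) => N VN Nf; apply: QA.
by have [] := VQ1 N (conj VN Nf).
Qed.

(* The chart of the Grassmannian in which a subspace is represented by the
   unique matrix M with M B = 1. *)
Definition normalized (r : nat) (B : 'M[R]_(n, r)) (P : set 'M[R]_(r, n)) :
    set (subspaces R n) :=
  [set V | exists M, [/\ represents M V, M *m B = 1%:M & P M]].

(** This is continuity of the local section. On full rank matrices N the chart over [Q] pulls back
    to the open condition that N B is invertible and (N B)^-1 N lies in [Q]; other numbers of rows
    miss it by dimension. *)
Lemma normalized_nbhs (r : nat) (B : 'M[R]_(n, r)) (M : 'M[R]_(r, n))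
    (P : set 'M[R]_(r, n)) : M *m B = 1%:M -> nbhs M P ->
  nbhs (rowspan M) (normalized B P).
Proof.
move=> MB; rewrite nbhsE => -[Q [oQ QM] QP].
have Mf : row_free M by apply/row_freeP; exists B.
suff oN : open (normalized B Q).
  rewrite nbhsE; exists (normalized B Q); first by split=> //; exists M.
  by move=> V [N [NV NB QN]]; exists N; split=> //; exact: QP.
move=> r'; apply/open_subspaceP.
have [<-|r'r] := eqVneq r r'; last first.
  exists set0; first exact: open0.
  apply/seteqP; split=> N [] //= [N' [[N'f N'N] _ _]] Nf; exfalso.
  by case/eqP: r'r; exact: rowspan_dim_eq N'f Nf N'N.
exists [set N : 'M[R]_(r, n) | N *m B \in unitmx /\ Q (invmx (N *m B) *m N)].
  rewrite openE => N [NBu QN]; rewrite /interior.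
  have NBc : mcvg (nbhs N) (fun N' => N' *m B) (N *m B).
    by apply: mcvg_mul; [exact: mcvg_id | exact: mcvg_cst].
  have H1 : \forall N' \near N, N' *m B \in unitmx by exact: near_unitmx NBu NBc.
  have H2 : \forall N' \near N, Q (invmx (N' *m B) *m N').
    apply: (mcvg_cvg (mcvg_mul (mcvg_inv NBu NBc) (@mcvg_id _ _ N))).
    exact: open_nbhs_nbhs.
  by apply: filterS2 H1 H2 => N' u v; split.
apply/seteqP; split=> N [] /=.
  move=> [NBu QN] Nf; split=> //; exists (invmx (N *m B) *m N); split=> //.
    split; last by rewrite rowspan_unit // unitmx_inv.
    by rewrite -row_leq_rank eqmxMfull ?row_leq_rank // row_full_unit unitmx_inv.
  by rewrite -mulmxA mulVmx.
move=> [N' [[N'f N'N] N'B QN']] Nf; split=> //.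
have [g gu NE] := rowspan_eq Nf (esym N'N).
have gE : N *m B = g by rewrite NE -mulmxA N'B mulmx1.
by rewrite gE NE mulKmx.
Qed.

End MatrixTopology.

(** * The map of flags *)

Lemma mcvg_usub (R : realType) (T : Type) (F : set_system T) {FF : Filter F}
    (p q n : nat) (A : T -> 'M[R]_(p + q, n)) A0 :
  mcvg F A A0 -> mcvg F (fun x => usubmx (A x)) (usubmx A0).
Proof.
by move=> AA0 i j; rewrite mxE; under eq_cvg do rewrite mxE; exact: AA0.
Qed.

Section FlagDual.
Variables (R : realType) (n : nat).

Definition flag_rep (k l : nat) (M : 'M[R]_(k + l, n))
    (p : subspaces R n * subspaces R n) :=
  [/\ row_free M, rowspan (dsubmx M) = p.1 & rowspan M = p.2].

(* For [b = false] this is the map induced by the stacked twist on the flags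
   (W, span(V, W)), for [b = true] its inverse. *)
Definition flag_dual (b : bool) (k l : nat) (p : subspaces R n * subspaces R n) :=
  let T := dualtw b (xget 0 [set M : 'M[R]_(k + l, n) | flag_rep M p]) in
  (rowspan (usubmx T), rowspan T).

Lemma flag_rep_eq k l (M N : 'M[R]_(k + l, n)) p : flag_rep M p -> flag_rep N p ->
  exists g : 'M[R]_(k + l), [/\ g \in unitmx, ulsubmx g \in unitmx, dlsubmx g = 0 &
    N = g *m M].
Proof.
move=> [Mf M1 M2] [Nf N1 N2].
have [g gu NE] := rowspan_eq Nf (etrans N2 (esym M2)).
have /submxP[h hE] : (dsubmx N <= dsubmx M)%MS.
  by rewrite -rowspanS N1 M1 subvv.
have dg : dsubmx g = row_mx 0 h.
  apply: (row_free_inj Mf); rewrite /= mul_dsub_mx -NE hE.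
  by rewrite -{2}[M]vsubmxK mul_row_col mul0mx add0r.
have dl0 : dlsubmx g = 0 by rewrite /dlsubmx dg row_mxKl.
exists g; split=> //; move: gu.
by rewrite -{1}[g]submxK dl0 !unitmxE det_ublock unitrM => /andP[].
Qed.

Lemma flag_dualE b k l (M : 'M[R]_(k + l, n)) p : flag_rep M p -> windows_free M ->
  flag_dual b k l p = (rowspan (usubmx (dualtw b M)), rowspan (dualtw b M)).
Proof.
move=> Mp Mw; rewrite /flag_dual; set N := xget _ _.
have Np : flag_rep N p.
  by apply: (@xgetPex _ 0 [set M : 'M[R]_(k + l, n) | flag_rep M p]); exists M.
have [g [gu gul gdl NE]] := flag_rep_eq Mp Np.
have := dualtw_mul b gu Mw; rewrite -NE => TE.
have gTu : g^T \in unitmx by rewrite unitmx_tr.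
congr pair; last by rewrite -TE rowspan_unit.
suff -> : usubmx (dualtw b M) = (ulsubmx g)^T *m usubmx (dualtw b N).
  by rewrite rowspan_unit // unitmx_tr.
rewrite -TE -{1}[g]submxK gdl tr_block_mx trmx0 -{1}[dualtw b N]vsubmxK.
by rewrite mul_block_col mul0mx addr0 col_mxKu.
Qed.

Lemma flag_rep_windows k l (M N : 'M[R]_(k + l, n)) p : flag_rep M p ->
  flag_rep N p -> windows_free M -> windows_free N.
Proof.
by move=> Mp Np Mw; have [g [gu _ _ ->]] := flag_rep_eq Mp Np; exact: windows_freeM.
Qed.

(** A nearby flag (W, U) has normalised representatives w and u close to the lower block of [M0] and
    to [M0]. Replacing the lower rows of u by w gives a representative of the flag close to [M0],
    where the matrix construction is continuous. *)
Lemma flag_dual_continuous b k l m (A : set (subspaces R n * subspaces R n)) :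
  (0 < n)%N -> ~~ odd m -> (k + l + m)%N = n ->
  (forall p, A p -> exists2 M : 'M[R]_(k + l, n), flag_rep M p & windows_free M) ->
  {within A, continuous (flag_dual b k l)}.
Proof.
move=> n_gt0 m_even klm Arep; apply/subspace_continuousP => p0 Ap0.
have [M0 M0p M0w] := Arep p0 Ap0; have E0 := flag_dualE b M0p M0w.
case: M0p => M0f M01 M02 Q /=; rewrite /from_subspace E0 => nQ.
pose phi (M : 'M[R]_(k + l, n)) :=
  (rowspan (usubmx (dualtw b M)), rowspan (dualtw b M)).
have nS : nbhs M0 [set M | row_free M /\ Q (phi M)].
  have Tf : row_free (dualtw b M0).
    apply: (@wmx_row_free _ _ _ (k + l) (twist_sign R l) _ 0).
    by rewrite row_free_unit; exact: (dual_windows_unit n_gt0 m_even klm b M0w 0).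
  have Tuf : row_free (usubmx (dualtw b M0)).
    by rewrite usubmxEsub; apply: row_free_rowsub => //; exact: lshift_inj.
  have cT : mcvg (nbhs M0) (dualtw b) (dualtw b M0).
    exact: (mcvg_dualtw M0w (@mcvg_id R _ _ M0)).
  have c1 : rowspan (usubmx (dualtw b M)) @[M --> M0] -->
      (rowspan (usubmx (dualtw b M0)) : subspaces R n).
    apply: (@cvg_comp _ _ _ (fun M => usubmx (dualtw b M)) (@rowspan R n k)); last first.
      exact: rowspan_continuous Tuf.
    exact: (mcvg_cvg (mcvg_usub cT)).
  have c2 : rowspan (dualtw b M) @[M --> M0] -->
      (rowspan (dualtw b M0) : subspaces R n).
    apply: (@cvg_comp _ _ _ (dualtw b) (@rowspan R n (k + l))); last first.
      exact: rowspan_continuous Tf.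
    exact: (mcvg_cvg cT).
  have cphi : phi @ nbhs M0 --> phi M0 by exact: (cvg_pair c1 c2).
  by apply: filterS2 (near_row_free M0f) (cphi Q nQ) => M Mf QM; split.
have M0df : row_free (dsubmx M0).
  by rewrite dsubmxEsub; apply: row_free_rowsub => //; exact: rshift_inj.
have /row_freeP[C M0C] := M0f; have /row_freeP[B M0B] := M0df.
have : nbhs (M0, dsubmx M0) [set uw : 'M[R]_(k + l, n) * 'M[R]_(l, n) |
    row_free (col_mx (usubmx uw.1) uw.2) /\ Q (phi (col_mx (usubmx uw.1) uw.2))].
  pose psi (uw : 'M[R]_(k + l, n) * 'M[R]_(l, n)) := col_mx (usubmx uw.1) uw.2.
  suff cpsi : psi @ nbhs (M0, dsubmx M0) --> M0 by exact: cpsi nS.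
  have c1 : mcvg (nbhs (M0, dsubmx M0)) fst M0.
    move=> i j; apply: (@cvg_comp _ _ _ fst (fun M : 'M[R]_(k + l, n) => M i j) _ (nbhs M0)).
      exact: cvg_fst.
    exact: coord_continuous.
  have c2 : mcvg (nbhs (M0, dsubmx M0)) snd (dsubmx M0).
    move=> i j; apply: (@cvg_comp _ _ _ snd (fun M : 'M[R]_(l, n) => M i j) _ (nbhs (dsubmx M0))).
      exact: cvg_snd.
    exact: coord_continuous.
  suff cpsi' : psi @ nbhs (M0, dsubmx M0) --> col_mx (usubmx M0) (dsubmx M0).
    by rewrite vsubmxK in cpsi'.
  exact: (mcvg_cvg (mcvg_col_mx (mcvg_usub c1) c2)).
case=> -[P1 P2] [/= nP1 nP2] P12.
have n1 := normalized_nbhs M0B nP2; have n2 := normalized_nbhs M0C nP1.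
rewrite M01 in n1; rewrite M02 in n2.
exists (normalized B P2, normalized C P1) => // -[W U] /= [NW NU] Ap.
have [w [[wf wW] _ Pw]] := NW; have [u [[uf uU] _ Pu]] := NU.
have [Mf QM] := P12 (u, w) (conj Pu Pw).
have [M Mp Mw] := Arep _ Ap.
pose N := col_mx (usubmx u) w.
have Np : flag_rep N (W, U).
  split; rewrite /N /= ?col_mxKd //; rewrite -uU; apply: rowspan_eqmx.
  (* The ranks agree, so an inclusion suffices; it holds for the rows of w because W is contained in
     U. *)
  apply/eqmxP; rewrite -(mxrank_leqif_eq _) ?(eqP Mf) ?(eqP uf) //.
  rewrite -addsmxE addsmx_sub; apply/andP; split.
    by rewrite -[X in (_ <= X)%MS]vsubmxK -addsmxE addsmxSl.
  case: Mp => _ /= M1 M2; rewrite -rowspanS wW uU -M1 -M2 rowspanS.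
  by rewrite -[X in (_ <= X)%MS]vsubmxK -addsmxE addsmxSr.
by rewrite (flag_dualE b Np (flag_rep_windows Mp Np Mw)).
Qed.

End FlagDual.

(** * Amplituhedron cells in terms of matrices *)

Section CellFlags.
Variables (R : realType) (n : nat).

(** With k and l exchanged this also describes the cells of the target, so the same lemmas serve the
    map and its inverse. *)
Definition cell_flags (k l : nat) (f : int -> int) : set (subspaces R n * subspaces R n) :=
  [set p | exists V : 'M[R]_(k, n), exists X : 'M[R]_(l, n),
    [/\ row_free V, positroid_cell R n k f (rowspan V), is_gpos X &
        p = (rowspan (altx X), rowspan (col_mx V (altx X)))]].

Lemma positroid_cell_rep (k : nat) f (V : subspaces R n) : positroid_cell R n k f V ->
  exists2 M : 'M[R]_(k, n), row_free M & V = rowspan M.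
Proof. by move=> [[M [Mf <-] _] _]; exists M. Qed.

Lemma amplituhedron_cellE k l m f : (k + l + m)%N = n ->
  amplituhedron_cell R n m k f = cell_flags k l f.
Proof.
move=> klm; have kml : (k + m + l)%N = n by rewrite addnAC.
apply/seteqP; split=> p.
  move=> [[V W] /= [VC /(Gr_perp_posP _ kml)[X Xp ->]] <-].
  have [M Mf VM] := positroid_cell_rep VC.
  exists M, X; split=> //; first by rewrite -VM.
  by rewrite /Zmap /= VM rowspan_col_mx.
move=> [V [X [Vf VC Xp ->]]]; exists (rowspan V, rowspan (altx X)).
  by split=> //=; apply/(Gr_perp_posP _ kml); exists X.
by rewrite /Zmap /= rowspan_col_mx.
Qed.

Lemma amplituhedron_cell_opE k l m f : (k + l + m)%N = n ->
  amplituhedron_cell_op R n m l f = cell_flags l k f.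
Proof.
move=> klm; have lmk : (l + m + k)%N = n by rewrite -klm addnC addnA.
apply/seteqP; split=> p.
  move=> [[W V] /= [/(Gr_perp_posP _ lmk)[X Xp ->] VC] <-].
  have [M Mf VM] := positroid_cell_rep VC.
  exists M, X; split=> //; first by rewrite -VM.
  by rewrite /Zmap_op /= VM rowspan_col_mx addvC.
move=> [V [X [Vf VC Xp ->]]]; exists (rowspan (altx X), rowspan V).
  by split=> //=; apply/(Gr_perp_posP _ lmk); exists X.
by rewrite /Zmap_op /= rowspan_col_mx addvC.
Qed.

Lemma amplituhedronE k l m : (k + l + m)%N = n ->
  amplituhedron R n m k = \bigcup_(f in affine_perm n k l) cell_flags k l f.
Proof.
move=> klm; have kml : (k + m + l)%N = n by rewrite addnAC.
have lE : (n - k - m)%N = l by lia.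
apply/seteqP; split=> p.
  move=> [/(Gr_perp_posP _ kml)[X Xp p1] [V [f fS VC] p2]]; rewrite lE in fS.
  exists f => //; have [M Mf VM] := positroid_cell_rep VC.
  exists M, X; split=> //; first by rewrite -VM.
  by rewrite [p]surjective_pairing p2 p1 VM rowspan_col_mx.
move=> [f fS [V [X [Vf VC Xp ->]]]]; split=> /=.
  by apply/(Gr_perp_posP _ kml); exists X.
exists (rowspan V); last by rewrite rowspan_col_mx.
by exists f; rewrite ?lE.
Qed.

End CellFlags.

Arguments cell_flags R n k l f : clear implicits.

Section CellDual.
Variables (R : realType) (k l m n : nat) (b : bool).
Hypotheses (n_gt0 : (0 < n)%N) (m_even : ~~ odd m) (klm : (k + l + m)%N = n).
Variables (f g : int -> int).
Hypotheses (fS : affine_perm n k l f) (fg : cancel f g) (gf : cancel g f).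
Variables (V : 'M[R]_(k, n)) (X : 'M[R]_(l, n)).
Hypotheses (Vf : row_free V) (VC : positroid_cell R n k f (rowspan V)) (Xp : is_gpos X).
Let M := col_mx V (altx X).

Lemma cell_windows_free : windows_free M.
Proof.
have [c c0 cV] : exists2 c, c != 0 & gnn c V by apply/Gr_nonnegP => //; case: VC.
by have [] := is_gnn_dual n_gt0 m_even klm false cV c0 Xp
  (cell_window_free n_gt0 m_even klm fS Vf VC).
Qed.

Lemma cell_flag_rep : flag_rep M (rowspan (altx X), rowspan M).
Proof.
split; rewrite /M ?col_mxKd //.
apply: (@wmx_row_free _ _ _ (k + l) (twist_sign R k) _ 0).
by rewrite row_free_unit; exact: (cell_windows_free 0).
Qed.

Lemma dual_is_cell :
  [/\ row_free (dsubmx (dualtw b M)),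
      positroid_cell R n l g (rowspan (dsubmx (dualtw b M))) &
      is_gpos (altx (usubmx (dualtw b M)))].
Proof.
have Mw := cell_windows_free.
have [c c0 cV] : exists2 c, c != 0 & gnn c V by apply/Gr_nonnegP => //; case: VC.
have [_ tp [d d0 dT]] := is_gnn_dual n_gt0 m_even klm b cV c0 Xp
  (cell_window_free n_gt0 m_even klm fS Vf VC).
have Tf : row_free (dsubmx (dualtw b M)).
  rewrite dsubmxEsub; apply: row_free_rowsub; last exact: rshift_inj.
  apply: (@wmx_row_free _ _ _ (k + l) (twist_sign R l) _ 0).
  by rewrite row_free_unit; exact: (dual_windows_unit n_gt0 m_even klm b Mw 0).
split=> //; split; first by apply/Gr_nonnegP => //; exists d.
move=> N [Nf NT] a a' aa'.
have [h hu ->] := rowspan_eq Nf NT.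
rewrite cyclic_columnsE /wmx mcols_mul eqmxMfull ?row_full_unit //.
rewrite -[mcols _ _ _]/(wmx _ _ _ _) -cyclic_columnsE.
exact: (dual_cell n_gt0 m_even klm fS Vf VC b Mw fg gf aa').
Qed.

Lemma flag_dual_cell : cell_flags R n l k g (flag_dual b k l (rowspan (altx X), rowspan M)).
Proof.
rewrite (flag_dualE b cell_flag_rep cell_windows_free).
have [Tf TC Tp] := dual_is_cell.
exists (dsubmx (dualtw b M)), (altx (usubmx (dualtw b M))); split=> //.
rewrite altxK; congr pair; apply: rowspan_eqmx.
rewrite -{1}[dualtw b M]vsubmxK; apply/eqmxP; rewrite -!addsmxE.
by rewrite addsmxC; apply/eqmxP.
Qed.

(** By [dualtw_involutive] the second dual is a nonzero multiple of [M] with its blocks exchanged;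
    its upper block spans the original smaller subspace and the whole matrix the larger one. *)
Lemma flag_dualK :
  flag_dual (~~ b) l k (flag_dual b k l (rowspan (altx X), rowspan M)) =
  (rowspan (altx X), rowspan M).
Proof.
have Mw := cell_windows_free; have Mp := cell_flag_rep.
have Tw := dual_windows_unit n_gt0 m_even klm b Mw.
have sw (A : 'M[R]_(k + l, n)) : rowspan (swapmx A) = rowspan A.
  by rewrite rowspan_col_mx addvC -rowspan_col_mx vsubmxK.
rewrite (flag_dualE b Mp Mw); set T := dualtw b M.
have Sp : flag_rep (swapmx T) (rowspan (usubmx T), rowspan T).
  split; rewrite ?sw // ?col_mxKd //.
  apply: (@wmx_row_free _ _ _ (l + k) (twist_sign R l) _ 0).
  by rewrite row_free_unit; exact: (windows_free_swap Tw 0).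
rewrite (flag_dualE (~~ b) Sp (windows_free_swap Tw)).
have [s s0 ->] := dualtw_involutive n_gt0 m_even klm b Mw.
have su p : s%:M \in @unitmx R p by rewrite unitmxE det_scalar unitfE expf_neq0.
have -> : usubmx (s *: swapmx M) = s%:M *m dsubmx M.
  rewrite mul_scalar_mx -[in RHS](col_mxKu (dsubmx M) (usubmx M)).
  by apply/matrixP => i j; rewrite [LHS]mxE [LHS]mxE [RHS]mxE [X in _ = _ * X]mxE.
by rewrite -mul_scalar_mx !rowspan_unit ?sw // /M col_mxKd.
Qed.

End CellDual.

Lemma homeo_betweenP (S T : topologicalType) (A : set S) (B : set T)
    (F : S -> T) (G : T -> S) :
  (forall x, A x -> B (F x)) -> (forall y, B y -> A (G y)) ->
  (forall x, A x -> G (F x) = x) -> (forall y, B y -> F (G y) = y) ->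
  {within A, continuous F} -> {within B, continuous G} -> homeo_between A B F.
Proof.
move=> AB BA GF FG cF cG; split=> //; last by exists G.
split=> [x Ax|x y /set_mem Ax /set_mem Ay E|y By]; first exact: AB.
  by rewrite -(GF x Ax) E GF.
by exists (G y); [exact: BA | exact: FG].
Qed.

(** * Comparison with the stacked twist map *)

Section StackedTwistLink.
Variables (R : realType) (k l n : nat) (V : 'M[R]_(k, n)) (W : 'M[R]_(l, n)).
Hypothesis Mw : windows_free (col_mx V W).

Lemma windows_free_twistable : twistable V W.
Proof.
move=> j; pose A := wmx (twist_sign R k) (col_mx V W) (j - l%:Z) (k + l).
have Au : A \in unitmx by exact: Mw.
rewrite basisEdim size_map size_iota dimvf /dim /= muln1 leqnn andbT.
apply/subvP => u _; rewrite -(mulKVmx Au u).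
set v := invmx A *m u.
have -> : A *m v = \sum_t v t 0 *: col t A.
  apply/colP => i; rewrite mxE summxE; apply: eq_bigr => t _.
  by rewrite [RHS]mxE mulrC [X in _ = _ * X]mxE.
apply: rpred_sum => t _; apply: rpredZ; apply: memv_span.
apply/mapP; exists (nat_of_ord t); first by rewrite mem_iota add0n ltn_ord.
by apply/colP => i; rewrite !mxE.
Qed.

(** The choice in [twisted_col] is forced: its equations are those of [is_dual], with exactly one
    solution. *)
Lemma twisted_mxE : twisted_mx V W = dualtw false (col_mx V W).
Proof.
apply/matrixP => i c; rewrite [LHS]mxE [RHS]mxE.
suff -> : twisted_col V W (c : nat).+1%:Z = dualcol false (col_mx V W) (c : nat).+1%:Z by [].
set j := (c : nat).+1%:Z.
have Uu : Uwin false (col_mx V W) j \in unitmx by exact: Mw.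
rewrite /twisted_col; set P := [set u | _].
have PE u : P u <-> is_dual false (col_mx V W) j u.
  split=> H i' /= ij; have := H i'; rewrite /= ?addr0 in ij *; move=> /(_ ij).
    by rewrite /cdot /stacked_col => ->; case: eqP => _; rewrite ?mulr1 ?mulr0.
  by rewrite /cdot /stacked_col => ->; case: eqP => _; rewrite ?mulr1 ?mulr0.
apply: xget_subset1; first by apply/PE; exact: dualcolP.
by move=> u v /PE /(dualcol_uniq Uu) -> /PE /(dualcol_uniq Uu) ->.
Qed.

End StackedTwistLink.

(** The chosen representatives differ from [V] and [W] by a block diagonal factor. Its inverse
    transpose is block diagonal too, so each half of the dual keeps its row span. *)
Lemma theta_rowspan (R : realType) (k l n : nat) (V : 'M[R]_(k, n)) (W : 'M[R]_(l, n)) :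
  windows_free (col_mx V W) -> row_free V -> row_free W ->
  theta k l (rowspan V, rowspan W) = stacked_twist V W.
Proof.
move=> Mw Vf Wf; rewrite /theta /=.
have rep r (N : 'M[R]_(r, n)) : row_free N ->
    exists2 g : 'M[R]_r, g \in unitmx & representative r (rowspan N) = g *m N.
  move=> Nf; have [Rf RN] : represents (representative r (rowspan N)) (rowspan N).
    by apply: (@xgetPex _ 0 [set M : 'M[R]_(r, n) | represents M (rowspan N)]); exists N.
  exact: rowspan_eq.
have [g gu ->] := rep _ _ Vf; have [h hu ->] := rep _ _ Wf.
pose d := block_mx g 0 0 h.
have du : d \in unitmx by rewrite unitmxE det_ublock unitrM -!unitmxE gu.
have dM : col_mx (g *m V) (h *m W) = d *m col_mx V W.
  by rewrite mul_block_col !mul0mx addr0 add0r.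
have dMw := windows_freeM du Mw.
have TE := dualtw_mul false du Mw.
rewrite /stacked_twist !twisted_mxE ?dM //.
set T := dualtw false _ in TE *; set T' := dualtw false (col_mx V W) in TE *.
have {}TE : T' = col_mx (g^T *m usubmx T) (h^T *m dsubmx T).
  rewrite -TE -{1}[T]vsubmxK tr_block_mx !trmx0 mul_block_col.
  by rewrite !mul0mx addr0 add0r.
by rewrite TE col_mxKu col_mxKd !rowspan_unit ?unitmx_tr.
Qed.

Lemma affine_perm_inverse (n k l : nat) (f : int -> int) : (0 < n)%N ->
  affine_perm n k l f ->
  exists g, [/\ affine_perm n l k g, cancel f g & cancel g f].
Proof.
move=> n_gt0 fS; have [[g fg gf] _ _ _] := fS.
by exists g; split=> //; exact: affine_perm_inv fS.
Qed.

Section AmplituhedronDual.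
Variables (R : realType) (k l m n : nat).
Hypotheses (n_gt0 : (0 < n)%N) (m_even : ~~ odd m) (klm : (k + l + m)%N = n).

Lemma cell_flags_rep f p : affine_perm n k l f -> cell_flags R n k l f p ->
  exists2 M : 'M[R]_(k + l, n), flag_rep M p & windows_free M.
Proof.
move=> fS [V [X [Vf VC Xp ->]]]; exists (col_mx V (altx X)).
  exact: (cell_flag_rep n_gt0 m_even klm fS Vf VC Xp).
exact: (cell_windows_free n_gt0 m_even klm fS Vf VC Xp).
Qed.

Lemma flag_dual_cell_flags b f g p : affine_perm n k l f -> cancel f g -> cancel g f ->
  cell_flags R n k l f p ->
  cell_flags R n l k g (flag_dual b k l p) /\ flag_dual (~~ b) l k (flag_dual b k l p) = p.
Proof.
move=> fS fg gf [V [X [Vf VC Xp ->]]]; split.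
  exact: (flag_dual_cell b n_gt0 m_even klm fS fg gf Vf VC Xp).
exact: (flag_dualK b n_gt0 m_even klm fS Vf VC Xp).
Qed.

Lemma flag_dual_amplituhedron b p : amplituhedron R n m k p ->
  amplituhedron R n m l (flag_dual b k l p) /\
  flag_dual (~~ b) l k (flag_dual b k l p) = p.
Proof.
rewrite (amplituhedronE _ klm) => -[f fS pf].
have [g [gS fg gf]] := affine_perm_inverse n_gt0 fS.
have [? ?] := flag_dual_cell_flags b fS fg gf pf; split=> //.
by rewrite (amplituhedronE _ (lkm klm)); exists g.
Qed.

Lemma amplituhedron_rep p : amplituhedron R n m k p ->
  exists2 M : 'M[R]_(k + l, n), flag_rep M p & windows_free M.
Proof. by rewrite (amplituhedronE _ klm) => -[f fS]; exact: cell_flags_rep. Qed.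

Lemma amplituhedron_flags : amplituhedron R n m k `<=` flags R n l (k + l).
Proof.
move=> p /amplituhedron_rep[M [Mf M1 M2] _]; rewrite /flags /= -M1 -M2.
split; last exact: dim_rowspan.
  by rewrite rowspanS -[X in (_ <= X)%MS]vsubmxK -addsmxE addsmxSr.
by apply: dim_rowspan; rewrite dsubmxEsub; apply: row_free_rowsub => //; exact: rshift_inj.
Qed.

Lemma Gr_ge_windows_free (V : 'M[R]_(k, n)) (W : 'M[R]_(l, n)) :
  row_free V -> row_free W -> Gr_ge R n m k (rowspan V) ->
  Gr_perp_pos R n (k + m) (rowspan W) -> windows_free (col_mx V W).
Proof.
move=> Vf Wf [f fS VC]; have kml : (k + m + l)%N = n by rewrite addnAC.
move=> /(Gr_perp_posP _ kml)[X Xp WX].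
have lE : (n - k - m)%N = l by lia.
rewrite lE in fS.
have [h hu ->] := rowspan_eq Wf WX.
pose d : 'M[R]_(k + l) := block_mx 1%:M 0 0 h.
have du : d \in unitmx by rewrite unitmxE det_ublock det1 mul1r -unitmxE.
have -> : col_mx V (h *m altx X) = d *m col_mx V (altx X).
  by rewrite mul_block_col !mul0mx mul1mx addr0 add0r.
exact: windows_freeM du (cell_windows_free n_gt0 m_even klm fS Vf VC Xp).
Qed.

(** Both maps are computed from one dual matrix: [theta] takes the spans of its two halves,
    [flag_dual] those of its upper half and of the whole. *)
Lemma theta_dual p : (Gr_ge R n m k `*` Gr_perp_pos R n (k + m)) p ->
  (Gr_perp_pos R n (l + m) `*` Gr_ge R n m l) (theta k l p) /\
  flag_dual false k l (Zmap p) = Zmap_op (theta k l p).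
Proof.
have kml : (k + m + l)%N = n by rewrite addnAC.
have lmk : (l + m + k)%N = n by lia.
case: p => V0 W0 [VG /(Gr_perp_posP _ kml)[X Xp WX]].
have {}WX : W0 = rowspan (altx X) by [].
case: VG => f fS VC; have [V Vf VE] := positroid_cell_rep VC.
have {}VE : V0 = rowspan V by [].
rewrite /= VE in VC; rewrite WX VE.
have lE : (n - k - m)%N = l by lia.
have kE : (n - l - m)%N = k by lia.
rewrite lE in fS; have [g [gS fg gf]] := affine_perm_inverse n_gt0 fS.
have Mw := cell_windows_free n_gt0 m_even klm fS Vf VC Xp.
have Mp := cell_flag_rep n_gt0 m_even klm fS Vf VC Xp.
have [Tf TC Tp] := dual_is_cell false n_gt0 m_even klm fS fg gf Vf VC Xp.
have Xf : row_free (altx X).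
  have [c cX] := Xp; rewrite row_free_altx; apply: gpos_row_free cX.
  by rewrite -kml leq_addl.
rewrite (theta_rowspan Mw Vf Xf) /stacked_twist (twisted_mxE Mw); split.
  split=> /=; last by exists g; rewrite ?kE.
  apply/(Gr_perp_posP _ lmk); exists (altx (usubmx (dualtw false (col_mx V (altx X))))) => //.
  by rewrite altxK.
rewrite /Zmap /Zmap_op /= -!rowspan_col_mx vsubmxK.
by rewrite (flag_dualE false Mp Mw).
Qed.

End AmplituhedronDual.

Theorem theorem7p3 (R : realType) (k l m n : nat)
    (n_ge2 : (2 <= n)%N) (m_even : ~~ odd m) (klm : (k + l + m)%N = n) :
  let dom := Gr_ge R n m k `*` Gr_perp_pos R n (k + m) in
  let codom := Gr_perp_pos R n (l + m) `*` Gr_ge R n m l in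
  (forall (V : 'M[R]_(k, n)) (W : 'M[R]_(l, n)),
     row_free V -> row_free W -> dom (rowspan V, rowspan W) ->
     twistable V W /\ theta k l (rowspan V, rowspan W) = stacked_twist V W) /\
  (forall p, dom p -> codom (theta k l p)) /\
  amplituhedron R n m k `<=` flags R n l (k + l) /\
  amplituhedron R n m l `<=` flags R n k (k + l) /\
  exists theta_t : subspaces R n * subspaces R n ->
                   subspaces R n * subspaces R n,
    homeo_between (amplituhedron R n m k) (amplituhedron R n m l) theta_t /\
    (forall p, dom p -> theta_t (Zmap p) = Zmap_op (theta k l p)) /\
    (forall f g : int -> int,
       affine_perm n k l f -> cancel f g -> cancel g f ->
       homeo_between (amplituhedron_cell R n m k f)
                     (amplituhedron_cell_op R n m l g) theta_t).
Proof.
have n_gt0 : (0 < n)%N by exact: ltnW.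
have lkm := lkm klm.
split.
  move=> V W Vf Wf [/= VG WG].
  have Mw := Gr_ge_windows_free n_gt0 m_even klm Vf Wf VG WG.
  by split; [exact: windows_free_twistable | exact: theta_rowspan].
split; first by move=> p pd; have [] := theta_dual n_gt0 m_even klm pd.
split; first exact: (amplituhedron_flags n_gt0 m_even klm).
split; first by rewrite (addnC k); exact: (amplituhedron_flags n_gt0 m_even lkm).
exists (flag_dual false k l); split; [|split].
- apply: (@homeo_betweenP _ _ _ _ _ (flag_dual true l k)).
  + by move=> p /(flag_dual_amplituhedron n_gt0 m_even klm false)[].
  + by move=> p /(flag_dual_amplituhedron n_gt0 m_even lkm true)[].
  + by move=> p /(flag_dual_amplituhedron n_gt0 m_even klm false)[].
  + by move=> p /(flag_dual_amplituhedron n_gt0 m_even lkm true)[].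
  + apply: (flag_dual_continuous n_gt0 m_even klm) => p.
    exact: (amplituhedron_rep n_gt0 m_even klm).
  + apply: (flag_dual_continuous n_gt0 m_even lkm) => p.
    exact: (amplituhedron_rep n_gt0 m_even lkm).
- by move=> p pd; have [] := theta_dual n_gt0 m_even klm pd.
move=> f g fS fg gf; rewrite (amplituhedron_cellE _ _ klm) (amplituhedron_cell_opE _ _ klm).
have gS := affine_perm_inv n_gt0 fg gf fS.
apply: (@homeo_betweenP _ _ _ _ _ (flag_dual true l k)).
- by move=> p /(flag_dual_cell_flags n_gt0 m_even klm false fS fg gf)[].
- by move=> p /(flag_dual_cell_flags n_gt0 m_even lkm true gS gf fg)[].
- by move=> p /(flag_dual_cell_flags n_gt0 m_even klm false fS fg gf)[].
- by move=> p /(flag_dual_cell_flags n_gt0 m_even lkm true gS gf fg)[].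
- apply: (flag_dual_continuous n_gt0 m_even klm) => p.
  exact: (cell_flags_rep n_gt0 m_even klm fS).
apply: (flag_dual_continuous n_gt0 m_even lkm) => p.
exact: (cell_flags_rep n_gt0 m_even lkm gS).
Qed.
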